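(* Let $p\ge5$, let $\lambda=\lambda_j$ be a simple eigenvalue, and let $\delta_2,\Lambda_{\rm qo},\Lambda_{\rm sep}>0$ be constants such that properties (i)–(iv) of the context hold for all $\mathcal T\in\mathbb T(\delta_2)$. Then there exists a constant $\Lambda_1>0$ such that for every $\mathcal T\in\mathbb T(\delta_2)$ and every refinement $\widehat{\mathcal T}\in\mathbb T$ of $\mathcal T$, the error estimators $\eta$ on $\mathcal T$ and $\widehat\eta$ on $\widehat{\mathcal T}$ satisfy (stability) $$\bigl|\widehat\eta(\mathcal T\cap\widehat{\mathcal T})-\eta(\mathcal T\cap\widehat{\mathcal T})\bigr|\le\Lambda_1\,|||\widehat u_h-u_h|||.$$
   Context: Continuous problem. $\Omega\subset\mathbb R^2$ is a bounded Lipschitz domain with polygonal boundary, $V:=H^2_0(\Omega)$, $a(u,v):=\int_\Omega D^2u:D^2v\,dx$ with norm $|||v|||:=a(v,v)^{1/2}$ on $V$, and $b(u,v):=\int_\Omega uv\,dx$ with norm $\|v\|:=\|v\|_{L^2(\Omega)}$. The eigenvalues $0<\lambda_1\le\lambda_2\le\dots\to\infty$ of $a(u,v)=\lambda b(u,v)$ for all $v\in V$ are enumerated with multiplicity, $\lambda_0:=0$. $j\in\mathbb N$ is fixed, $\lambda=\lambda_j$ is simple, and $u\in V$ with $\|u\|=1$ is a fixed corresponding eigenvector. Triangulations. $\mathbb T$ is the set of all regular triangulations of $\Omega$ obtained by newest-vertex bisection (NVB) from a fixed initial triangulation $\mathcal T_{\rm init}$ (hence uniformly shape-regular); $\mathbb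 T(\delta)$ is the subset of those with maximal triangle diameter $h_{\max}\le\delta$. Triangulations are sets of triangles, so $\mathcal T\cap\widehat{\mathcal T}$ is the set of triangles belonging to both. Discrete spaces (hierarchical Argyris spaces). $A_p(\mathcal T)$ is the set of all $v_h\in V$ that are polynomials of degree at most $p$ on every triangle of $\mathcal T$ and whose Hessian is continuous at every vertex of $\mathcal T$. For a sequence $\mathcal T_{\rm init}=\mathcal S_0,\dots,\mathcal S_m=\mathcal T$ of successive one-level NVB refinements (each triangle is divided into at most four sub-triangles by bisection of refinement edges), $V(\mathcal T):=A_p(\mathcal S_0)+\dots+A_p(\mathcal S_m)$; this depends only on $\mathcal T$, and $V(\mathcal T)\subset V(\widehat{\mathcal T})\subset V$ for refinements $\widehat{\mathcal T}$ of $\mathcal T$. Discrete problem. With $N=\dim V(\mathcal T)$, let $0<\lambda_h^{(1)}\le\dots\le\lambda_h^{(N)}$ be the discrete eigenvalues, counted with multiplicity, of $a(u_h,v_h)=\lambda_hb(u_h,v_h)$ for all $v_h\in V(\mathcal T)$, with $u_h\in V(\mathcal T)$, $\|u_h\|=1$; $\lambda_h^{(0)}:=0$ and $\lambda_h^{(k)}:=\infty$ for $k>N$. $(\lambda_h,u_h)$ is the discrete eigenpair number $j$ on $\mathcal T$ with $b(u,u_h)\ge0$; $(\widehat\lambda_h,\widehat u_h)$ denotes the same for $\widehat{\mathcal T}$. Properties for $\mathcal T\in\mathbb T(\delta_2)$: (i) $\dim V(\mathcal T)\ge j$ and ${\rm LB}:=|||u-u_h|||^2+\lambda_h-\lambda+\|u-u_h\|^2\le\Lambda_{\rm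 qo}\min_{v_h\in V(\mathcal T)}|||u-v_h|||^2$; (ii) ${\rm LB}<1/2$; (iii) $\lambda_{j-1}\le\lambda_h^{(j-1)}<\lambda_j\le\lambda_h^{(j)}<\lambda_{j+1}\le\lambda_h^{(j+1)}$; (iv) $\max\bigl\{\lambda_j/(\lambda_j-\lambda_h^{(j-1)}),\ \lambda_h^{(j)}/(\lambda_h^{(j+1)}-\lambda_h^{(j)})\bigr\}\le\Lambda_{\rm sep}$. Error estimators. For $T\in\mathcal T$ with area $|T|$, $$\eta^2(T)=|T|^2\|\lambda_hu_h-\Delta^2u_h\|_{L^2(T)}^2+|T|^{1/2}\|[\partial^2_{\nu\nu}u_h]_E\|^2_{L^2(\partial T\cap\Omega)}+|T|^{3/2}\|[\partial_\nu\Delta u_h]_E\|^2_{L^2(\partial T\cap\Omega)},$$ where $[\bullet]_E$ is the jump across interior edges $E$ and $\nu$ is a unit normal of the edge. For $T\in\widehat{\mathcal T}$, $\widehat\eta^2(T)$ is defined by the same formula with $(\widehat\lambda_h,\widehat u_h)$ and the edges of $\widehat{\mathcal T}$. For a set $\mathcal M$ of triangles, $\eta(\mathcal M):=(\sum_{T\in\mathcal M}\eta^2(T))^{1/2}$, and analogously for $\widehat\eta$. The constant $\Lambda_1$ is independent of $\mathcal T$ and $\widehat{\mathcal T}$. *)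

(* Defs.v *)
From HB Require Import structures.
From mathcomp Require Import all_boot all_order all_algebra finmap.
From mathcomp Require Import all_classical all_reals all_analysis.

Set Implicit Arguments.
Unset Strict Implicit.
Unset Printing Implicit Defensive.

Import Order.TTheory GRing.Theory Num.Theory.
Import numFieldNormedType.Exports.

Local Open Scope classical_set_scope.
Local Open Scope ring_scope.

Notation plane R := (R * R)%type.

(** * The Euclidean plane *)

Section Plane.
Context {R : realType}.
Implicit Types (x y a b e : plane R) (A : set (plane R)).

Definition mu2 :
    {measure set (measurableTypeR R * measurableTypeR R)%type -> \bar R} :=
  (@lebesgue_measure R \x @lebesgue_measure R)%E.

(* The library norm of a product is the maximum norm, hence this one. *)
Definition enorm x : R := Num.sqrt (x.1 ^+ 2 + x.2 ^+ 2).

Definition rot90 x : plane R := (- x.2, x.1).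

Definition segment a b : set (plane R) :=
  [set (1 - t) *: a + t *: b | t in `[0, 1]].

Definition boundary A : set (plane R) := closure A `\` A°.

(* Near every boundary point, A lies strictly above the graph of a Lipschitz
   function in some orthonormal frame (e, rot90 e). *)
Definition lipschitz_boundary A : Prop :=
  forall x, boundary A x ->
  exists e (r h L : R) (g : R -> R),
    [/\ enorm e = 1, 0 < r, 0 < h,
        (forall s t, `|g s - g t| <= L * `|s - t|) &
        forall s t, `|s| < r -> `|t| < h ->
          (A (x + s *: e + t *: rot90 e) <-> g s < t)].

Definition polygonal_boundary A : Prop :=
  exists E : seq (plane R * plane R),
    boundary A = [set x | exists2 ab, ab \in E & segment ab.1 ab.2 x].

Definition polygonal_lipschitz_domain A : Prop :=
  [/\ A !=set0, open A, connected A & bounded_set A] /\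
  lipschitz_boundary A /\ polygonal_boundary A.

End Plane.

(** * The space H^2_0(Omega) *)

Section Sobolev.
Context {R : realType}.
Implicit Types (f g v w phi : plane R -> R) (Omega : set (plane R)).

Definition basis_vec (i : 'I_2) : plane R := ((i == 0)%:R, (i == 1)%:R).

Definition pd (i : 'I_2) f : plane R -> R := fun x => 'D_(basis_vec i) f x.

Definition pds (s : seq 'I_2) f : plane R -> R := foldr pd f s.

Definition smooth f : Prop :=
  forall s : seq 'I_2, continuous (pds s f) /\
    forall i x, derivable (pds s f) x (basis_vec i).

Definition test_function Omega phi : Prop :=
  smooth phi /\
  exists C, [/\ compact C, C `<=` Omega & forall x, ~ C x -> phi x = 0].

Definition L2 Omega f : Prop :=
  measurable_fun (Omega : set (measurableTypeR R * measurableTypeR R)) f /\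
  mu2.-integrable Omega (fun x => (f x ^+ 2)%:E).

Definition is_weak_deriv Omega (s : seq 'I_2) v g : Prop :=
  L2 Omega g /\
  forall phi, test_function Omega phi ->
    \int[mu2]_(x in Omega) (v x * pds s phi x) =
    (-1) ^+ size s * \int[mu2]_(x in Omega) (g x * phi x).

(* A representative of the weak derivative, unique up to null sets. *)
Definition wderiv Omega (s : seq 'I_2) v : plane R -> R :=
  xget (fun=> 0) [set g | is_weak_deriv Omega s v g].

Definition multi_indices2 : seq (seq 'I_2) :=
  [:: [::]] ++ [seq [:: i] | i <- enum 'I_2] ++
  [seq [:: i; k] | i <- enum 'I_2, k <- enum 'I_2].

(* Closure of the test functions in the H^2 norm; elements are represented by
   functions on the whole plane that are extended by zero outside Omega. *)
Definition H20 Omega : set (plane R -> R) := [set v |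
  [/\ (forall x, ~ Omega x -> v x = 0),
      L2 Omega v,
      (forall s, s \in multi_indices2 -> exists g, is_weak_deriv Omega s v g) &
      forall eps : R, 0 < eps -> exists2 phi, test_function Omega phi &
        \sum_(s <- multi_indices2)
          \int[mu2]_(x in Omega) ((wderiv Omega s v x - pds s phi x) ^+ 2)
        < eps]].

Definition form_a Omega v w : R :=
  \sum_(i < 2) \sum_(k < 2) \int[mu2]_(x in Omega)
    (wderiv Omega [:: i; k] v x * wderiv Omega [:: i; k] w x).

Definition form_b Omega v w : R := \int[mu2]_(x in Omega) (v x * w x).

Definition norm_a Omega v : R := Num.sqrt (form_a Omega v v).

Definition norm_b Omega v : R := Num.sqrt (form_b Omega v v).

End Sobolev.

(** * Eigenvalues of a(u, v) = lambda b(u, v) on a space W of functions *)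

Section Eigenvalues.
Context {R : realType}.
Implicit Types (Omega : set (plane R)) (W : set (plane R -> R)).

(* The dimension of W, functions being identified if they agree a.e. *)
Definition has_dim W (m : nat) : Prop :=
  exists e : 'I_m -> plane R -> R,
    [/\ (forall i, W (e i)),
        (forall c : 'I_m -> R,
           {ae @mu2 R, forall x, \sum_(i < m) c i * e i x = 0} ->
           forall i, c i = 0) &
        forall w, W w -> exists c : 'I_m -> R,
           {ae @mu2 R, forall x, w x = \sum_(i < m) c i * e i x}].

Definition eigenfunctions Omega W (l : R) : set (plane R -> R) :=
  [set w | W w /\ forall v, W v -> form_a Omega w v = l * form_b Omega w v].

(* lam 1 <= lam 2 <= ... lists every eigenvalue as often as its multiplicity *)
Definition enumerates_eigenvalues Omega W (lam : nat -> \bar R) : Prop :=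
  {homo lam : k l / (k <= l)%N >-> (k <= l)%E} /\
  forall l : R, exists2 m, has_dim (eigenfunctions Omega W l) m &
    ([set k | (0 < k)%N /\ lam k = l%:E] #= `I_m)%card.

Definition continuous_eigenvalues Omega (lam : nat -> R) : Prop :=
  [/\ lam 0%N = 0, (forall k, (0 < k)%N -> 0 < lam k),
      lam @ \oo --> +oo &
      enumerates_eigenvalues Omega (H20 Omega) (fun k => (lam k)%:E)].

Definition discrete_eigenvalues Omega W (lam : nat -> \bar R) : Prop :=
  exists N,
    [/\ has_dim W N, lam 0%N = 0%E,
        (forall k, (0 < k <= N)%N -> (0 < lam k < +oo)%E),
        (forall k, (N < k)%N -> lam k = +oo%E) &
        enumerates_eigenvalues Omega W lam].

Definition eigenpair Omega W (l : R) (w : plane R -> R) : Prop :=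
  eigenfunctions Omega W l w /\ norm_b Omega w = 1.

End Eigenvalues.

(** * Triangulations and newest-vertex bisection *)

(* (z0, z1, z2) is the closed triangle with these vertices, with refinement
   edge z0 z1. Since the bisection rule is deterministic, equal triangles in
   two refinements of the same initial triangulation have equal codes. *)
Notation triangle R := (plane R * plane R * plane R)%type.
Notation triangulation R := {fset triangle R}.

Section Triangulations.
Context {R : realType}.
Implicit Types (K : triangle R) (T S : triangulation R) (Omega : set (plane R)).

Definition vertices K : seq (plane R) := [:: K.1.1; K.1.2; K.2].

Definition edges K : seq (plane R * plane R) :=
  [:: (K.1.1, K.1.2); (K.1.2, K.2); (K.2, K.1.1)].

Definition has_edge K (E : plane R * plane R) : bool :=
  (E \in edges K) || ((E.2, E.1) \in edges K).

Definition tri_set K : set (plane R) :=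
  [set x | exists s t : R, [/\ 0 <= s, 0 <= t, s + t <= 1 &
     x = K.1.1 + s *: (K.1.2 - K.1.1) + t *: (K.2 - K.1.1)]].

Definition area K : R :=
  `|(K.1.2.1 - K.1.1.1) * (K.2.2 - K.1.1.2)
    - (K.2.1 - K.1.1.1) * (K.1.2.2 - K.1.1.2)| / 2.

Definition regular_triangulation Omega T : Prop :=
  [/\ (forall K, K \in T -> 0 < area K),
      closure Omega = [set x | exists2 K, K \in T & tri_set K x] &
      forall K K', K \in T -> K' \in T -> K != K' ->
        [\/ tri_set K `&` tri_set K' = set0,
            exists z, [/\ z \in vertices K, z \in vertices K' &
                          tri_set K `&` tri_set K' = [set z]] |
            exists E, [/\ has_edge K E, has_edge K' E &
                          tri_set K `&` tri_set K' = segment E.1 E.2]]].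

Definition mesh_le T (delta : R) : Prop :=
  forall K, K \in T -> forall x y, tri_set K x -> tri_set K y ->
    enorm (x - y) <= delta.

Definition refmid K : plane R := 2^-1 *: (K.1.1 + K.1.2).

(* The refinement edge of a child is opposite to the new vertex. *)
Definition child1 K : triangle R := (K.2, K.1.1, refmid K).
Definition child2 K : triangle R := (K.1.2, K.2, refmid K).

Inductive nvb T : triangulation R -> Prop :=
| nvb_refl : nvb T T
| nvb_bisect S K : nvb T S -> K \in S ->
    nvb T (child1 K |` (child2 K |` (S `\ K)))%fset.

Definition nvb_triangulation Omega Tinit T : Prop :=
  nvb Tinit T /\ regular_triangulation Omega T.

Definition one_level_patterns K : seq (seq (triangle R)) :=
  let K1 := child1 K in let K2 := child2 K in
  [:: [:: K]; [:: K1; K2];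
      [:: child1 K1; child2 K1; K2]; [:: K1; child1 K2; child2 K2];
      [:: child1 K1; child2 K1; child1 K2; child2 K2]].

Definition one_level_refinement Omega S T : Prop :=
  regular_triangulation Omega T /\
  exists c : triangle R -> seq (triangle R),
    (forall K, K \in S -> c K \in one_level_patterns K) /\
    (forall K', K' \in T <-> exists2 K, K \in S & K' \in c K).

End Triangulations.

(** * Hierarchical Argyris spaces *)

Section Argyris.
Context {R : realType}.
Implicit Types (K : triangle R) (T : triangulation R) (Omega : set (plane R)).
Implicit Types (f v w : plane R -> R).

Definition poly_fun (p : nat) f : Prop :=
  exists c : nat -> nat -> R, forall x,
    f x = \sum_(a < p.+1) \sum_(b < p.+1 | (a + b <= p)%N)
            c a b * x.1 ^+ a * x.2 ^+ b.

Definition is_piece (p : nat) v K f : Prop :=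
  poly_fun p f /\ forall x, tri_set K x -> v x = f x.

(* The polynomial, on the whole plane, that v coincides with on K. *)
Definition piece (p : nat) v K : plane R -> R :=
  xget (fun=> 0) [set f | is_piece p v K f].

(* Functions in A_p are represented pointwise (by their continuous version). *)
Definition argyris Omega (p : nat) T : set (plane R -> R) := [set v |
  [/\ H20 Omega v,
      (forall K, K \in T -> exists f, is_piece p v K f) &
      forall K K' z, K \in T -> K' \in T ->
        z \in vertices K -> z \in vertices K' ->
        forall i k, pds [:: i; k] (piece p v K) z =
                    pds [:: i; k] (piece p v K') z]].

(* A_p(S_0) + ... + A_p(S_m); this does not depend on the chosen chain. *)
Definition hier_argyris Omega (p : nat) (Tinit T : triangulation R) :
    set (plane R -> R) := [set v |
  exists m (S : nat -> triangulation R) (w : nat -> plane R -> R),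
    [/\ S 0%N = Tinit, S m = T,
        (forall l, (l < m)%N -> one_level_refinement Omega (S l) (S l.+1)),
        (forall l, (l <= m)%N -> argyris Omega p (S l) (w l)) &
        v = (fun x => \sum_(l < m.+1) w l x)]].

End Argyris.

(** * Error estimators *)

Section Estimator.
Context {R : realType}.
Implicit Types (K : triangle R) (T M : triangulation R) (Omega : set (plane R)).
Implicit Types (f w : plane R -> R) (E : plane R * plane R).

Definition laplace f : plane R -> R := fun x => \sum_(i < 2) pds [:: i; i] f x.

Definition unit_normal E : plane R :=
  (enorm (E.2 - E.1))^-1 *: rot90 (E.2 - E.1).

Definition d_nunu E f : plane R -> R :=
  fun x => 'D_(unit_normal E) (fun y => 'D_(unit_normal E) f y) x.

Definition d_nu_laplace E f : plane R -> R := fun x => 'D_(unit_normal E) (laplace f) x.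

(* Arc-length integral over the part of the edge E inside Omega. *)
Definition edge_integral Omega E f : R :=
  enorm (E.2 - E.1) *
  \int[@lebesgue_measure R]_(t in
         [set t : R | 0 <= t <= 1 /\ Omega ((1 - t) *: E.1 + t *: E.2)])
    f ((1 - t) *: E.1 + t *: E.2).

(* The jump of G w across the edge E of K; the sum has exactly one term if E
   is an interior edge, and its sign is irrelevant below. *)
Definition jump (p : nat) T w (G : (plane R -> R) -> plane R -> R) K E :
    plane R -> R :=
  fun x => \sum_(K' <- T | (K' != K) && has_edge K' E)
    (G (piece p w K) x - G (piece p w K') x).

Definition eta2 Omega (p : nat) T (l : R) w K : R :=
  area K ^+ 2 *
    \int[mu2]_(x in tri_set K) ((l * w x - laplace (laplace (piece p w K)) x) ^+ 2)
  + area K `^ (1 / 2) *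
    \sum_(E <- edges K)
      edge_integral Omega E (fun x => jump p T w (d_nunu E) K E x ^+ 2)
  + area K `^ (3 / 2) *
    \sum_(E <- edges K)
      edge_integral Omega E (fun x => jump p T w (d_nu_laplace E) K E x ^+ 2).

Definition eta Omega (p : nat) T (l : R) w M : R :=
  Num.sqrt (\sum_(K <- M) eta2 Omega p T l w K).

End Estimator.

(** * Discrete eigenpairs and the standing properties *)

Section Discrete.
Context {R : realType}.
Context (Omega : set (plane R)) (p : nat) (Tinit : triangulation R).
Context (j : nat) (lam : nat -> R) (u : plane R -> R).
Implicit Types (T : triangulation R) (lamh : nat -> \bar R) (uh : plane R -> R).

Local Notation V := (hier_argyris Omega p Tinit).

(* (lh, uh) is the discrete eigenpair number j on T. *)
Definition discrete_eigenpair T lamh (lh : R) uh : Prop :=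
  [/\ discrete_eigenvalues Omega (V T) lamh, lamh j = lh%:E,
      eigenpair Omega (V T) lh uh & 0 <= form_b Omega u uh].

Definition LB (lh : R) uh : R :=
  norm_a Omega (u \- uh) ^+ 2 + lh - lam j + norm_b Omega (u \- uh) ^+ 2.

Definition property_i T (Lqo : R) : Prop :=
  (exists2 N, has_dim (V T) N & (j <= N)%N) /\
  forall lamh lh uh, discrete_eigenpair T lamh lh uh ->
    LB lh uh <= Lqo * inf [set norm_a Omega (u \- vh) ^+ 2 | vh in V T].

Definition property_ii T : Prop :=
  forall lamh lh uh, discrete_eigenpair T lamh lh uh -> LB lh uh < 1 / 2.

Definition property_iii T : Prop :=
  forall lamh, discrete_eigenvalues Omega (V T) lamh ->
    [/\ ((lam j.-1)%:E <= lamh j.-1)%E, (lamh j.-1 < (lam j)%:E)%E,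
        ((lam j)%:E <= lamh j)%E, (lamh j < (lam j.+1)%:E)%E &
        ((lam j.+1)%:E <= lamh j.+1)%E].

(* In case lamh j.+1 = +oo the second quotient is 0. *)
Definition property_iv T (Lsep : R) : Prop :=
  forall lamh, discrete_eigenvalues Omega (V T) lamh ->
    (maxe ((lam j)%:E / ((lam j)%:E - lamh j.-1))
          (lamh j / (lamh j.+1 - lamh j)) <= Lsep%:E)%E.

End Discrete.

(* Main.v *)
(* Both estimators are weighted l^2 norms of volume residuals and jumps, so the
   reverse triangle inequality reduces the claim to bounds for the residuals and
   jumps of e = uhat - uh and of the right-hand sides. If K belongs to both
   triangulations, its neighbours in That are contained in its neighbours in T,
   hence the jumps of the pieces of uh across an edge of K are the same in both.

   Since uh and uhat are piecewise polynomials, every term is then an inverse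
   estimate. A derivative of a polynomial q on K is bounded by the L^2 norm of
   any function having the same integrals as q against all test functions
   supported in K: the coefficients of q are integrals of q against dual
   polynomials times a fixed bump function. Applied to q = D^2 e on K, this
   uses only the weak Hessian of e, and no trace theorem is needed. Uniform
   shape regularity holds because bisection halves both the area and the sum
   |z2 - z1|^2 + |z2 - z0|^2, where z2 is opposite to the refinement edge.

   The right-hand sides differ by lhat e + (lhat - lh) uh. The first part is
   bounded by the Poincare inequality, and lhat - lh is the difference of the
   squared energy norms of uhat and uh, which is at most 2 lam_(j+1)^(1/2) |||e|||
   by property (iii). *)
Require Import Defs.
From mathcomp Require Import all_boot all_order all_algebra finmap.
From mathcomp Require Import all_classical all_reals all_analysis.
From mathcomp Require Import measurable_realfun ring lra.

Set Implicit Arguments.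
Unset Strict Implicit.
Unset Printing Implicit Defensive.

Import Order.TTheory GRing.Theory Num.Theory.
Import numFieldNormedType.Exports.

Local Open Scope classical_set_scope.
Local Open Scope ring_scope.

(** * Square-integrable functions *)

(** Functions of [H20] are known only through weak derivatives, and [wderiv] is an arbitrary
    representative, whereas the estimator contains pointwise derivatives of polynomials on triangles
    and edges. The link between the two is the action on test functions supported inside one
    triangle. This dictates the form of the inverse estimate: on the right stands a function [h]
    that may differ from the polynomial, on the left a pointwise value anywhere on the closed
    triangle, so that edge terms are covered too.

    All lengths on a triangle K are measured by r = [inrad sigma K]. The square of a derivative of
    order 2 + n of e is bounded by r^(-2n-2) times the local energy. Since |K| is of order r^2, the
    weights of the estimator and the size of the triangle or edge compensate exactly: r^4 r^2 r^(-6)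
    in the volume term, r r r^(-2) and r^3 r r^(-4) in the jump terms. Only the difference of the
    right-hand sides keeps a factor |K|^2, which is why a bound [amax] for the areas is carried
    along. *)

Section SquareIntegrable.
Context d (T : measurableType d) (R : realType).
Variable mu : {measure set T -> \bar R}.
Variable D : set T.
Hypothesis mD : measurable D.
Implicit Types f g : T -> R.

(** Kept general because two measures occur: on the plane this unfolds to [L2], and on the parameter
    interval of an edge it serves the jump terms. *)
Definition sqint f :=
  measurable_fun D f /\ mu.-integrable D (fun x => (f x ^+ 2)%:E).

Definition ip f g := \int[mu]_(x in D) (f x * g x).

Lemma sqint_ipP f g : sqint f -> sqint g ->
  mu.-integrable D (fun x => (f x * g x)%:E).
Proof.
move=> [mf f2] [mg g2].
apply: (@le_integrable _ _ _ mu D mD _ (fun x => ((f x ^+ 2)%:E + (g x ^+ 2)%:E)%E)).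
- by apply/measurable_EFinP; exact: measurable_funM.
- move=> x Dx /=; rewrite lee_fin [leRHS]ger0_norm ?addr_ge0 ?sqr_ge0//.
  rewrite normrM -(real_normK (num_real (f x))) -(real_normK (num_real (g x))).
  have := sqr_ge0 (`|f x| - `|g x|); have := sqr_ge0 (`|f x| + `|g x|); nra.
- exact: integrableD.
Qed.

Lemma sqintD f g : sqint f -> sqint g -> sqint (fun x => f x + g x).
Proof.
move=> Hf Hg; have fg := sqint_ipP Hf Hg; case: Hf Hg => [mf f2] [mg g2].
split; first exact: measurable_funD.
have H := integrableD mD (integrableD mD f2 g2) (integrableZl mD 2 fg).
by apply: eq_integrable H => // x _ /=; rewrite -!EFinM -!EFinD; congr EFin; ring.
Qed.

Lemma sqintZ c f : sqint f -> sqint (fun x => c * f x).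
Proof.
move=> [mf f2]; split.
  by apply: measurable_funM => //; exact: measurable_cst.
have H := integrableZl mD (c ^+ 2) f2.
by apply: eq_integrable H => // x _ /=; rewrite -!EFinM; congr EFin; ring.
Qed.

Lemma sqint_eq f g : {in D, f =1 g} -> sqint f -> sqint g.
Proof.
move=> fg [mf f2]; split; first by apply: eq_measurable_fun mf.
by apply: eq_integrable f2 => // x xD /=; rewrite fg.
Qed.

Lemma sqintB f g : sqint f -> sqint g -> sqint (fun x => f x - g x).
Proof.
move=> Hf /(sqintZ (-1)) Hg; apply: sqint_eq (sqintD Hf Hg) => x _.
by rewrite mulN1r.
Qed.

Lemma sqint0 : sqint (fun=> 0).
Proof.
split; first exact: measurable_cst.
by apply: eq_integrable (integrable0 mu D) => // x _; rewrite expr0n.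
Qed.

Lemma ipC f g : ip f g = ip g f.
Proof. by apply: eq_Rintegral => x _; rewrite mulrC. Qed.

Lemma ip_eq f g f' g' : {in D, f =1 f'} -> {in D, g =1 g'} -> ip f g = ip f' g'.
Proof. by move=> ff gg; apply: eq_Rintegral => x xD; rewrite ff// gg. Qed.

Lemma ipDl f g h : sqint f -> sqint g -> sqint h ->
  ip (fun x => f x + g x) h = ip f h + ip g h.
Proof.
move=> Hf Hg Hh; rewrite /ip -RintegralD//; [|exact: sqint_ipP..].
by apply: eq_Rintegral => x _; rewrite mulrDl.
Qed.

Lemma ipZl c f h : sqint f -> sqint h -> ip (fun x => c * f x) h = c * ip f h.
Proof.
move=> Hf Hh; rewrite /ip -RintegralZl//; last exact: sqint_ipP.
by apply: eq_Rintegral => x _; rewrite mulrA.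
Qed.

Lemma ipBl f g h : sqint f -> sqint g -> sqint h ->
  ip (fun x => f x - g x) h = ip f h - ip g h.
Proof.
move=> Hf Hg Hh; rewrite /ip -RintegralB//; [|exact: sqint_ipP..].
by apply: eq_Rintegral => x _; rewrite mulrBl.
Qed.

Lemma ipBr f g h : sqint f -> sqint g -> sqint h ->
  ip f (fun x => g x - h x) = ip f g - ip f h.
Proof. by move=> *; rewrite ipC ipBl// !(ipC f). Qed.

Lemma ipDr f g h : sqint f -> sqint g -> sqint h ->
  ip f (fun x => g x + h x) = ip f g + ip f h.
Proof. by move=> *; rewrite ipC ipDl// !(ipC f). Qed.

Lemma ipZr c f h : sqint f -> sqint h -> ip f (fun x => c * h x) = c * ip f h.
Proof. by move=> *; rewrite ipC ipZl// (ipC f). Qed.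

Lemma ip_ge0 f : 0 <= ip f f.
Proof. by apply: Rintegral_ge0 => x _; rewrite -expr2 sqr_ge0. Qed.

Lemma ip_sqrE f : \int[mu]_(x in D) (f x ^+ 2) = ip f f.
Proof. by apply: eq_Rintegral => x _; rewrite expr2. Qed.

Lemma ip_expand t f g : sqint f -> sqint g ->
  ip (fun x => f x - t * g x) (fun x => f x - t * g x)
  = ip f f - 2 * t * ip f g + t ^+ 2 * ip g g.
Proof.
move=> Hf Hg; have Htg := sqintZ t Hg.
rewrite ipBl ?ipBr ?ipZl ?ipZr//; [|exact: sqintB..].
by rewrite (ipC g f); ring.
Qed.

Lemma ip_CauchySchwarz f g : sqint f -> sqint g ->
  ip f g ^+ 2 <= ip f f * ip g g.
Proof.
move=> Hf Hg; have H t := ip_ge0 (fun x => f x - t * g x).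
have {}H t : 0 <= ip f f - 2 * t * ip f g + t ^+ 2 * ip g g.
  by rewrite -ip_expand.
have [g0|g0] := eqVneq (ip g g) 0.
  have [fg0|fg0] := eqVneq (ip f g) 0; first by rewrite fg0 g0 expr0n mulr0.
  (* If [ip g g = 0] but [ip f g] is nonzero, the expansion is affine in t, and this t gives it the
     value -1. *)
  have := H ((ip f f + 1) / (2 * ip f g)).
  have -> : 2 * ((ip f f + 1) / (2 * ip f g)) * ip f g = ip f f + 1 by field.
  by rewrite g0 mulr0; lra.
have g_gt0 : 0 < ip g g by rewrite lt_def g0 ip_ge0.
have := H (ip f g / ip g g).
have -> : ip f f - 2 * (ip f g / ip g g) * ip f g + (ip f g / ip g g) ^+ 2 * ip g g
  = (ip f f * ip g g - ip f g ^+ 2) / ip g g by field.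
by rewrite pmulr_lge0 ?invr_gt0// subr_ge0.
Qed.

End SquareIntegrable.

(* [nrm_close a b e] says that a, b, e are squared seminorms of vectors
   f, g, h with h = f - g, as far as the reverse triangle inequality goes. *)
Section NormClose.
Context {R : realType}.
Implicit Types a b e c : R.

Definition nrm_close a b e :=
  [/\ 0 <= a, 0 <= b, 0 <= e & a + b - e <= 2 * Num.sqrt a * Num.sqrt b].

Lemma nrm_close0 : nrm_close 0 0 0.
Proof. by split; rewrite ?lexx// sqrtr0; lra. Qed.

(** Cauchy-Schwarz for the vectors (sqrt a, sqrt a') and (sqrt b, sqrt b') absorbs the two products.
    Volume and edge integrals can thus be added up without a common vector space. *)
Lemma nrm_closeD a b e a' b' e' : nrm_close a b e -> nrm_close a' b' e' ->
  nrm_close (a + a') (b + b') (e + e').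
Proof.
move=> [a0 b0 e0 H] [a'0 b'0 e'0 H']; split; rewrite ?addr_ge0//.
set x := Num.sqrt a; set y := Num.sqrt b; set x' := Num.sqrt a'; set y' := Num.sqrt b'.
have Ha : a = x ^+ 2 by rewrite sqr_sqrtr.
have Hb : b = y ^+ 2 by rewrite sqr_sqrtr.
have Ha' : a' = x' ^+ 2 by rewrite sqr_sqrtr.
have Hb' : b' = y' ^+ 2 by rewrite sqr_sqrtr.
have x0 : 0 <= x by rewrite sqrtr_ge0.
have y0 : 0 <= y by rewrite sqrtr_ge0.
have x'0 : 0 <= x' by rewrite sqrtr_ge0.
have y'0 : 0 <= y' by rewrite sqrtr_ge0.
have : x * y + x' * y' <= Num.sqrt (a + a') * Num.sqrt (b + b').
  rewrite -sqrtrM ?addr_ge0// -[leLHS]ger0_norm ?addr_ge0 ?mulr_ge0//.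
  rewrite -sqrtr_sqr ler_sqrt ?mulr_ge0 ?addr_ge0 //.
  rewrite Ha Hb Ha' Hb'; have := sqr_ge0 (x * y' - x' * y); nra.
rewrite -/x -/y in H; rewrite -/x' -/y' in H'; rewrite -!mulrA; lra.
Qed.

Lemma nrm_closeZ c a b e : 0 <= c -> nrm_close a b e ->
  nrm_close (c * a) (c * b) (c * e).
Proof.
move=> c0 [a0 b0 e0 H]; split; rewrite ?mulr_ge0//.
have -> : 2 * Num.sqrt (c * a) * Num.sqrt (c * b) = c * (2 * Num.sqrt a * Num.sqrt b).
  rewrite !sqrtrM//; have := sqr_sqrtr c0; nra.
rewrite -mulrDr -mulrBr; exact: ler_wpM2l.
Qed.

Lemma nrm_close_sum (I : Type) (r : seq I) (a b e : I -> R) :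
  (forall i, nrm_close (a i) (b i) (e i)) ->
  nrm_close (\sum_(i <- r) a i) (\sum_(i <- r) b i) (\sum_(i <- r) e i).
Proof.
move=> H; elim: r => [|i r IH]; first by rewrite !big_nil; exact: nrm_close0.
by rewrite !big_cons; exact: nrm_closeD.
Qed.

Lemma nrm_close_sum_seq (I : eqType) (r : seq I) (a b e : I -> R) :
  (forall i, i \in r -> nrm_close (a i) (b i) (e i)) ->
  nrm_close (\sum_(i <- r) a i) (\sum_(i <- r) b i) (\sum_(i <- r) e i).
Proof.
move=> H; rewrite big_seq [X in nrm_close _ X]big_seq [X in nrm_close _ _ X]big_seq.
by apply: (big_ind3 nrm_close); [exact: nrm_close0 | move=> *; exact: nrm_closeD |].
Qed.

Lemma nrm_close_le a b e : nrm_close a b e ->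
  `|Num.sqrt a - Num.sqrt b| <= Num.sqrt e.
Proof.
move=> [a0 b0 e0 H]; rewrite -sqrtr_sqr ler_sqrt// sqrrB !sqr_sqrtr//.
by move: H; rewrite mulr2n; lra.
Qed.

(** Expanding the square of f - g turns the required inequality into Cauchy-Schwarz. *)
Lemma nrm_close_ip d (T : measurableType d) (mu : {measure set T -> \bar R})
  (D : set T) (mD : measurable D) f g :
  sqint mu D f -> sqint mu D g ->
  nrm_close (ip mu D f f) (ip mu D g g)
    (ip mu D (fun x => f x - g x) (fun x => f x - g x)).
Proof.
move=> Hf Hg; split; rewrite ?ip_ge0//.
have := @ip_expand _ _ _ mu D mD 1 f g Hf Hg.
rewrite expr1n mul1r mulr1 => E.
have -> : ip mu D (fun x => f x - g x) (fun x => f x - g x) =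
  ip mu D f f - 2 * ip mu D f g + ip mu D g g.
  by rewrite -E; apply: ip_eq => x _; rewrite mul1r.
have : ip mu D f g <= Num.sqrt (ip mu D f f) * Num.sqrt (ip mu D g g).
  rewrite -sqrtrM ?ip_ge0//; apply: (le_trans (ler_norm _)).
  by rewrite -sqrtr_sqr ler_sqrt ?mulr_ge0 ?ip_ge0// ip_CauchySchwarz.
rewrite -mulrA; lra.
Qed.

End NormClose.

Notation mplane R := (measurableTypeR R * measurableTypeR R)%type.

(** * Boxes, Borel sets and integrability in the plane *)

Section PlaneMeasure.
Context {R : realType}.
Implicit Types (x y a b : plane R) (A U D : set (plane R)) (f g : plane R -> R).

Definition obox a b : set (plane R) := `]a.1, b.1[ `*` `]a.2, b.2[.
Definition cbox a b : set (plane R) := `[a.1, b.1] `*` `[a.2, b.2].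

Lemma measurable_obox a b : measurable (obox a b : set (mplane R)).
Proof. by apply: measurableX; exact: measurable_itv. Qed.

Lemma measurable_cbox a b : measurable (cbox a b : set (mplane R)).
Proof. by apply: measurableX; exact: measurable_itv. Qed.

Lemma obox_cbox a b : obox a b `<=` cbox a b.
Proof. by move=> x [/= h1 h2]; split; apply: subset_itv_oo_cc. Qed.

Lemma cboxP a b x : cbox a b x <-> (a.1 <= x.1 <= b.1) /\ (a.2 <= x.2 <= b.2).
Proof. by rewrite /cbox /= !in_itv. Qed.

Lemma oboxP a b x : obox a b x <-> (a.1 < x.1 < b.1) /\ (a.2 < x.2 < b.2).
Proof. by rewrite /obox /= !in_itv. Qed.

Lemma mu2_cbox a b : a.1 <= b.1 -> a.2 <= b.2 ->
  mu2 (cbox a b) = ((b.1 - a.1) * (b.2 - a.2))%:E.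
Proof.
have itvE (s t : R) : s <= t -> (lebesgue_measure (`[s, t] : set R) = (t - s)%:E)%E.
  move=> st; rewrite lebesgue_measure_itv /= lte_fin -EFinB.
  by have [//|ts] := ltP s t; congr EFin; lra.
move=> h1 h2; rewrite /mu2 [LHS]product_measure1E; [|exact: measurable_itv..].
by rewrite EFinM; congr (_ * _)%E; exact: itvE.
Qed.

Lemma ball_planeE x (e : R) y : ball x e y <-> `|x.1 - y.1| < e /\ `|x.2 - y.2| < e.
Proof. by rewrite /ball /= /prod_ball -!ball_normE. Qed.

Lemma open_boxP U x : open U -> U x ->
  exists2 e : R, 0 < e & cbox (x.1 - e, x.2 - e) (x.1 + e, x.2 + e) `<=` U.
Proof.
rewrite openE => oU /oU /nbhs_ballP[e /= e0 eU].
exists (e / 2) => [|y /cboxP/= [h1 h2]]; first by rewrite divr_gt0.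
by apply: eU; apply/ball_planeE; rewrite !ltr_norml; lra.
Qed.

(** Rational corners make the family countable: open sets become countable unions of boxes, and
    statements valid almost everywhere on each box can be glued. *)
Definition ratbox (q : rat * rat * (rat * rat)) : plane R * plane R :=
  ((ratr q.1.1, ratr q.1.2), (ratr q.2.1, ratr q.2.2)).

Lemma open_ratbox U x : open U -> U x ->
  exists q, obox (ratbox q).1 (ratbox q).2 x /\ cbox (ratbox q).1 (ratbox q).2 `<=` U.
Proof.
move=> oU Ux; have [e e0 eU] := open_boxP oU Ux.
have rl (s : R) : exists q, ratr q \in `]s - e, s[ by apply: rat_in_itvoo; lra.
have rr (s : R) : exists q, ratr q \in `]s, s + e[ by apply: rat_in_itvoo; lra.
have [q1 /[!in_itv]/= h1] := rl x.1; have [q2 /[!in_itv]/= h2] := rl x.2.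
have [q3 /[!in_itv]/= h3] := rr x.1; have [q4 /[!in_itv]/= h4] := rr x.2.
exists ((q1, q2), (q3, q4)); split; first by apply/oboxP => /=; lra.
move=> y /cboxP/= [h5 h6]; apply: eU; apply/cboxP => /=; lra.
Qed.

Lemma open_bigcup_ratbox U : open U ->
  U = \bigcup_(q in [set q | cbox (ratbox q).1 (ratbox q).2 `<=` U])
        obox (ratbox q).1 (ratbox q).2.
Proof.
move=> oU; apply/seteqP; split => [x /(open_ratbox oU)[q [qx qU]]|x [q /= qU qx]].
  by exists q.
exact/qU/obox_cbox.
Qed.

Lemma open_measurable_plane U : open U -> measurable (U : set (mplane R)).
Proof.
move=> /open_bigcup_ratbox ->; rewrite bigcup_mkcond.
apply: countable_bigcupT_measurable => [|q]; first exact: countableP.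
by case: ifP => _; [exact: measurable_obox|exact: measurable0].
Qed.

Lemma closed_measurable_plane A : closed A -> measurable (A : set (mplane R)).
Proof.
move=> cA; rewrite -(setCK A); apply: measurableC.
by apply: open_measurable_plane; rewrite openC.
Qed.

Lemma continuous_measurable_plane D f : measurable (D : set (mplane R)) ->
  continuous f -> measurable_fun (D : set (mplane R)) f.
Proof.
move=> mD /continuousP cf; apply: (measurability _ (RGenOpens.measurableE R)).
move=> _ [_ [a [b ->] <-]]; apply: measurableI => //.
by apply: open_measurable_plane; exact/cf/interval_open.
Qed.

Lemma cbox_compact a b : compact (cbox a b).
Proof. by apply: compact_setX; exact: segment_compact. Qed.

Lemma bounded_sub_cbox A : bounded_set A ->
  exists2 M : R, 0 < M & A `<=` cbox (- M, - M) (M, M).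
Proof.
move=> [M [_ /(_ (`|M| + 1)) HM]]; exists (`|M| + 1); first by rewrite ltr_wpDl.
move=> x Ax; have /(_ _)/(_ x Ax) := HM; rewrite ltr_pwDr ?ler_norm// => /(_ isT).
rewrite /= prod_normE /= ge_max => /andP[h1 h2]; apply/cboxP => /=.
by move: h1 h2; rewrite !ler_norml.
Qed.

Lemma mu2_fin_sub_cbox A a b : measurable (A : set (mplane R)) ->
  A `<=` cbox a b -> (mu2 A < +oo)%E.
Proof.
move=> mA Aab; apply: (@le_lt_trans _ _ (mu2 (cbox a b))).
  by apply: le_measure; rewrite ?inE//; exact: measurable_cbox.
have [h1|h1] := leP a.1 b.1; have [h2|h2] := leP a.2 b.2;
  try by rewrite mu2_cbox// ltry.
all: suff -> : cbox a b = set0 by rewrite measure0 ltry.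
all: by apply/seteqP; split => // x /cboxP[]; lra.
Qed.

Lemma bounded_sqint D f (B : R) : measurable (D : set (mplane R)) ->
  (mu2 D < +oo)%E -> measurable_fun (D : set (mplane R)) f ->
  (forall x, D x -> `|f x| <= B) -> sqint (@mu2 R) D f.
Proof.
move=> mD fD mf fB; split => //.
apply: (@measurable_bounded_integrable _ _ _ mu2 (fun x => f x ^+ 2)) => //.
  exact: measurable_funX.
exists (B ^+ 2); split; first exact: num_real.
move=> c Bc x Dx; apply/ltW/(le_lt_trans _ Bc).
by rewrite /= normrX lerXn2r ?nnegrE// ?fB// (le_trans _ (fB x Dx)).
Qed.

Lemma bounded_integrable_plane D f (B : R) : measurable (D : set (mplane R)) ->
  (mu2 D < +oo)%E -> measurable_fun (D : set (mplane R)) f ->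
  (forall x, D x -> `|f x| <= B) -> (@mu2 R).-integrable D (EFin \o f).
Proof.
move=> mD fD mf fB; apply: measurable_bounded_integrable => //.
exists B; split; first exact: num_real.
by move=> c Bc x Dx; apply/ltW/(le_lt_trans _ Bc)/fB.
Qed.

Lemma compact_bounded_fun (K : set (plane R)) f : compact K -> continuous f ->
  exists2 B, 0 <= B & forall x, K x -> `|f x| <= B.
Proof.
move=> cK cf; have /compact_bounded[B [_ HB]] : compact (f @` K).
  by apply: continuous_compact => //; exact: continuous_subspaceT.
exists (`|B| + 1) => [|x Kx]; first by rewrite addr_ge0.
by apply: (HB (`|B| + 1)) => /=; [rewrite ltr_pwDr// ler_norm|exists x].
Qed.

End PlaneMeasure.

(** * Smooth functions and weak derivatives *)

Section PartialDerivatives.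
Context {R : realType}.
Implicit Types (f g : plane R -> R) (x v : plane R) (i : 'I_2).

Local Notation e_ i := (basis_vec i : plane R).

Lemma derive_line f x v : 'D_v f x = 'D_1 (fun h : R => f (h *: v + x)) 0.
Proof.
rewrite /derive; set g1 := fun h => h^-1 *: _; set g2 := fun h => h^-1 *: _.
suff -> : g1 = g2 by [].
by rewrite funeqE /g1 /g2 => h /=; rewrite addr0 scale0r add0r [_%:A]mulr1.
Qed.

Lemma derive_shift_line f x v s :
  'D_1 (fun h : R => f (h *: v + x)) s = 'D_v f (s *: v + x).
Proof.
rewrite [RHS]derive_line /derive; set g1 := fun h => h^-1 *: _; set g2 := fun h => h^-1 *: _.
suff -> : g1 = g2 by [].
rewrite funeqE /g1 /g2 => h /=.
by rewrite addr0 scale0r add0r [_%:A]mulr1 scalerDl addrA.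
Qed.

Lemma derivable_shift_line f x v s : derivable f (s *: v + x) v ->
  derivable (fun h : R => f (h *: v + x)) s 1.
Proof.
move=> /derivable1P; rewrite /derivable.
set g1 := fun h => h^-1 *: _; set g2 := fun h => h^-1 *: _.
suff -> : g1 = g2 by [].
rewrite funeqE /g1 /g2 => h /=.
by rewrite addr0 scale0r add0r [_%:A]mulr1 scalerDl addrA.
Qed.

(** Restriction to the line through x in direction v reduces the chain rule to one variable, so
    derivability of f in that single direction suffices. *)
Lemma is_derive_comp_plane (F : R -> R) f x v (a b : R) :
  is_derive (f x) 1 F a -> is_derive x v f b ->
  is_derive x v (fun y => F (f y)) (a * b).
Proof.
move=> HF Hf.
have Hl : is_derive (0 : R) 1 (fun h : R => f (h *: v + x)) b.
  have [/derivable1P d <-] := Hf; apply: DeriveDef => //.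
  by rewrite -derive_line.
have HF' : is_derive (f (0 *: v + x)) 1 F a by rewrite scale0r add0r.
have [d e] := is_derive1_comp HF' Hl.
apply: DeriveDef; first exact/derivable1P.
by rewrite derive_line.
Qed.

Definition pderivable f := forall i x, derivable f x (e_ i).

Lemma is_derive_affine_line (a b s : R) : is_derive s 1 (fun h : R => h * a + b) a.
Proof.
have H1 : is_derive s 1 (fun h : R => h * a) a.
  have -> : (fun h : R => h * a) = a *: (@id R) by apply/funext => h /=; rewrite mulrC.
  by apply: is_derive_eq; rewrite [_ *: _]mulr1.
have := is_deriveD H1 (is_derive_cst b s 1); rewrite addr0.
by [].
Qed.

Lemma is_derive_fst x v : is_derive x v (fun y : plane R => y.1) v.1.
Proof.
have [d e] := is_derive_affine_line v.1 x.1 0.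
by apply: DeriveDef; [apply/derivable1P|rewrite derive_line].
Qed.

Lemma is_derive_snd x v : is_derive x v (fun y : plane R => y.2) v.2.
Proof.
have [d e] := is_derive_affine_line v.2 x.2 0.
by apply: DeriveDef; [apply/derivable1P|rewrite derive_line].
Qed.

Lemma pdP i f x a : is_derive x (e_ i) f a -> pd i f x = a.
Proof. by case. Qed.

Lemma pdD i f g : pderivable f -> pderivable g ->
  pd i (fun x => f x + g x) = fun x => pd i f x + pd i g x.
Proof. by move=> df dg; apply/funext => x; exact: deriveD. Qed.

Lemma pdM i f g : pderivable f -> pderivable g ->
  pd i (fun x => f x * g x) = fun x => pd i f x * g x + f x * pd i g x.
Proof.
move=> df dg; apply/funext => x; rewrite [LHS](deriveM (df i x) (dg i x)).
by rewrite addrC; congr (_ + _); rewrite mulrC.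
Qed.

(** Counting orders allows induction through the product and chain rules, which the words of
    derivatives in [smooth] do not; [smoothP] translates between the two. *)
Fixpoint diffn (n : nat) f : Prop :=
  if n is n'.+1 then
    [/\ continuous f, pderivable f & forall i, diffn n' (pd i f)]
  else continuous f.

Lemma diffn_cont n f : diffn n f -> continuous f.
Proof. by case: n => [|n] //= []. Qed.

Lemma diffnW n f : diffn n.+1 f -> diffn n f.
Proof.
elim: n f => [|n IH] f /= [cf df Hf] //; split => // i.
exact/IH.
Qed.

Lemma diffn_cst n (c : R) : diffn n (fun=> c).
Proof.
elim: n c => [|n IH] c; first by move=> x; exact: cvg_cst.
split => [x|i x|i]; [exact: cvg_cst|exact: derivable_cst|].
have -> : pd i (fun=> c) = (fun=> 0) by apply/funext => x; exact: derive_cst.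
exact: IH.
Qed.

Lemma diffnD n f g : diffn n f -> diffn n g -> diffn n (fun x => f x + g x).
Proof.
elim: n f g => [|n IH] f g /=; first by move=> cf cg x; apply: cvgD; [exact: cf|exact: cg].
move=> [cf df Hf] [cg dg Hg]; split => [x|i x|i].
- by apply: cvgD; [exact: cf|exact: cg].
- exact: derivableD.
- by rewrite pdD//; exact: IH.
Qed.

Lemma diffnM n f g : diffn n f -> diffn n g -> diffn n (fun x => f x * g x).
Proof.
elim: n f g => [|n IH] f g /=; first by move=> cf cg x; apply: cvgM; [exact: cf|exact: cg].
move=> Hf' Hg'; have := diffnW Hf'; have := diffnW Hg'.
case: Hf' Hg' => [cf df Hf] [cg dg Hg] Dg Df; split => [x|i x|i].
- by apply: cvgM; [exact: cf|exact: cg].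
- exact: derivableM.
- by rewrite pdM//; apply: diffnD; exact: IH.
Qed.

Lemma diffn_sum n (I : Type) (r : seq I) (F : I -> plane R -> R) :
  (forall k, diffn n (F k)) -> diffn n (fun x => \sum_(k <- r) F k x).
Proof.
move=> HF; elim: r => [|k r IH].
  by under eq_fun do rewrite big_nil; exact: diffn_cst.
by under eq_fun do rewrite big_cons; exact: diffnD.
Qed.

Lemma diffn_exp n f k : diffn n f -> diffn n (fun x => f x ^+ k).
Proof.
move=> Hf; elim: k => [|k IH].
  by under eq_fun do rewrite expr0; exact: diffn_cst.
by under eq_fun do rewrite exprS; exact: diffnM.
Qed.

Lemma diffn_fst n : diffn n (fun x => x.1).
Proof.
case: n => [|n]; first by move=> x; exact: cvg_fst.
split => [x|i x|i]; [exact: cvg_fst|by have [] := is_derive_fst x (e_ i)|].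
have -> : pd i (fun x : plane R => x.1) = fun=> (e_ i).1.
  by apply/funext => x; apply/pdP/is_derive_fst.
exact: diffn_cst.
Qed.

Lemma diffn_snd n : diffn n (fun x => x.2).
Proof.
case: n => [|n]; first by move=> x; exact: cvg_snd.
split => [x|i x|i]; [exact: cvg_snd|by have [] := is_derive_snd x (e_ i)|].
have -> : pd i (fun x : plane R => x.2) = fun=> (e_ i).2.
  by apply/funext => x; apply/pdP/is_derive_snd.
exact: diffn_cst.
Qed.

Lemma pds_rcons s i f : pds (rcons s i) f = pds s (pd i f).
Proof. by rewrite /pds foldr_rcons. Qed.

Lemma smoothP f : smooth f <-> forall n, diffn n f.
Proof.
split => [+ n|].
  elim: n f => [|n IH] f Hf; first by have [] := Hf [::].
  have [c0 d0] := Hf [::]; split => // i.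
  by apply: IH => s; rewrite -pds_rcons; exact: Hf.
move=> + s; elim/last_ind: s f => [|s i IH] f Hf.
  by have [c0 d0 _] := Hf 1%N.
by rewrite !pds_rcons; apply: IH => n; have [_ _ ] := Hf n.+1; exact.
Qed.

Lemma smooth_pds s f : smooth f -> smooth (pds s f).
Proof. by move=> Hf s'; rewrite /pds -foldr_cat; exact: Hf. Qed.

Lemma smooth_pderivable f : smooth f -> pderivable f.
Proof. by move=> /(_ [::])[]. Qed.

Lemma smooth_cont f : smooth f -> continuous f.
Proof. by move=> /(_ [::])[]. Qed.

Lemma smoothD f g : smooth f -> smooth g -> smooth (fun x => f x + g x).
Proof. by move=> /smoothP Hf /smoothP Hg; apply/smoothP => n; exact: diffnD. Qed.

Lemma smoothM f g : smooth f -> smooth g -> smooth (fun x => f x * g x).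
Proof. by move=> /smoothP Hf /smoothP Hg; apply/smoothP => n; exact: diffnM. Qed.

Lemma smooth_cst c : smooth (fun=> c : R).
Proof. by apply/smoothP => n; exact: diffn_cst. Qed.

Lemma smoothZ c f : smooth f -> smooth (fun x => c * f x).
Proof. by move=> Hf; exact: (smoothM (smooth_cst c) Hf). Qed.

Lemma smooth_expn f k : smooth f -> smooth (fun x => f x ^+ k).
Proof. by move=> /smoothP Hf; apply/smoothP => n; exact: diffn_exp. Qed.

Lemma smooth_fst : smooth (fun x : plane R => x.1).
Proof. by apply/smoothP => n; exact: diffn_fst. Qed.

Lemma smooth_snd : smooth (fun x : plane R => x.2).
Proof. by apply/smoothP => n; exact: diffn_snd. Qed.

Lemma smooth_sum (I : Type) (r : seq I) (F : I -> plane R -> R) :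
  (forall k, smooth (F k)) -> smooth (fun x => \sum_(k <- r) F k x).
Proof.
by move=> HF; apply/smoothP => n; apply: diffn_sum => k; have /smoothP := HF k; exact.
Qed.

Lemma smooth_expR f : smooth f -> smooth (fun x => expR (f x)).
Proof.
move=> /smoothP Hf; apply/smoothP => n; elim: n => [|n IH] /=.
  by move=> x; apply: continuous_comp; [exact: (diffn_cont (Hf 0%N))|exact: continuous_expR].
have [cf df Hd] := Hf n.+1.
have D i x : is_derive x (e_ i) (fun y => expR (f y)) (expR (f x) * pd i f x).
  by apply: (@is_derive_comp_plane expR f x (e_ i)); exact: derivableP.
split => [x|i x|i].
- by apply: continuous_comp; [exact: cf|exact: continuous_expR].
- by have [] := D i x.
- have -> : pd i (fun y => expR (f y)) = fun x => expR (f x) * pd i f x.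
    by apply/funext => x; apply: pdP.
  by apply: diffnM => //; exact: Hd.
Qed.

Lemma pdsD s f g : smooth f -> smooth g ->
  pds s (fun x => f x + g x) = fun x => pds s f x + pds s g x.
Proof.
move=> Hf Hg; elim: s => [|i s IH] //=.
by rewrite IH pdD//; apply: smooth_pderivable; exact: smooth_pds.
Qed.

Lemma pd_cstM i c f : pderivable f -> pd i (fun x => c * f x) = fun x => c * pd i f x.
Proof.
move=> df; rewrite (pdM i (fun k x => derivable_cst c x (e_ k)) df).
by apply/funext => x; rewrite [pd _ (fun=> c) x]derive_cst mul0r add0r.
Qed.

Lemma pdsZ s c f : smooth f -> pds s (fun x => c * f x) = fun x => c * pds s f x.
Proof.
move=> Hf; elim: s => [|i s IH] //=.
by rewrite IH pd_cstM//; apply: smooth_pderivable; exact: smooth_pds.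
Qed.

Lemma pdsB s f g : smooth f -> smooth g ->
  pds s (fun x => f x - g x) = fun x => pds s f x - pds s g x.
Proof.
move=> Hf Hg.
have -> : (fun x => f x - g x) = (fun x => f x + (-1) * g x).
  by apply/funext => x; rewrite mulN1r.
rewrite (pdsD s Hf (smoothZ (-1) Hg)) (pdsZ s (-1) Hg).
by apply/funext => x; rewrite mulN1r.
Qed.

Lemma pds_sum s (I : Type) (r : seq I) (F : I -> plane R -> R) :
  (forall k, smooth (F k)) ->
  pds s (fun x => \sum_(k <- r) F k x) = fun x => \sum_(k <- r) pds s (F k) x.
Proof.
move=> HF; elim: r => [|k r IH].
  have -> : (fun x : plane R => \sum_(k <- [::]) F k x) = (fun=> 0 * 0).
    by apply/funext => x; rewrite big_nil mul0r.
  rewrite pdsZ; last exact: smooth_cst.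
  by apply/funext => x; rewrite big_nil mul0r.
under eq_fun do rewrite big_cons.
rewrite pdsD//; last exact: smooth_sum.
by rewrite IH; apply/funext => x; rewrite big_cons.
Qed.

End PartialDerivatives.

(** * The flat function exp(-1/t) and its derivatives *)

Section SmoothBump.
Context {R : realType}.
Implicit Types (P : {poly R}) (t : R).

(** The functions P(1/t) exp(-1/t), extended by zero, form a class closed under differentiation: the
    derivative belongs to the polynomial (P - P') X^2. One induction over the order then gives
    smoothness. *)
Definition expinv P t : R := if 0 < t then P.[t^-1] * expR (- t^-1) else 0.

Lemma expR_invN_le n t : 0 < t -> expR (- t^-1) <= (n.+1)`!%:R * t ^+ n.+1.
Proof.
move=> t0; rewrite expRN -[leRHS]invrK lef_pV2 ?posrE ?expR_gt0 ?invr_gt0 ?mulr_gt0 ?exprn_gt0 ?ltr0n ?fact_gt0//.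
have := @expR_ge1Dxn R t^-1 n; rewrite invr_ge0 (ltW t0) => /(_ isT).
rewrite invfM exprVn mulrC; lra.
Qed.

Lemma horner_inv_le P t : 0 < t <= 1 ->
  `|P.[t^-1]| * t ^+ size P <= \sum_(i < size P) `|P`_i|.
Proof.
move=> /andP[t0 t1]; rewrite horner_coef -[X in _ * X]ger0_norm ?exprn_ge0 ?(ltW t0)// -normrM.
rewrite mulr_suml. apply: (le_trans (ler_norm_sum _ _ _)); apply: ler_sum => i _.
rewrite -mulrA normrM ler_piMr// ger0_norm ?mulr_ge0 ?exprn_ge0 ?invr_ge0 ?(ltW t0)//.
have -> : t ^+ size P = t ^+ i * t ^+ (size P - i) by rewrite -exprD subnKC// ltnW.
rewrite mulrA -exprMn mulVf ?gt_eqF// expr1n mul1r.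
by rewrite exprn_ile1// (ltW t0).
Qed.

(** The polynomial costs a factor t^(-size P), while exp(-1/t) is at most a multiple of t^(size P +
    2). The remaining t^2 makes the derivative at 0 vanish. *)
Lemma expinv_le P : exists2 C, 0 <= C & forall t, t <= 1 -> `|expinv P t| <= C * t ^+ 2.
Proof.
pose C := (\sum_(i < size P) `|P`_i|) * ((size P).+2)`!%:R.
exists C => [|t t1]; first by rewrite mulr_ge0// sumr_ge0.
rewrite /expinv; case: ifPn => [t0|_]; last first.
  by rewrite normr0 mulr_ge0 ?sqr_ge0// mulr_ge0// sumr_ge0.
rewrite normrM [X in _ * X]ger0_norm ?expR_ge0//.
have h1 := @horner_inv_le P t; rewrite t0 t1 in h1; have {}h1 := h1 isT.
have h2 := expR_invN_le (size P).+1 t0.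
apply: le_trans (_ : `|P.[t^-1]| * (((size P).+2)`!%:R * t ^+ (size P).+2) <= _).
  by rewrite ler_wpM2l.
rewrite -[(size P).+2]addn2 exprD addn2.
have -> : forall a b c d : R, a * (b * (c * d)) = (a * c) * b * d by move=> *; ring.
by rewrite ler_wpM2r ?sqr_ge0// ler_wpM2r// ler0n.
Qed.

Lemma is_derive0_of_sqr_bound (F : R -> R) C :
  F 0 = 0 -> (forall t, t <= 1 -> `|F t| <= C * t ^+ 2) -> is_derive (0 : R) 1 F 0.
Proof.
move=> F0 FC; have C0 : 0 <= C.
  by have := FC 1 (lexx _); rewrite expr1n mulr1; apply: le_trans.
have L : (fun h : R => h^-1 *: ((F \o shift 0) (h *: 1) - F 0)) @ 0^' --> (0 : R).
  apply/cvgr0Pnorm_le => e e0; near=> h.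
  have h0 : h != 0 by near: h; exact: nbhs_dnbhs_neq.
  have h1 : `|h| <= 1 by near: h; apply: dnbhs0_le.
  have he : `|h| <= e / (C + 1).
    by near: h; apply: dnbhs0_le; rewrite divr_gt0// ltr_wpDl.
  rewrite /= addr0 F0 subr0 [_ *: 1]mulr1 normrZ normfV.
  rewrite ler_pdivrMl ?normr_gt0//.
  apply: (le_trans (FC _ _)); first exact: le_trans (ler_norm _) h1.
  rewrite -(real_normK (num_real h)) expr2 mulrA mulrC ler_wpM2l//.
  move: he; rewrite ler_pdivlMr ?ltr_wpDl//.
  by have := normr_ge0 h; nra.
by apply: DeriveDef; [apply/cvg_ex; exists 0|exact/cvg_lim].
Unshelve. all: by end_near.
Qed.

Lemma is_derive_expinv P t :
  is_derive t 1 (expinv P) (expinv ((P - P^`()) * 'X^2) t).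
Proof.
have [t0|t0|->] := ltgtP t 0.
- have -> : expinv ((P - P^`()) * 'X^2) t = 0 by rewrite /expinv ltNge ltW.
  apply: (near_eq_is_derive (f := cst 0)).
  near=> s; rewrite /expinv ltNge ltW//.
  by near: s; exact: lt_nbhsl.
- have -> : expinv ((P - P^`()) * 'X^2) t =
     P.[t^-1] * (expR (- t^-1) * - - t^-2) + expR (- t^-1) * (P^`().[t^-1] * - t^-2).
    rewrite /expinv t0 hornerM hornerD hornerN hornerXn exprVn.
    by ring.
  have D1 : is_derive t 1 (fun s : R => s^-1) (- t^-2).
    have t1 : id t != 0 by rewrite gt_eqF.
    have := @is_deriveV _ id t 1 1 t1 (is_derive_id _ _).
    by rewrite [_ *: _]mulr1.
  have D2 : is_derive t 1 (fun s : R => P.[s^-1]) (P^`().[t^-1] * - t^-2).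
    exact: (is_derive1_comp (f := horner P) (is_derive_poly P _) D1).
  have D3 : is_derive t 1 (fun s : R => expR (- s^-1)) (expR (- t^-1) * - - t^-2).
    exact: (is_derive1_comp (f := expR) (is_derive_expR _) (is_deriveN D1)).
  apply: (near_eq_is_derive _ (is_deriveM D2 D3)).
  near=> s; rewrite /expinv; case: ifPn => // /negP[].
  by near: s; exact: lt_nbhsr.
have -> : expinv ((P - P^`()) * 'X^2) 0 = 0 by rewrite /expinv ltxx.
have [C _ HC] := expinv_le P.
by apply: (is_derive0_of_sqr_bound _ HC); rewrite /expinv ltxx.
Unshelve. all: by end_near.
Qed.

Lemma continuous_expinv P : continuous (expinv P).
Proof.
move=> t; have [d _] := is_derive_expinv P t.
by apply: differentiable_continuous; exact/derivable1_diffP.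
Qed.

Lemma smooth_expinv P (f : plane R -> R) : smooth f -> smooth (fun x => expinv P (f x)).
Proof.
move=> /smoothP Hf; apply/smoothP => n; elim: n P => [|n IH] P.
  by move=> x; apply: continuous_comp; [exact: (diffn_cont (Hf 0%N))|exact: continuous_expinv].
have [cf df Hd] := Hf n.+1.
pose P' := (P - P^`()) * 'X^2.
have D i x : is_derive x (basis_vec i : plane R) (fun y => expinv P (f y)) (expinv P' (f x) * pd i f x).
  by apply: (is_derive_comp_plane (is_derive_expinv P (f x))); exact: derivableP.
split => [x|i x|i].
- by apply: continuous_comp; [exact: cf|exact: continuous_expinv].
- by have [] := D i x.
- have -> : pd i (fun y => expinv P (f y)) = fun x => expinv P' (f x) * pd i f x.
    by apply/funext => x; have [] := D i x.
  by apply: diffnM; [exact: IH|exact: Hd].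
Qed.

Lemma expinv_gt0 t : 0 < expinv 1 t <-> 0 < t.
Proof.
rewrite /expinv; case: ifPn => // t0.
  by rewrite hornerC mul1r expR_gt0.
by rewrite ltxx.
Qed.

Lemma expinv_ge0 t : 0 <= expinv 1 t.
Proof. by rewrite /expinv; case: ifPn => // t0; rewrite hornerC mul1r expR_ge0. Qed.

Lemma expinv_eq0 t : t <= 0 -> expinv 1 t = 0.
Proof. by move=> t0; rewrite /expinv ltNge t0. Qed.

Lemma expinv_le1 t : expinv 1 t <= 1.
Proof.
rewrite /expinv; case: ifPn => // t0; rewrite hornerC mul1r -expR0 ler_expR.
by rewrite oppr_le0 invr_ge0 ltW.
Qed.

End SmoothBump.

(** * Integration by parts against compactly supported functions *)

Section IntegrationByParts.
Context {R : realType}.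
Implicit Types (f g phi psi : plane R -> R) (x : plane R) (i : 'I_2).
Implicit Types (A B C U : set (plane R)).

Local Notation e_ i := (basis_vec i : plane R).

Lemma Rintegral_supp A B C g : C `<=` A -> C `<=` B ->
  (forall x, ~ C x -> g x = 0) ->
  \int[mu2]_(x in A) g x = \int[mu2]_(x in B) g x.
Proof.
move=> CA CB gC; rewrite Rintegral_mkcond [RHS]Rintegral_mkcond.
apply: eq_Rintegral => x _; rewrite !patchE.
have [Cx|nCx] := pselect (C x); first by rewrite !mem_set//; [exact: CB|exact: CA].
by rewrite gC//; do !case: ifP.
Qed.

Lemma line_fst y s : s *: (e_ 0) + (0, y) = (s, y).
Proof.
by congr pair; rewrite /= /GRing.scale/= ?mulr1 ?mulr0 ?addr0 ?add0r.
Qed.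

Lemma line_snd y s : s *: (e_ 1) + (y, 0) = (y, s).
Proof.
by congr pair; rewrite /= /GRing.scale/= ?mulr1 ?mulr0 ?addr0 ?add0r.
Qed.

Lemma FTC2_vanishing (F G : R -> R) (M : R) : 0 < M ->
  (forall s, derivable F s 1) -> (forall s, 'D_1 F s = G s) -> continuous G ->
  F (- M) = 0 -> F M = 0 ->
  (\int[@lebesgue_measure R]_(s in `[(- M)%R, M]) (G s)%:E = 0)%E.
Proof.
move=> M0 dF FG cG F1 F2.
have cF : continuous F by move=> s; exact/differentiable_continuous/derivable1_diffP/dF.
rewrite (@continuous_FTC2 _ G F).
- by rewrite F1 F2 sube0.
- by rewrite gtrN.
- exact: continuous_subspaceT.
- split => [s _||]; first exact: dF.
    exact/cvg_at_right_filter/cF.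
  exact/cvg_at_left_filter/cF.
- by move=> s _; rewrite derive1E FG.
Qed.

(** By Fubini the variable of differentiation is integrated innermost. Each line integral is a
    difference of two values of psi on the boundary of the box, and these vanish because the box in
    the hypothesis is open. *)
Lemma integral_pd_box i psi M : 0 < M -> continuous psi -> pderivable psi ->
  continuous (pd i psi) -> (forall x, ~ obox (- M, - M) (M, M) x -> psi x = 0) ->
  \int[mu2]_(x in cbox (- M, - M) (M, M)) pd i psi x = 0.
Proof.
move=> M0 cpsi dpsi cpd psi0; set Q := cbox _ _.
have mQ : measurable (Q : set (mplane R)) by exact: measurable_cbox.
have [B _ HB] := compact_bounded_fun (@cbox_compact _ (- M, - M) (M, M)) cpd.
have iQ : (@mu2 R).-integrable Q (EFin \o pd i psi).
  apply: (bounded_integrable_plane (B := B)) => //.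
    exact: (mu2_fin_sub_cbox mQ (fun x h => h)).
  exact: continuous_measurable_plane.
have iT : (@mu2 R).-integrable setT ((EFin \o pd i psi) \_ Q).
  by rewrite -integrable_mkcond.
rewrite /Rintegral integral_mkcond -[RHS]/(fine 0); congr fine.
have [i0|i1] : i = 0 \/ i = 1.
  by case: i {cpd iQ iT HB} => [[|[|//]] ?]; [left|right]; exact/val_inj.
- rewrite -[LHS](integral21_prod_meas1 iT) integral0_eq// => y _.
  rewrite /fubini_G.
  have [yM|yM] := boolP (y \in `[- M, M]); last first.
    rewrite integral0_eq// => s _; rewrite patchE memNset// => -[_ h].
    by move/negP: yM; apply.
  transitivity (\int[lebesgue_measure]_(s in `[(- M)%R, M]) (pd 0 psi (s, y))%:E)%E.
    rewrite [RHS]integral_mkcond; apply: eq_integral => s _.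
    rewrite !patchE i0; case: ifPn => [|nQ].
      by rewrite inE => -[/= sM _]; rewrite mem_set.
    rewrite memNset// => sM; move/negP: nQ; apply; rewrite inE; split => //=.
  apply: (@FTC2_vanishing (fun s => psi (s, y))) => //.
  + move=> s; under eq_fun do rewrite -line_fst.
    by apply: derivable_shift_line; exact: dpsi.
  + move=> s; under eq_fun do rewrite -line_fst.
    by rewrite derive_shift_line line_fst.
  + move=> s; apply: (@continuous_comp _ _ _ (fun s : R => (s, y)) (pd 0 psi)).
      exact: (cvg_pair (F := nbhs s) (G := nbhs s) (H := nbhs y) (f := id) (g := fun=> y) cvg_id (cvg_cst y)).
    by rewrite -i0; exact: cpd.
  + by apply: psi0 => /oboxP[]/=; rewrite ltxx.
  + by apply: psi0 => /oboxP[]/=; rewrite ltxx andbF.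
- rewrite -[LHS](integral12_prod_meas1 iT) integral0_eq// => y _.
  rewrite /fubini_F.
  have [yM|yM] := boolP (y \in `[- M, M]); last first.
    rewrite integral0_eq// => s _; rewrite patchE memNset// => -[h _].
    by move/negP: yM; apply.
  transitivity (\int[lebesgue_measure]_(s in `[(- M)%R, M]) (pd 1 psi (y, s))%:E)%E.
    rewrite [RHS]integral_mkcond; apply: eq_integral => s _.
    rewrite !patchE i1; case: ifPn => [|nQ].
      by rewrite inE => -[/= _ sM]; rewrite mem_set.
    rewrite memNset// => sM; move/negP: nQ; apply; rewrite inE; split => //=.
  apply: (@FTC2_vanishing (fun s => psi (y, s))) => //.
  + move=> s; under eq_fun do rewrite -line_snd.
    by apply: derivable_shift_line; exact: dpsi.
  + move=> s; under eq_fun do rewrite -line_snd.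
    by rewrite derive_shift_line line_snd.
  + move=> s; apply: (@continuous_comp _ _ _ (fun s : R => (y, s)) (pd 1 psi)).
      exact: (cvg_pair (F := nbhs s) (G := nbhs y) (H := nbhs s) (f := fun=> y) (g := id) (cvg_cst y) cvg_id).
    by rewrite -i1; exact: cpd.
  + by apply: psi0 => /oboxP[_]/=; rewrite ltxx.
  + by apply: psi0 => /oboxP[_]/=; rewrite ltxx andbF.
Qed.

Lemma pd_supp i C g : closed C -> (forall x, ~ C x -> g x = 0) ->
  forall x, ~ C x -> pd i g x = 0.
Proof.
move=> cC gC x nCx; rewrite /pd (near_eq_derive _ (g := cst 0)) ?derive_cst//.
have : nbhs x (~` C) by apply: open_nbhs_nbhs; split => //; rewrite openC.
by apply: filterS => y; exact: gC.
Qed.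

Lemma pds_supp s C g : closed C -> (forall x, ~ C x -> g x = 0) ->
  forall x, ~ C x -> pds s g x = 0.
Proof. by move=> cC gC; elim: s => [|i s IH] //=; exact: pd_supp. Qed.

Lemma compact_sub_obox C : compact C ->
  exists2 M : R, 0 < M & C `<=` obox (- M, - M) (M, M).
Proof.
move=> /compact_bounded/bounded_sub_cbox[M M0 CM].
exists (M + 1) => [|x /CM/cboxP/= [h1 h2]]; first by rewrite ltr_wpDr// ltW.
by apply/oboxP => /=; lra.
Qed.

Lemma integral_pd_supp i psi C A : compact C -> C `<=` A ->
  (forall x, ~ C x -> psi x = 0) -> smooth psi ->
  \int[mu2]_(x in A) pd i psi x = 0.
Proof.
move=> cC CA psiC spsi; have [M M0 CM] := compact_sub_obox cC.
have clC : closed C by apply: compact_closed => //; exact: norm_hausdorff.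
rewrite (@Rintegral_supp A (cbox (- M, - M) (M, M)) C) //.
- apply: integral_pd_box => //.
  + exact: smooth_cont.
  + exact: smooth_pderivable.
  + by have [] := spsi [:: i].
  + by move=> x nx; apply: psiC => /CM.
- by apply: (subset_trans CM); exact: obox_cbox.
- exact: pd_supp.
Qed.

Lemma smooth_supp_integrable g C A : compact C -> C `<=` A ->
  measurable (A : set (mplane R)) ->
  (forall x, ~ C x -> g x = 0) -> continuous g ->
  (@mu2 R).-integrable A (EFin \o g).
Proof.
move=> cC CA mA gC cg; have [M M0 CM] := compact_sub_obox cC.
have [B B0 HB] := compact_bounded_fun (@cbox_compact _ (- M, - M) (M, M)) cg.
have mQ := @measurable_cbox R (- M, - M) (M, M).
have : (@mu2 R).-integrable (cbox (- M, - M) (M, M)) (EFin \o g).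
  apply: (bounded_integrable_plane (B := B)) => //.
    exact: (mu2_fin_sub_cbox mQ (fun x h => h)).
  exact: continuous_measurable_plane.
rewrite integrable_mkcond//.
have -> : (EFin \o g) \_ (cbox (- M, - M) (M, M)) = EFin \o g.
  apply/funext => x; rewrite patchE; case: ifPn => //; rewrite notin_setE => nx.
  by rewrite /= gC// => /CM/obox_cbox.
exact: integrableS.
Qed.

Lemma integration_by_parts_pd i f g C A : compact C -> C `<=` A ->
  measurable (A : set (mplane R)) ->
  (forall x, ~ C x -> g x = 0) -> smooth f -> smooth g ->
  \int[mu2]_(x in A) (f x * pd i g x) = - \int[mu2]_(x in A) (pd i f x * g x).
Proof.
move=> cC CA mA gC sf sg; apply/eqP; rewrite -subr_eq0 opprK; apply/eqP.
have clC : closed C by apply: compact_closed => //; exact: norm_hausdorff.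
rewrite -RintegralD//; first last.
- apply: (@smooth_supp_integrable _ C) => //; first by move=> x nx; rewrite gC ?mulr0.
  exact: (smooth_cont (smoothM (smooth_pds [:: i] sf) sg)).
- apply: (@smooth_supp_integrable _ C) => //.
    by move=> x nx; rewrite (pd_supp i clC gC) ?mulr0.
  exact: (smooth_cont (smoothM sf (smooth_pds [:: i] sg))).
rewrite -[RHS](@integral_pd_supp i (fun x => f x * g x) C A cC CA _ (smoothM sf sg)).
- apply: eq_Rintegral => x _.
  rewrite (pdM i (smooth_pderivable sf) (smooth_pderivable sg)).
  by rewrite addrC.
- by move=> x nx; rewrite gC ?mulr0.
Qed.

(** The outermost derivative of g moves first and becomes the innermost one on f, whence [rev s]. *)
Lemma integration_by_parts_pds s f g C A : compact C -> C `<=` A ->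
  measurable (A : set (mplane R)) ->
  (forall x, ~ C x -> g x = 0) -> smooth f -> smooth g ->
  \int[mu2]_(x in A) (f x * pds s g x) =
  (-1) ^+ size s * \int[mu2]_(x in A) (pds (rev s) f x * g x).
Proof.
move=> cC CA mA gC sf sg.
have clC : closed C by apply: compact_closed => //; exact: norm_hausdorff.
elim: s f sf => [|i s IH] f sf; first by rewrite mul1r.
rewrite [LHS](integration_by_parts_pd i cC CA mA (pds_supp s clC gC) sf (smooth_pds s sg)).
by rewrite (IH _ (smooth_pds [:: i] sf)) rev_cons pds_rcons /= exprS -mulrA mulN1r.
Qed.

End IntegrationByParts.

(** * The fundamental lemma of the calculus of variations *)

Section FundamentalLemma.
Context {R : realType}.
Implicit Types (a b x : plane R) (U : set (plane R)) (g phi : plane R -> R).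

Definition oboxes : set (set (plane R)) := [set A | exists a b, A = obox a b].

Lemma setI_obox a b a' b' : obox a b `&` obox a' b' =
  obox (Num.max a.1 a'.1, Num.max a.2 a'.2) (Num.min b.1 b'.1, Num.min b.2 b'.2).
Proof.
apply/seteqP; split => x.
  move=> [/oboxP[/andP[? ?] /andP[? ?]] /oboxP[/andP[? ?] /andP[? ?]]].
  by apply/oboxP => /=; rewrite !gt_max !lt_min; split; do !(apply/andP; split => //).
move=> /oboxP /=; rewrite !gt_max !lt_min.
by move=> [/andP[/andP[? ?] /andP[? ?]] /andP[/andP[? ?] /andP[? ?]]];
  split; apply/oboxP; split; apply/andP; split.
Qed.

Lemma setI_closed_oboxes : setI_closed oboxes.
Proof. by move=> _ _ [a [b ->]] [a' [b' ->]]; rewrite setI_obox; do 2 eexists. Qed.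

Lemma nat_bound (y : R) : exists n : nat, `|y| < n%:R.
Proof. by exists (Num.bound `|y|); rewrite archi_boundP. Qed.

(** The product sigma-algebra is generated by the two projections, and the preimage of an open
    interval under a projection is a strip, that is, a countable union of open boxes. *)
Lemma measurable_oboxesE : (measurable : set (set (mplane R))) = <<s oboxes >>.
Proof.
apply/seteqP; split; last first.
  apply: smallest_sub; first exact: sigma_algebra_measurable.
  by move=> _ [a [b ->]]; exact: measurable_obox.
pose T := g_sigma_algebraType oboxes.
have mfst : measurable_fun (setT : set T) (fst : T -> R).
  apply: (measurability _ (RGenOpens.measurableE R)) => _ [_ [a [b ->] <-]].
  have -> : setT `&` (fst : T -> R) @^-1` `]a, b[ = \bigcup_n obox (a, - n%:R) (b, n%:R).
    apply/seteqP; split => x; last by move=> [n _ /oboxP[/= ? _]]; split => //=; rewrite in_itv.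
    move=> [_ /=]; rewrite in_itv /= => h; have [n Hn] := nat_bound x.2.
    by exists n => //; apply/oboxP; split => //=; rewrite -ltr_norml.
  by apply: bigcup_measurable => n _; apply: sub_sigma_algebra; do 2 eexists.
have msnd : measurable_fun (setT : set T) (snd : T -> R).
  apply: (measurability _ (RGenOpens.measurableE R)) => _ [_ [a [b ->] <-]].
  have -> : setT `&` (snd : T -> R) @^-1` `]a, b[ = \bigcup_n obox (- n%:R, a) (n%:R, b).
    apply/seteqP; split => x; last by move=> [n _ /oboxP[/= _ ?]]; split => //=; rewrite in_itv.
    move=> [_ /=]; rewrite in_itv /= => h; have [n Hn] := nat_bound x.1.
    by exists n => //; apply/oboxP; split => //=; rewrite -ltr_norml.
  by apply: bigcup_measurable => n _; apply: sub_sigma_algebra; do 2 eexists.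
apply: smallest_sub; first exact: smallest_sigma_algebra.
rewrite subUset; split => _ [A mA <-].
- exact: mfst.
- exact: msnd.
Qed.

(** The sets over which the zero extension of g has integral zero form a Dynkin system. It contains
    the open boxes, which are stable under intersection and generate, hence every measurable set. *)
Lemma integrable_obox_eq0 a0 b0 g :
  (@mu2 R).-integrable (obox a0 b0) (EFin \o g) ->
  (forall a b, cbox a b `<=` cbox a0 b0 -> \int[mu2]_(x in obox a b) g x = 0) ->
  ae_eq mu2 (obox a0 b0) (EFin \o g) (cst 0%E).
Proof.
move=> ig H; have mD := @measurable_obox _ a0 b0.
have iT : (@mu2 R).-integrable setT ((EFin \o g) \_ (obox a0 b0)) by rewrite -integrable_mkcond.
have H0 A : <<s oboxes >> A -> (\int[mu2]_(x in A) ((EFin \o g) \_ (obox a0 b0)) x = 0)%E.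
  move: A; apply: (dynkin_induction measurable_oboxesE setI_closed_oboxes) => /=.
  - rewrite -integral_mkcond.
    have E := H a0 b0 (fun x h => h).
    by rewrite -[LHS]fineK; [rewrite [fine _]E|exact: integrable_fin_num].
  - move=> _ [a [b ->]]; rewrite -integral_mkcondr.
    rewrite setI_obox; set c : plane R := (Num.max _ _, _); set d : plane R := (Num.min _ _, _).
    have sD : obox c d `<=` obox a0 b0 by rewrite /c /d -setI_obox; exact: subIsetr.
    have mc := @measurable_obox _ c d.
    have ic : (@mu2 R).-integrable (obox c d) (EFin \o g) by exact: integrableS ig.
    have E : \int[mu2]_(x in obox c d) g x = 0.
      apply: H => x /cboxP /=; rewrite !ge_max !le_min.
      by move=> [/andP[/andP[? ?] /andP[? ?]] /andP[/andP[? ?] /andP[? ?]]];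
        apply/cboxP; split; apply/andP; split.
    by rewrite -[LHS]fineK; [rewrite [fine _]E|exact: integrable_fin_num].
  - move=> S mS HS; have mSC := measurableC mS.
    have E := @integral_setU _ _ _ (@mu2 R) S (~` S) _ mS mSC.
    have {}E := E ((EFin \o g) \_ (obox a0 b0)).
    rewrite setUv HS add0e in E; rewrite -E.
    + rewrite -integral_mkcond.
      have E' := H a0 b0 (fun x h => h).
      by rewrite -[LHS]fineK; [rewrite [fine _]E'|exact: integrable_fin_num].
    + exact: measurable_int iT.
    + by apply/disj_setPCl.
  - move=> F mF tF HF; rewrite integral_bigcup//; last first.
      by apply: integrableS iT => //; exact: bigcup_measurable.
    by rewrite eseries0// => n _ _; rewrite HF.
apply: integral_ae_eq => //.
move=> E ED mE; rewrite integral0.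
have := H0 E; rewrite -measurable_oboxesE => /(_ mE).
by rewrite -integral_mkcondr setIidl.
Qed.

Definition box_bump a b x : R :=
  (expinv 1 (x.1 - a.1) * expinv 1 (b.1 - x.1)) *
  (expinv 1 (x.2 - a.2) * expinv 1 (b.2 - x.2)).

Lemma box_bump_ge0 a b x : 0 <= box_bump a b x.
Proof. by rewrite /box_bump !mulr_ge0 ?expinv_ge0. Qed.

Lemma box_bump_gt0 a b x : obox a b x -> 0 < box_bump a b x.
Proof.
by move=> /oboxP[/andP[? ?] /andP[? ?]]; rewrite /box_bump;
  do 2 apply: mulr_gt0; apply/expinv_gt0; rewrite subr_gt0.
Qed.

Lemma box_bump_eq0 a b x : ~ obox a b x -> box_bump a b x = 0.
Proof.
move=> nx; rewrite /box_bump.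
have [h1|h1] := leP x.1 a.1; first by rewrite (@expinv_eq0 _ (_ - a.1)) ?mul0r// subr_le0.
have [h2|h2] := leP b.1 x.1; first by rewrite (@expinv_eq0 _ (b.1 - _)) ?mulr0 ?mul0r// subr_le0.
have [h3|h3] := leP x.2 a.2; first by rewrite (@expinv_eq0 _ (_ - a.2)) ?mul0r ?mulr0// subr_le0.
have [h4|h4] := leP b.2 x.2; first by rewrite (@expinv_eq0 _ (b.2 - _)) ?mulr0// subr_le0.
by exfalso; apply: nx; apply/oboxP; rewrite h1 h2 h3 h4.
Qed.

Lemma smooth_subr (f : plane R -> R) c : smooth f -> smooth (fun x => f x - c).
Proof. by move=> sf; exact: (smoothD sf (smooth_cst _)). Qed.

Lemma smooth_rsub (f : plane R -> R) c : smooth f -> smooth (fun x => c - f x).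
Proof.
move=> sf; have := smoothD (smooth_cst c) (smoothZ (-1) sf).
by under eq_fun do rewrite mulN1r.
Qed.

Lemma smooth_box_bump a b : smooth (box_bump a b).
Proof.
have s1 := @smooth_fst R; have s2 := @smooth_snd R.
exact: (smoothM (smoothM (smooth_expinv 1 (smooth_subr a.1 s1)) (smooth_expinv 1 (smooth_rsub b.1 s1)))
  (smoothM (smooth_expinv 1 (smooth_subr a.2 s2)) (smooth_expinv 1 (smooth_rsub b.2 s2)))).
Qed.

(** [box_bump] is positive exactly on the open box, so these smooth functions have values in [0, 1],
    vanish off the box and tend to its indicator as n grows. *)
Definition plateau (n : nat) a b x : R := 1 - expR (- n%:R * box_bump a b x).

Lemma plateau_test n a b U : cbox a b `<=` U -> test_function U (plateau n a b).
Proof.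
move=> abU; split.
  exact: (smooth_rsub 1 (smooth_expR (smoothZ _ (smooth_box_bump a b)))).
exists (cbox a b); split => // [|x nx]; first exact: cbox_compact.
rewrite /plateau box_bump_eq0 ?mulr0 ?expR0 ?subrr// => h.
exact/nx/obox_cbox.
Qed.

Lemma plateau_itv n a b x : 0 <= plateau n a b x <= 1.
Proof.
rewrite /plateau subr_ge0 gerBl expR_ge0 andbT -expR0 ler_expR.
by rewrite mulNr oppr_le0 mulr_ge0// box_bump_ge0.
Qed.

Lemma plateau_cvg a b x : plateau n a b x @[n --> \oo] --> (\1_(obox a b) x : R).
Proof.
rewrite indicE; have [h|h] := boolP (x \in obox a b); last first.
  have -> : (fun n => plateau n a b x) = fun=> 0.
    apply/funext => n; rewrite /plateau box_bump_eq0 ?mulr0 ?expR0 ?subrr//.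
    by move: h; rewrite notin_setE.
  exact: cvg_cst.
rewrite inE in h; have c0 := box_bump_gt0 h; set c := box_bump a b x in c0 *.
have q1 : `|expR (- c)| < 1 by rewrite ger0_norm ?expR_ge0// -expR0 ltr_expR oppr_lt0.
have -> : (fun n => plateau n a b x) = (fun n => 1 - expR (- c) ^+ n).
  by apply/funext => n; rewrite /plateau -expRM_natl mulrN mulNr.
rewrite -[X in _ --> X]subr0; apply: cvgB; first exact: cvg_cst.
exact: cvg_expr.
Qed.

(** Dominated convergence with [plateau n a b] as test functions and |g| as majorant. *)
Lemma integral_obox_eq0 U g a b : measurable (U : set (mplane R)) ->
  (@mu2 R).-integrable U (EFin \o g) -> cbox a b `<=` U ->
  (forall phi, test_function U phi -> \int[mu2]_(x in U) (g x * phi x) = 0) ->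
  \int[mu2]_(x in obox a b) g x = 0.
Proof.
move=> mU ig abU H; have mb := @measurable_obox _ a b.
have mg : measurable_fun (U : set (mplane R)) g by apply/measurable_EFinP; exact: measurable_int ig.
have sU : obox a b `<=` U by apply: subset_trans abU; exact: obox_cbox.
pose f_ n x := (g x * plateau n a b x)%:E.
have mp n : measurable_fun (U : set (mplane R)) (plateau n a b).
  apply: continuous_measurable_plane => //.
  by have [+ _] := plateau_test n abU; exact: smooth_cont.
have mind : measurable_fun (U : set (mplane R)) (\1_(obox a b) : plane R -> R).
  exact: (@measurable_indic _ (mplane R) R U _ mb).
have [] := @dominated_convergence _ _ _ (@mu2 R) U mU f_
   (fun x => (g x * \1_(obox a b) x)%:E) (fun x => `|g x|%:E).
- by move=> n; apply/measurable_EFinP; exact: measurable_funM.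
- by apply/measurable_EFinP; exact: measurable_funM.
- apply: aeW => x _; apply: cvg_EFin; first exact: nearW.
  by apply: cvgM; [exact: cvg_cst|exact: plateau_cvg].
- exact: (integrable_norm ig).
- apply: aeW => x n _; rewrite /f_ lee_fin normrM ler_piMr//.
  by have /andP[? ?] := plateau_itv n a b x; rewrite ger0_norm.
move=> _ _; rewrite (_ : [sequence _]_n = cst 0%E); last first.
  apply/funext => n /=.
  have E := H _ (plateau_test n abU).
  have i : (@mu2 R).-integrable U (f_ n).
    apply: (le_integrable mU _ _ (integrable_norm ig)).
      by apply/measurable_EFinP; exact: measurable_funM.
    move=> x _; rewrite /= normr_id lee_fin normrM ler_piMr//.
    by have /andP[? ?] := plateau_itv n a b x; rewrite ger0_norm.
  by rewrite -[LHS]fineK ?integrable_fin_num//; congr EFin.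
move=> /(cvg_unique _ (cvg_cst _)) => /(_ (@ereal_hausdorff R)) E.
rewrite -(setIidr sU) Rintegral_mkcondr /Rintegral.
transitivity (fine (0%E : \bar R)) => //; congr fine; rewrite E.
apply: eq_integral => x _; rewrite patchE indicE; case: ifP => _ /=.
  by rewrite mulr1.
by rewrite mulr0.
Qed.

Lemma fundamental_lemma U g : open U ->
  (@mu2 R).-integrable U (EFin \o g) ->
  (forall phi, test_function U phi -> \int[mu2]_(x in U) (g x * phi x) = 0) ->
  ae_eq mu2 U (EFin \o g) (cst 0%E).
Proof.
move=> oU ig H; have mU := open_measurable_plane oU.
have Hq q : cbox (ratbox q).1 (ratbox q).2 `<=` U ->
    ae_eq mu2 (obox (ratbox q).1 (ratbox q).2) (EFin \o g) (cst 0%E).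
  move=> qU; apply: integrable_obox_eq0.
  - apply: integrableS ig => //; first exact: measurable_obox.
    by apply: subset_trans qU; exact: obox_cbox.
  - by move=> a b ab; apply: (integral_obox_eq0 mU ig _ H) => x /ab; exact: qU.
pose P q x := cbox (ratbox q).1 (ratbox q).2 `<=` U -> obox (ratbox q).1 (ratbox q).2 x -> g x = 0.
(* Numbering the rational boxes by [choice.unpickle] makes the exceptional set a countable union of
   null sets. *)
have Hall : \forall x \ae mu2, forall n : nat, if choice.unpickle n is Some q then P q x else True.
  apply: ae_foralln => n; case: choice.unpickle => [q|] /=; last exact: (@aeW _ (mplane R)).
  have [qU|nqU] := pselect (cbox (ratbox q).1 (ratbox q).2 `<=` U); last first.
    by apply: (@aeW _ (mplane R)) => x qU.
  apply: filterS (Hq q qU) => x Hx _ qx.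
  by have [] := Hx qx.
apply: (@filterS _ _ (ae_filter_ringOfSetsType (@mu2 R)) _ _ _ Hall) => x Hx Ux /=; congr EFin.
have [q [qx qU]] := open_ratbox oU Ux.
by have := Hx (choice.pickle q); rewrite choice.pickleK /= => /(_ qU qx).
Qed.

End FundamentalLemma.

(** * Equality almost everywhere *)

Section AlmostEverywhere.
Context d (T : measurableType d) (R : realType).
Variable mu : {measure set T -> \bar R}.
Variable D : set T.
Hypothesis mD : measurable D.
Implicit Types f g : T -> R.

Definition aeq f g := {ae mu, forall x, D x -> f x = g x}.

Lemma aeq_sub_eq0 f g : ae_eq mu D (EFin \o (fun x => f x - g x)) (cst 0%E) -> aeq f g.
Proof.
move=> H; apply: (@filterS _ _ (ae_filter_ringOfSetsType mu) _ _ _ H) => x Hx Dx.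
by have /= [/eqP] := Hx Dx; rewrite subr_eq0 => /eqP.
Qed.

Lemma aeq_refl f : aeq f f.
Proof. by apply: aeW. Qed.

Lemma aeq_sub f g f' g' : aeq f g -> aeq f' g' ->
  aeq (fun x => f x - f' x) (fun x => g x - g' x).
Proof.
move=> H H'.
apply: (@filterS2 _ _ (ae_filter_ringOfSetsType mu) _ _ _ _ H H') => x Hx Hx' Dx.
by rewrite Hx// Hx'.
Qed.

Lemma ip_aeq f g f' g' : sqint mu D f -> sqint mu D g -> sqint mu D f' -> sqint mu D g' ->
  aeq f f' -> aeq g g' -> ip mu D f g = ip mu D f' g'.
Proof.
move=> [mf _] [mg _] [mf' _] [mg' _] H H'; congr fine.
apply: ae_eq_integral => //.
- by apply/measurable_EFinP; exact: measurable_funM.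
- by apply/measurable_EFinP; exact: measurable_funM.
apply: (@filterS2 _ _ (ae_filter_ringOfSetsType mu) _ _ _ _ H H') => x Hx Hx' Dx.
by rewrite Hx// Hx'.
Qed.

(** The parallelogram law with the norm of the difference dropped. *)
Lemma ip_norm2_le f g : sqint mu D f -> sqint mu D g ->
  ip mu D (fun x => f x + g x) (fun x => f x + g x) <=
  2 * ip mu D f f + 2 * ip mu D g g.
Proof.
move=> Hf Hg; have Hfg := sqintD mD Hf Hg; have Hfmg := sqintB mD Hf Hg.
have := ip_ge0 mu D (fun x => f x - g x).
rewrite ipBl// !ipBr// ipDl// !ipDr// (ipC mu D g f); lra.
Qed.

End AlmostEverywhere.

(** * Weak derivatives, linearity of [H20] and the Poincare inequality *)

Section Sobolev.
Context {R : realType}.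
Variable Omega : set (plane R).
Hypothesis oO : open Omega.
Hypothesis bO : bounded_set Omega.
Implicit Types (v w g phi : plane R -> R) (s : seq 'I_2).

Local Notation mO := (open_measurable_plane oO).
Local Notation ipO := (ip (@mu2 R) Omega).
Local Notation aeO := (aeq (@mu2 R) Omega).

Lemma mu2_bounded_lty : (mu2 Omega < +oo)%E.
Proof.
have [M M0 OM] := bounded_sub_cbox bO.
exact: mu2_fin_sub_cbox mO OM.
Qed.

Lemma L2_cst c : L2 Omega (fun=> c).
Proof.
by apply: (bounded_sqint mO mu2_bounded_lty (B := `|c|)).
Qed.

Lemma L2_integrable g : L2 Omega g -> (@mu2 R).-integrable Omega (EFin \o g).
Proof.
move=> Hg; have := sqint_ipP mO Hg (L2_cst 1).
by apply: eq_integrable; [exact: mO|move=> x _ /=; rewrite mulr1].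
Qed.

Lemma test_pds s phi : test_function Omega phi -> test_function Omega (pds s phi).
Proof.
move=> [sp [C [cC CO pC]]]; split; first exact: smooth_pds.
exists C; split => //; apply: pds_supp => //.
by apply: compact_closed => //; exact: norm_hausdorff.
Qed.

Lemma test_L2 phi : test_function Omega phi -> L2 Omega phi.
Proof.
move=> [sp [C [cC CO pC]]].
have [B B0 HB] := compact_bounded_fun cC (smooth_cont sp).
apply: (bounded_sqint mO mu2_bounded_lty (B := B)) => [|x Ox].
  exact: (continuous_measurable_plane mO (smooth_cont sp)).
by have [/HB//|/pC->] := pselect (C x); rewrite normr0.
Qed.

Lemma testD phi psi c : test_function Omega phi -> test_function Omega psi ->
  test_function Omega (fun x => phi x + c * psi x).
Proof.
move=> [sp [C [cC CO pC]]] [sp' [C' [cC' CO' pC']]]; split.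
  exact: (smoothD sp (smoothZ c sp')).
exists (C `|` C'); split => [|x [/CO|/CO']//|x nC]; first exact: compactU.
by rewrite pC ?pC' ?mulr0 ?addr0// => h; apply: nC; [right|left].
Qed.

(** The difference of two weak derivatives annihilates every test function. As [wderiv] chooses an
    unspecified representative, all its algebra, linearity included, is derived from this and holds
    almost everywhere only. *)
Lemma weak_deriv_unique s v g g' : is_weak_deriv Omega s v g ->
  is_weak_deriv Omega s v g' -> aeO g g'.
Proof.
move=> [Hg wg] [Hg' wg']; apply: aeq_sub_eq0; apply: fundamental_lemma => //.
  by apply: L2_integrable; exact: sqintB mO _ _ _ _.
move=> phi tphi; rewrite -/(ipO _ _) ipBl//; [|exact: mO|exact: test_L2].
apply/eqP; rewrite subr_eq0; apply/eqP.
have := wg _ tphi; rewrite (wg' _ tphi); have sn0 : (-1 : R) ^+ size s != 0 by rewrite signr_eq0.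
by move=> /(mulfI sn0) E; rewrite /ip -E.
Qed.

Lemma wderivP s v : (exists g, is_weak_deriv Omega s v g) ->
  is_weak_deriv Omega s v (wderiv Omega s v).
Proof. by move=> H; exact: (xgetPex (fun=> 0) H). Qed.

Lemma weak_derivD s v w g h c : L2 Omega v -> L2 Omega w ->
  is_weak_deriv Omega s v g -> is_weak_deriv Omega s w h ->
  is_weak_deriv Omega s (fun x => v x + c * w x) (fun x => g x + c * h x).
Proof.
move=> Lv Lw [Lg wg] [Lh wh]; split; first exact: (sqintD mO Lg (sqintZ mO c Lh)).
move=> phi tphi; have Lp := test_L2 tphi; have Ls := test_L2 (test_pds s tphi).
rewrite -/(ipO _ _) -/(ipO (fun x => g x + c * h x) phi).
rewrite !ipDl//; do ?[exact: mO | exact: (sqintZ mO)].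
rewrite !ipZl//; do ?[exact: mO].
by rewrite /ip (wg _ tphi) (wh _ tphi); ring.
Qed.

Lemma weak_deriv0 v : L2 Omega v -> is_weak_deriv Omega [::] v v.
Proof. by move=> Lv; split => // phi _; rewrite mul1r. Qed.

Lemma H20_wderiv s v : H20 Omega v -> s \in multi_indices2 ->
  is_weak_deriv Omega s v (wderiv Omega s v).
Proof. by move=> [_ _ Hs _] si; apply: wderivP; exact: Hs. Qed.

Lemma mem_multi_nil : [::] \in multi_indices2.
Proof. by []. Qed.

Lemma mem_multi2 i k : [:: i; k] \in multi_indices2.
Proof.
rewrite /multi_indices2 mem_cat; apply/orP; right.
rewrite mem_cat; apply/orP; right.
by apply/allpairsP; exists (i, k); rewrite !mem_enum.
Qed.

Lemma H20_wderiv0 v : H20 Omega v -> aeO (wderiv Omega [::] v) v.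
Proof.
move=> Hv; have [_ Lv _ _] := Hv.
exact: (weak_deriv_unique (H20_wderiv Hv mem_multi_nil) (weak_deriv0 Lv)).
Qed.

Lemma H20_L2 v : H20 Omega v -> L2 Omega v.
Proof. by case. Qed.

Lemma H20_weakD s v w c : H20 Omega v -> H20 Omega w -> s \in multi_indices2 ->
  is_weak_deriv Omega s (fun x => v x + c * w x)
    (fun x => wderiv Omega s v x + c * wderiv Omega s w x).
Proof.
move=> Hv Hw si.
exact: (weak_derivD c (H20_L2 Hv) (H20_L2 Hw) (H20_wderiv Hv si) (H20_wderiv Hw si)).
Qed.

Lemma H20_wderivD s v w c : H20 Omega v -> H20 Omega w -> s \in multi_indices2 ->
  aeO (wderiv Omega s (fun x => v x + c * w x))
      (fun x => wderiv Omega s v x + c * wderiv Omega s w x).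
Proof.
move=> Hv Hw si; have H := H20_weakD c Hv Hw si.
by apply: (weak_deriv_unique _ H); apply: wderivP; eexists; exact: H.
Qed.

Lemma H20_lin v w c : H20 Omega v -> H20 Omega w -> H20 Omega (fun x => v x + c * w x).
Proof.
move=> Hv Hw; have [v0 Lv _ Av] := Hv; have [w0 Lw _ Aw] := Hw; split.
- by move=> x nx; rewrite v0// w0// mulr0 addr0.
- exact: (sqintD mO Lv (sqintZ mO c Lw)).
- by move=> s si; eexists; exact: (H20_weakD c Hv Hw si).
(* Splitting by [ip_norm2_le] costs a factor 2 for v and 2 c^2 for w, so each approximation receives
   this share of eps. *)
move=> eps eps0; pose e1 := eps / (2 + 2 * c ^+ 2).
have c0 : 0 < 2 + 2 * c ^+ 2 by have := sqr_ge0 c; lra.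
have e10 : 0 < e1 by rewrite divr_gt0.
have [phi tphi Hphi] := Av _ e10; have [psi tpsi Hpsi] := Aw _ e10.
exists (fun x => phi x + c * psi x); first exact: testD.
apply: (@le_lt_trans _ _ (2 * (\sum_(s <- multi_indices2)
          \int[mu2]_(x in Omega) ((wderiv Omega s v x - pds s phi x) ^+ 2)) +
    2 * c ^+ 2 * (\sum_(s <- multi_indices2)
          \int[mu2]_(x in Omega) ((wderiv Omega s w x - pds s psi x) ^+ 2)))).
  rewrite !mulr_sumr -big_split /= big_seq [leRHS]big_seq; apply: ler_sum => s si.
  have [Lgv _] := H20_wderiv Hv si; have [Lgw _] := H20_wderiv Hw si.
  have Lp := test_L2 (test_pds s tphi); have Lq := test_L2 (test_pds s tpsi).
  have LH := H20_weakD c Hv Hw si.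
  have Lsum : L2 Omega (wderiv Omega s (fun x => v x + c * w x)).
    by have [] := wderivP (ex_intro _ _ LH).
  rewrite !ip_sqrE.
  set f := fun x => wderiv Omega s v x - pds s phi x.
  set h := fun x => wderiv Omega s w x - pds s psi x.
  have Lf : L2 Omega f by exact: (sqintB mO).
  have Lh : L2 Omega h by exact: (sqintB mO).
  have Lch : L2 Omega (fun x => c * h x) by exact: (sqintZ mO).
  have Lfh : L2 Omega (fun x => f x + c * h x) by exact: (sqintD mO).
  have := ip_norm2_le mO Lf Lch.
  rewrite (ipZl mO c Lh Lch) (ipZr mO c Lh Lh) => le.
  have -> : 2 * c ^+ 2 * ipO h h = 2 * (c * (c * ipO h h)) by ring.
  apply: le_trans le.
  rewrite le_eqVlt; apply/orP; left; apply/eqP.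
  have [sphi _] := tphi; have [spsi _] := tpsi.
  have A : aeO (fun x => wderiv Omega s (fun x => v x + c * w x) x -
     pds s (fun x => phi x + c * psi x) x) (fun x => f x + c * h x).
    rewrite (pdsD s sphi (smoothZ c spsi)) (pdsZ s c spsi).
    have -> : (fun x => f x + c * h x) = (fun x =>
       (wderiv Omega s v x + c * wderiv Omega s w x) - (pds s phi x + c * pds s psi x)).
      by apply/funext => x; rewrite /f /h; ring.
    by apply: aeq_sub; [exact: H20_wderivD|exact: aeq_refl].
  have Ld : L2 Omega (fun x => wderiv Omega s (fun x => v x + c * w x) x -
     pds s (fun x => phi x + c * psi x) x).
    by apply: (sqintB mO) => //; apply: test_L2; apply: test_pds; exact: testD.
  exact: (ip_aeq mO Ld Ld Lfh Lfh A A).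
have -> : eps = 2 * e1 + 2 * c ^+ 2 * e1 by rewrite /e1; field; rewrite gt_eqF.
apply: ltr_leD; first by rewrite ltr_pM2l.
by apply: ler_wpM2l; [rewrite mulr_ge0 ?sqr_ge0|exact: ltW].
Qed.

Lemma H20_sub v w : H20 Omega v -> H20 Omega w -> H20 Omega (v \- w).
Proof.
move=> Hv Hw; have := H20_lin (-1) Hv Hw.
by under eq_fun do rewrite mulN1r.
Qed.

Lemma H20_sum (n : nat) (w : nat -> plane R -> R) :
  (forall l, (l <= n)%N -> H20 Omega (w l)) ->
  H20 Omega (fun x => \sum_(l < n.+1) w l x).
Proof.
elim: n => [|n IH] H.
  by under eq_fun do rewrite big_ord1; exact: H.
have -> : (fun x => \sum_(l < n.+2) w l x) =
    (fun x => (\sum_(l < n.+1) w l x) + 1 * w n.+1 x).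
  by apply/funext => x; rewrite big_ord_recr /= mul1r.
exact: (H20_lin 1 (IH (fun l ln => H l (leqW ln))) (H n.+1 (leqnn _))).
Qed.

Lemma H20_wderivB s v w : H20 Omega v -> H20 Omega w -> s \in multi_indices2 ->
  aeO (wderiv Omega s (v \- w)) (fun x => wderiv Omega s v x - wderiv Omega s w x).
Proof.
move=> Hv Hw si; have := H20_wderivD (-1) Hv Hw si.
under [X in aeO _ X]eq_fun do rewrite mulN1r.
by under [X in wderiv _ _ X]eq_fun do rewrite mulN1r.
Qed.

Lemma nrm_close_form_a v w : H20 Omega v -> H20 Omega w ->
  nrm_close (form_a Omega v v) (form_a Omega w w) (form_a Omega (v \- w) (v \- w)).
Proof.
move=> Hv Hw; apply: nrm_close_sum => i; apply: nrm_close_sum => k.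
have si := mem_multi2 i k.
have [Lv _] := H20_wderiv Hv si; have [Lw _] := H20_wderiv Hw si.
have [Ld _] := H20_wderiv (H20_sub Hv Hw) si.
have A := H20_wderivB Hv Hw si.
have LL := sqintB mO Lv Lw.
rewrite -[X in nrm_close _ _ X]/(ipO _ _) (ip_aeq mO Ld Ld LL LL A A).
have H : nrm_close (ipO _ _) (ipO _ _) (ipO _ _) := nrm_close_ip mO Lv Lw.
exact: H.
Qed.

Lemma form_a_ge0 v : 0 <= form_a Omega v v.
Proof.
by apply: sumr_ge0 => i _; apply: sumr_ge0 => k _; exact: ip_ge0.
Qed.

Lemma norm_a_sub_le v w : H20 Omega v -> H20 Omega w ->
  `|norm_a Omega v - norm_a Omega w| <= norm_a Omega (v \- w).
Proof. by move=> Hv Hw; apply: nrm_close_le; exact: nrm_close_form_a. Qed.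

(** Write 1 as the derivative of the first coordinate x. Integration by parts gives (phi, phi) =
    (phi, h) with h = -2 x [pd 0 phi], so (phi, phi) <= (h, h) by Cauchy-Schwarz, and |x| <= M on
    [Omega]. *)
Lemma poincare_test_pd M phi : 0 < M -> Omega `<=` cbox (- M, - M) (M, M) ->
  test_function Omega phi ->
  ipO phi phi <= 4 * M ^+ 2 * ipO (pd 0 phi) (pd 0 phi).
Proof.
move=> M0 OM tphi; have Lp := test_L2 tphi.
have Ld : L2 Omega (pd 0 phi) by exact: (test_L2 (test_pds [:: 0] tphi)).
have [sp [C [cC CO pC]]] := tphi.
pose h := fun x : plane R => (-2) * (x.1 * pd 0 phi x).
have sd : smooth (pd 0 phi) by exact: (smooth_pds [:: 0]).
have sh : smooth h by exact: (smoothZ _ (smoothM (@smooth_fst R) sd)).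
have th : test_function Omega h.
  split => //; exists C; split => // x nC; rewrite /h.
  have clC : closed C by apply: compact_closed => //; exact: norm_hausdorff.
  by rewrite (pd_supp 0 clC pC) ?mulr0.
have Lh := test_L2 th.
have E : ipO phi phi = ipO phi h.
  have nC x : ~ C x -> phi x * phi x = 0 by move=> /pC->; rewrite mulr0.
  have E := integration_by_parts_pd 0 cC CO mO nC (@smooth_fst R) (smoothM sp sp).
  have -> : ipO phi phi = - (- \int[mu2]_(x in Omega) (pd 0 (fun y : plane R => y.1) x * (phi x * phi x))).
    rewrite opprK; apply: eq_Rintegral => x _.
    by rewrite (pdP (is_derive_fst x (basis_vec 0))) /= mul1r.
  rewrite -E -mulN1r -RintegralZl; [|exact: mO|]; last first.
    have : L2 Omega (fun x : plane R => x.1 * pd 0 (fun x => phi x * phi x) x).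
      apply: test_L2; split.
        exact: (smoothM (@smooth_fst R) (smooth_pds [:: 0] (smoothM sp sp))).
      exists C; split => // x nx.
      have clC : closed C by apply: compact_closed => //; exact: norm_hausdorff.
      by rewrite (pd_supp 0 clC nC) ?mulr0.
    exact: L2_integrable.
  apply: eq_Rintegral => x _.
  rewrite (pdM 0 (smooth_pderivable sp) (smooth_pderivable sp)) /h; ring.
have le1 : ipO phi phi <= ipO h h.
  have CS := ip_CauchySchwarz mO Lp Lh; rewrite -E expr2 in CS.
  have [->|p0] := eqVneq (ipO phi phi) 0; first exact: ip_ge0.
  have pp : 0 < ipO phi phi by rewrite lt_def p0 ip_ge0.
  by rewrite ler_pM2l in CS.
apply: (le_trans le1); rewrite /ip -RintegralZl; [|exact: mO|exact: (sqint_ipP mO Ld Ld)].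
apply: le_Rintegral.
- exact: mO.
- exact: (sqint_ipP mO Lh Lh).
- have := integrableZl mO (4 * M ^+ 2) (sqint_ipP mO Ld Ld).
  by apply: eq_integrable; first exact: mO.
move=> x /OM/cboxP[/= /andP[h1 h2] _]; rewrite /h.
have : x.1 ^+ 2 <= M ^+ 2 by nra.
have := sqr_ge0 (pd 0 phi x); set D := pd 0 phi x => D0 x1.
have -> : -2 * (x.1 * D) * (-2 * (x.1 * D)) = x.1 ^+ 2 * (4 * D ^+ 2) by ring.
have -> : 4 * M ^+ 2 * (D * D) = M ^+ 2 * (4 * D ^+ 2) by ring.
by rewrite ler_wpM2r// mulr_ge0.
Qed.

Lemma sum2_ge_term (G : 'I_2 -> 'I_2 -> R) : (forall i k, 0 <= G i k) ->
  forall i k, G i k <= \sum_(i < 2) \sum_(k < 2) G i k.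
Proof.
move=> G0 i k; rewrite (bigD1 i)//= (bigD1 k)//= -addrA lerDl addr_ge0//.
  by apply: sumr_ge0 => l _; exact: G0.
by apply: sumr_ge0 => l _; apply: sumr_ge0 => m _; exact: G0.
Qed.

(** For a test function phi the previous inequality is used twice in the same direction, for phi and
    for [pd 0 phi]. Hence the single Hessian entry [[:: 0; 0]] controls v, after approximating v by
    phi; the factor 4 stems from passing from v to phi and back with [ip_norm2_le]. *)
Lemma poincare_H20 : exists2 CP : R, 0 < CP & forall v, H20 Omega v ->
  ipO v v <= CP * form_a Omega v v.
Proof.
have [M M0 OM] := bounded_sub_cbox bO.
pose A := (4 * M ^+ 2) ^+ 2.
have A0 : 0 < A by rewrite exprn_gt0// mulr_gt0// exprn_gt0.
exists (4 * A) => [|v Hv]; first by rewrite mulr_gt0.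
have s2 := mem_multi2 0 0.
have [Lw _] := H20_wderiv Hv s2; have Lv := H20_L2 Hv.
have [L0 _] := H20_wderiv Hv mem_multi_nil.
apply: (@le_trans _ _ (4 * A * ipO (wderiv Omega [:: 0; 0] v) (wderiv Omega [:: 0; 0] v))); last first.
  rewrite ler_wpM2l//; first by rewrite mulr_ge0// ltW.
  exact: (sum2_ge_term (G := fun i k => ipO (wderiv Omega [:: i; k] v)
    (wderiv Omega [:: i; k] v)) (fun i k => ip_ge0 _ _ _) 0 0).
apply/ler_addgt0Pr => e e0.
pose e1 := e / (2 + 4 * A).
have c0 : 0 < 2 + 4 * A by lra.
have e10 : 0 < e1 by rewrite divr_gt0.
have [_ _ _ Av] := Hv; have [phi tphi Hphi] := Av _ e10.
have Hs s : s \in multi_indices2 ->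
    ipO (fun x => wderiv Omega s v x - pds s phi x) (fun x => wderiv Omega s v x - pds s phi x) <= e1.
  move=> si; apply: le_trans (ltW Hphi).
  rewrite (big_rem s)//= ip_sqrE lerDl.
  by apply: sumr_ge0 => t _; rewrite ip_sqrE ip_ge0.
have H0 := Hs _ mem_multi_nil; have H2 := Hs _ s2.
have Lp := test_L2 tphi; have L2p := test_L2 (test_pds [:: 0; 0] tphi).
have P1 := poincare_test_pd M0 OM tphi.
have P2 := poincare_test_pd M0 OM (test_pds [:: 0] tphi).
have {P1 P2} P : ipO phi phi <= A * ipO (pds [:: 0; 0] phi) (pds [:: 0; 0] phi).
  rewrite /A; have c4 : 0 <= 4 * M ^+ 2 by rewrite mulr_ge0// sqr_ge0.
  move: (4 * M ^+ 2) c4 P1 P2 => c4 c40 P1 P2; apply: (le_trans P1).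
  by rewrite expr2 -mulrA; exact: ler_wpM2l.
have Q1 : ipO v v <= 2 * e1 + 2 * ipO phi phi.
  have E0 := H20_wderiv0 Hv.
  rewrite -(ip_aeq mO L0 L0 Lv Lv E0 E0).
  have Ls := sqintB mO L0 Lp.
  have := ip_norm2_le mO Ls Lp.
  under [X in ip _ _ X]eq_fun do rewrite subrK.
  under [X in ip _ _ _ X]eq_fun do rewrite subrK.
  move: H0; rewrite /=; lra.
have Q2 : ipO (pds [:: 0; 0] phi) (pds [:: 0; 0] phi) <= 2 * e1 +
    2 * ipO (wderiv Omega [:: 0; 0] v) (wderiv Omega [:: 0; 0] v).
  have Ls := sqintB mO L2p Lw.
  have := ip_norm2_le mO Ls Lw.
  under [X in ip _ _ X]eq_fun do rewrite subrK.
  under [X in ip _ _ _ X]eq_fun do rewrite subrK.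
  have -> : ipO (fun x => pds [:: 0; 0] phi x - wderiv Omega [:: 0; 0] v x)
      (fun x => pds [:: 0; 0] phi x - wderiv Omega [:: 0; 0] v x) =
    ipO (fun x => wderiv Omega [:: 0; 0] v x - pds [:: 0; 0] phi x)
      (fun x => wderiv Omega [:: 0; 0] v x - pds [:: 0; 0] phi x).
    by apply: eq_Rintegral => x _; ring.
  move: H2; lra.
have -> : e = 2 * e1 + 4 * A * e1 by rewrite /e1; field; rewrite gt_eqF.
nra.
Qed.

End Sobolev.

(** * An inverse estimate by duality *)

Section Moments.
Context {R : realType}.
Implicit Types (P Q : {poly R}) (t z r : R) (F : R -> R).

Local Notation mu1 := (@lebesgue_measure R).

(** Multiplication by this bump on (-1, 1) makes a polynomial smooth and compactly supported;
    moments and the dual basis refer to it. *)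
Definition weight t : R := expinv 1 (t + 1) * expinv 1 (1 - t).

Lemma continuous_weight : continuous weight.
Proof.
move=> t; apply: cvgM.
  apply: (@continuous_comp _ _ _ (fun t => t + 1) (expinv 1)); last exact: continuous_expinv.
  by apply: cvgD; [exact: cvg_id|exact: cvg_cst].
apply: (@continuous_comp _ _ _ (fun t => 1 - t) (expinv 1)); last exact: continuous_expinv.
by apply: cvgB; [exact: cvg_cst|exact: cvg_id].
Qed.

Lemma weight_itv t : 0 <= weight t <= 1.
Proof.
rewrite /weight mulr_ge0 ?expinv_ge0//= mulr_ile1 ?expinv_ge0 ?expinv_le1//.
Qed.

Lemma weight_gt0 t : -1 < t < 1 -> 0 < weight t.
Proof. by move=> /andP[? ?]; apply: mulr_gt0; apply/expinv_gt0; lra. Qed.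

Lemma weight_eq0 t : ~~ (-1 < t < 1) -> weight t = 0.
Proof.
rewrite negb_and -!leNgt /weight => /orP[h|h].
  by rewrite (@expinv_eq0 _ (t + 1)) ?mul0r//; lra.
by rewrite (@expinv_eq0 _ (1 - t)) ?mulr0//; lra.
Qed.

Lemma continuous_itv_integrable F a b : continuous F ->
  mu1.-integrable `[a, b] (EFin \o F).
Proof.
move=> cF; apply: continuous_compact_integrable; first exact: segment_compact.
exact: continuous_subspaceT.
Qed.

Definition wpoly P t : R := P.[t] * weight t.

Lemma continuous_wpoly P : continuous (wpoly P).
Proof. by move=> t; apply: cvgM; [exact: continuous_horner|exact: continuous_weight]. Qed.

Definition moment P : R := \int[mu1]_(t in `[-1, 1]) wpoly P t.

Lemma momentD P Q : moment (P + Q) = moment P + moment Q.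
Proof.
rewrite /moment -RintegralD//; [|exact/continuous_itv_integrable/continuous_wpoly..].
by apply: eq_Rintegral => t _; rewrite /wpoly hornerD mulrDl.
Qed.

Lemma momentZ c P : moment (c *: P) = c * moment P.
Proof.
rewrite /moment -RintegralZl//; last exact/continuous_itv_integrable/continuous_wpoly.
apply: eq_Rintegral => t _; rewrite /wpoly hornerZ; exact/esym/mulrA.
Qed.

Lemma moment0 : moment 0 = 0.
Proof. by have := momentZ 0 0; rewrite scale0r mul0r. Qed.

Lemma moment_sum I (s : seq I) (G : I -> {poly R}) :
  moment (\sum_(i <- s) G i) = \sum_(i <- s) moment (G i).
Proof.
elim: s => [|i s IH]; first by rewrite !big_nil moment0.
by rewrite !big_cons momentD IH.
Qed.

Lemma poly_nonroot P : P != 0 -> exists2 t, -1 < t < 1 & P.[t] != 0.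
Proof.
move=> P0; apply: contrapT => H.
(* These are [size P] distinct points of (0, 1), whereas a nonzero P has fewer than [size P]
   roots. *)
pose rs : seq R := [seq (n.+2)%:R^-1 | n <- iota 0 (size P)].
have : (size rs < size P)%N.
  apply: max_poly_roots => //.
    apply/allP => _ /mapP[n _ ->]; apply/negPn/negP => h; apply: H.
    exists (n.+2)%:R^-1; last exact: h.
    rewrite (lt_trans (ltrN10 _)) ?invr_gt0 ?ltr0n//=.
    by rewrite invf_lt1 ?ltr0n// ltr1n.
  rewrite map_inj_uniq ?iota_uniq// => m n /invr_inj/eqP.
  by rewrite eqr_nat => /eqP[].
by rewrite size_map size_iota ltnn.
Qed.

Lemma moment_sqr_eq0 P : moment (P * P) = 0 -> P = 0.
Proof.
move=> M0; apply/eqP; apply: contraT => /poly_nonroot[t0 /andP[t1 t2] Pt0].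
pose f := wpoly (P * P); have cf := @continuous_wpoly (P * P).
have f0 t : 0 <= f t.
  rewrite /f /wpoly hornerM mulr_ge0//; first by rewrite -expr2 sqr_ge0.
  by have /andP[] := weight_itv t.
have ft0 : 0 < f t0.
  rewrite /f /wpoly hornerM mulr_gt0 ?weight_gt0 ?t1//.
  by rewrite -expr2 exprn_even_gt0//.
have /nbhs_ballP[d /= d0 Hd] : \forall t \near t0, f t0 / 2 < f t.
  by apply: (cvgr_gt (f t0) (cf t0)); lra.
(* A neighbourhood of t0 inside [-1, 1] on which the integrand exceeds half its value at t0; its
   contribution already makes the integral positive. *)
have [e [e0 ed e1 e2]] : exists e : R, [/\ 0 < e, e <= d / 2, e <= t0 + 1 & e <= 1 - t0].
  exists (Num.min (d / 2) (Num.min (t0 + 1) (1 - t0))); split.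
  - by rewrite !lt_min; apply/and3P; split; lra.
  - by rewrite ge_min lexx.
  - by rewrite !ge_min lexx ?orbT.
  - by rewrite !ge_min lexx ?orbT.
have sub : `[t0 - e, t0 + e]%classic `<=` `[-1, 1].
  by move=> t /=; rewrite !in_itv /=; lra.
have : 0 < \int[mu1]_(t in `[-1, 1] `&` `[t0 - e, t0 + e]) (f t0 / 2).
  rewrite setIidr// Rintegral_cst//= lebesgue_measure_itv /= lte_fin ifT; last by rewrite ltrBlDr -addrA ltrDl addr_gt0.
  by rewrite -EFinD /= mulr_gt0//; lra.
rewrite Rintegral_mkcondr => /lt_le_trans -/(_ 0).
rewrite ltxx => ->//; rewrite -M0; apply: le_Rintegral => //.
- rewrite -restrict_EFin; apply/integrable_restrict => //.
  by rewrite setIidr//; apply: continuous_itv_integrable; exact: cst_continuous.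
- exact: continuous_itv_integrable.
- move=> t _; rewrite patchE; case: ifPn => [|_]; last exact: f0.
  rewrite inE /= in_itv /= => ht; apply/ltW/Hd; rewrite -ball_normE /= ltr_norml; lra.
Qed.

(* The Gram matrix of the monomials is invertible since moment (P * P) = 0
   forces P = 0; the rows of its inverse are the coefficients of psi. *)
Lemma dual_poly p : exists psi : 'I_p.+1 -> {poly R},
  forall a P, (size P <= p.+1)%N -> moment (P * psi a) = P`_a.
Proof.
pose G : 'M[R]_p.+1 := \matrix_(a, b) moment ('X^a * 'X^b).
have Gu : G \in unitmx.
  rewrite -row_free_unit -kermx_eq0; apply/rowV0P => v /sub_kermxP vG.
  pose P : {poly R} := \sum_(a < p.+1) v 0 a *: 'X^a.
  have HP (b : 'I_p.+1) : moment (P * 'X^b) = (v *m G) 0 b.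
    rewrite mxE mulr_suml moment_sum; apply: eq_bigr => a _.
    by rewrite -scalerAl momentZ mxE.
  have /moment_sqr_eq0 P0 : moment (P * P) = 0.
    rewrite {2}/P mulr_sumr moment_sum big1// => b _.
    by rewrite -scalerAr momentZ (HP b) vG mxE mulr0.
  apply/rowP => a; rewrite mxE.
  have : P`_a = 0 by rewrite P0 coef0.
  rewrite coef_sum (bigD1 a)//= coefZ coefXn eqxx mulr1 big1 ?addr0// => b ba.
  by rewrite coefZ coefXn (inj_eq val_inj) eq_sym (negPf ba) mulr0.
exists (fun a => \sum_(b < p.+1) (invmx G) b a *: 'X^b) => a P sP.
have {1}-> : P = \sum_(c < p.+1) P`_c *: 'X^c.
  apply/polyP => k; rewrite coef_sum; have [kp|kp] := ltnP k p.+1.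
    rewrite (bigD1 (Ordinal kp))//= coefZ coefXn eqxx mulr1 big1 ?addr0// => b ba.
    rewrite coefZ coefXn; case: eqP => [kb|]; last by rewrite mulr0.
    by case/eqP: ba; apply/val_inj.
  rewrite nth_default ?(leq_trans sP)// big1// => b _.
  rewrite coefZ coefXn; case: eqP => [kb|]; last by rewrite mulr0.
  by move: (ltn_ord b); rewrite -kb ltnNge kp.
rewrite mulr_suml moment_sum.
transitivity (\sum_(c < p.+1) P`_c * (G *m invmx G) c a).
  apply: eq_bigr => c _; rewrite -scalerAl momentZ mxE; congr (_ * _).
  rewrite mulr_sumr moment_sum; apply: eq_bigr => b _.
  by rewrite -scalerAr momentZ mxE mulrC.
rewrite mulmxV// (bigD1 a)//= mxE eqxx mulr1 big1 ?addr0// => b ba.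
by rewrite mxE (negPf ba) mulr0.
Qed.

Lemma Rintegral_scale F z r : 0 < r -> continuous F ->
  \int[mu1]_(t in `[z - r, z + r]) F ((t - z) / r) =
  r * \int[mu1]_(t in `[-1, 1]) F t.
Proof.
move=> r0 cF; pose G s := F ((s - z) / r).
have cG : continuous G.
  move=> s; apply: (@continuous_comp _ _ _ (fun s => (s - z) / r) F); last exact: cF.
  apply: cvgM; last exact: cvg_cst.
  by apply: cvgB; [exact: cvg_id|exact: cvg_cst].
pose L s : R := s * r + z.
have L' (s : R) : is_derive s 1 L r by exact: is_derive_affine_line.
have dL : (L^`())%classic = fun=> r.
  by apply/funext => s; rewrite derive1E; have [] := L' s.
have cL : continuous L.
  by move=> s; apply/differentiable_continuous/derivable1_diffP; have [] := L' s.
have := @integration_by_substitution_increasing R L G (-1) 1.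
rewrite dL => H.
have -> : z - r = L (-1) by rewrite /L; ring.
have -> : z + r = L 1 by rewrite /L; ring.
rewrite /Rintegral H.
- rewrite -RintegralZl//; last exact: continuous_itv_integrable.
  congr fine; apply: eq_integral => s _ /=; rewrite /G /L; congr EFin.
  rewrite mulrC; congr (_ * F _); field; exact: lt0r_neq0.
- lra.
- by move=> s t _ _ st; rewrite /L ltrD2r ltr_pM2r.
- by move=> s _; exact: cvg_cst.
- exact: is_cvg_cst.
- exact: is_cvg_cst.
- split => [s _||]; first by have [] := L' s.
    exact/cvg_at_right_filter/cL.
  exact/cvg_at_left_filter/cL.
- exact: continuous_subspaceT.
Qed.

Lemma moment_scale P z r : 0 < r ->
  \int[mu1]_(t in `[z - r, z + r]) wpoly P ((t - z) / r) = r * moment P.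
Proof. by move=> r0; apply: Rintegral_scale => //; exact: continuous_wpoly. Qed.

Lemma Rintegral_cbox_prod (F G : R -> R) (a b : plane R) : continuous F -> continuous G ->
  \int[mu2]_(x in cbox a b) (F x.1 * G x.2) =
  (\int[mu1]_(t in `[a.1, b.1]) F t) * (\int[mu1]_(t in `[a.2, b.2]) G t).
Proof.
move=> cF cG; pose I := `[a.1, b.1]%classic; pose J := `[a.2, b.2]%classic.
have cFG : continuous (fun x : plane R => F x.1 * G x.2).
  move=> x; apply: cvgM.
    by apply: (@continuous_comp _ _ _ fst F); [exact: cvg_fst|exact: cF].
  by apply: (@continuous_comp _ _ _ snd G); [exact: cvg_snd|exact: cG].
have mQ : measurable (cbox a b : set (mplane R)) by exact: measurable_cbox.
have [B _ HB] := compact_bounded_fun (@cbox_compact _ a b) cFG.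
have iQ : (@mu2 R).-integrable (cbox a b) (EFin \o (fun x => F x.1 * G x.2)).
  apply: (bounded_integrable_plane (B := B)) => //.
    exact: (mu2_fin_sub_cbox mQ (fun x h => h)).
  exact: continuous_measurable_plane.
have iT : (@mu2 R).-integrable setT ((EFin \o (fun x : plane R => F x.1 * G x.2)) \_ (cbox a b)).
  by rewrite -integrable_mkcond.
have iF := (@integrable_mkcond _ (measurableTypeR R) R mu1 I (EFin \o F)
  (measurable_itv _)).1 (continuous_itv_integrable a.1 b.1 cF).
have iG := (@integrable_mkcond _ (measurableTypeR R) R mu1 J (EFin \o G)
  (measurable_itv _)).1 (continuous_itv_integrable a.2 b.2 cG).
rewrite restrict_EFin in iF; rewrite restrict_EFin in iG.
rewrite {1}/Rintegral integral_mkcond -[X in fine X](integral12_prod_meas1 iT).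
rewrite Rintegral_mkcond [X in _ * X]Rintegral_mkcond -/I -/J.
rewrite -RintegralZr//; congr fine; apply: eq_integral => s _.
rewrite /fubini_F.
transitivity (\int[mu1]_t ((F \_ I) s * (G \_ J) t)%:E)%E.
  apply: eq_integral => t _; rewrite !patchE.
  have -> : ((s, t) \in cbox a b) = (s \in I) && (t \in J).
    by apply/idP/andP; rewrite !inE.
  by case: (s \in I); case: (t \in J) => //=; rewrite ?mul0r ?mulr0.
under eq_integral do rewrite EFinM.
rewrite integralZl// EFinM; congr (_ * _)%E.
by rewrite fineK//; exact: integrable_fin_num.
Qed.

End Moments.

(** * Polynomials as sums of products in local coordinates *)

Section TensorPolynomials.
Context {R : realType}.
Implicit Types (x z : plane R) (r : R) (l : seq ({poly R} * {poly R})) (f : plane R -> R).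
Implicit Types (P : {poly R}).

(** The coordinates are relative to a square with centre z and half side r, so that bounds for
    coefficients carry no dependence on the element. A list of products of univariate polynomials
    lets derivatives and integrals over squares act termwise; different lists may represent one
    polynomial. *)
Definition tensf z r l x : R :=
  \sum_(k <- l) k.1.[(x.1 - z.1) / r] * k.2.[(x.2 - z.2) / r].

Definition deg_le (p : nat) l : bool :=
  all (fun k : {poly R} * {poly R} => (size k.1 <= p.+1)%N && (size k.2 <= p.+1)%N) l.

Definition tcoef l (a b : nat) : R := \sum_(k <- l) k.1`_a * k.2`_b.

Definition tderiv (i : 'I_2) l : seq ({poly R} * {poly R}) :=
  [seq (if i == 0 then (k.1^`(), k.2) else (k.1, k.2^`())) | k <- l].

Lemma ord2_cases (i : 'I_2) : i = 0 \/ i = 1.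
Proof. by case: i => [[|[|//]] ?]; [left|right]; exact/val_inj. Qed.

Lemma smooth_horner P f : smooth f -> smooth (fun x => P.[f x]).
Proof.
move=> sf; under eq_fun do rewrite horner_coef.
by apply: smooth_sum => i; exact: (smoothZ _ (smooth_expn _ sf)).
Qed.

Lemma smooth_scaled1 z r : smooth (fun x : plane R => (x.1 - z.1) / r).
Proof. exact: (smoothM (smooth_subr z.1 (@smooth_fst R)) (smooth_cst r^-1)). Qed.

Lemma smooth_scaled2 z r : smooth (fun x : plane R => (x.2 - z.2) / r).
Proof. exact: (smoothM (smooth_subr z.2 (@smooth_snd R)) (smooth_cst r^-1)). Qed.

Lemma smooth_tensf z r l : smooth (tensf z r l).
Proof.
apply: smooth_sum => k.
exact: (smoothM (smooth_horner _ (smooth_scaled1 z r)) (smooth_horner _ (smooth_scaled2 z r))).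
Qed.

Lemma pd_horner i P f : smooth f ->
  pd i (fun x => P.[f x]) = fun x => P^`().[f x] * pd i f x.
Proof.
move=> sf; apply/funext => x; apply: pdP.
apply: (is_derive_comp_plane (is_derive_poly P (f x))).
by apply: derivableP; exact: (smooth_pderivable sf).
Qed.

Lemma pd_scaled1 i z r : pd i (fun x : plane R => (x.1 - z.1) / r) = fun=> (i == 0)%:R / r.
Proof.
have sf := smooth_pderivable (@smooth_fst R).
have -> : (fun x : plane R => (x.1 - z.1) / r) = (fun x => r^-1 * x.1 + (- z.1 / r)).
  by apply/funext => x; rewrite mulrBl mulrC mulNr.
rewrite (pdD i (smooth_pderivable (smoothZ r^-1 (@smooth_fst R))) (smooth_pderivable (smooth_cst _))).
rewrite (pd_cstM i _ sf); apply/funext => x.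
have -> : pd i (fun=> - z.1 / r) x = 0 by exact: derive_cst.
rewrite addr0 (pdP (is_derive_fst x (basis_vec i))).
by rewrite mulrC.
Qed.

Lemma pd_scaled2 i z r : pd i (fun x : plane R => (x.2 - z.2) / r) = fun=> (i == 1)%:R / r.
Proof.
have sf := smooth_pderivable (@smooth_snd R).
have -> : (fun x : plane R => (x.2 - z.2) / r) = (fun x => r^-1 * x.2 + (- z.2 / r)).
  by apply/funext => x; rewrite mulrBl mulrC mulNr.
rewrite (pdD i (smooth_pderivable (smoothZ r^-1 (@smooth_snd R))) (smooth_pderivable (smooth_cst _))).
rewrite (pd_cstM i _ sf); apply/funext => x.
have -> : pd i (fun=> - z.2 / r) x = 0 by exact: derive_cst.
rewrite addr0 (pdP (is_derive_snd x (basis_vec i))).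
by rewrite mulrC.
Qed.

Lemma pd_tensf i z r l :
  pd i (tensf z r l) = fun x => r^-1 * tensf z r (tderiv i l) x.
Proof.
have sk (k : {poly R} * {poly R}) :
    smooth (fun x : plane R => k.1.[(x.1 - z.1) / r] * k.2.[(x.2 - z.2) / r]).
  exact: (smoothM (smooth_horner _ (smooth_scaled1 z r)) (smooth_horner _ (smooth_scaled2 z r))).
rewrite [LHS](pds_sum [:: i] l sk); apply/funext => x.
rewrite /tensf big_map mulr_sumr; apply: eq_bigr => k _.
rewrite [pds _ _](pdM i (smooth_pderivable (smooth_horner _ (smooth_scaled1 z r)))
  (smooth_pderivable (smooth_horner _ (smooth_scaled2 z r)))).
rewrite (pd_horner _ _ (smooth_scaled1 z r)) (pd_horner _ _ (smooth_scaled2 z r)).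
rewrite pd_scaled1 pd_scaled2.
by have [->|->] := ord2_cases i; rewrite /= ?mul1r ?mul0r ?mulr0 ?addr0 ?add0r; ring.
Qed.

Lemma deg_le_tderiv p i l : deg_le p l -> deg_le p (tderiv i l).
Proof.
move=> /allP H; apply/allP => _ /mapP[k kl ->]; have /andP[h1 h2] := H _ kl.
have hd P : (size P <= p.+1)%N -> (size P^`() <= p.+1)%N.
  have [->|P0] := eqVneq P 0; first by rewrite deriv0 size_poly0.
  by apply: leq_trans; apply/ltnW/lt_size_deriv.
by case: ifP => _ /=; rewrite ?h1 ?h2 ?hd.
Qed.

Lemma tcoef_eq0 p l a b : deg_le p l -> (p < a)%N || (p < b)%N -> tcoef l a b = 0.
Proof.
move=> /allP H ab; rewrite /tcoef big_seq big1// => k /H /andP[h1 h2].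
case/orP: ab => h.
  by rewrite (nth_default _ (leq_trans h1 h)) mul0r.
by rewrite [X in _ * X](nth_default _ (leq_trans h2 h)) mulr0.
Qed.

Lemma tcoef_tderiv p i l B : deg_le p l -> (forall a b, `|tcoef l a b| <= B) ->
  forall a b, `|tcoef (tderiv i l) a b| <= p.+1%:R * B.
Proof.
move=> dl H a b; have B0 : 0 <= B by apply: le_trans (H 0%N 0%N).
have ddl := deg_le_tderiv i dl.
have [pa|ap] := ltnP p a; first by rewrite (tcoef_eq0 ddl) ?pa// normr0 mulr_ge0.
have [pb|bp] := ltnP p b; first by rewrite (tcoef_eq0 ddl) ?pb ?orbT// normr0 mulr_ge0.
have Hmul (m c : nat) (y : R) : (c <= p)%N -> `|y| <= B -> `|y *+ c.+1| <= p.+1%:R * B.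
  move=> cp yB; rewrite normrMn -[leLHS]mulr_natl.
  by apply: ler_pM => //; rewrite ler_nat.
rewrite /tcoef big_map; have [->|->] := ord2_cases i; rewrite /=.
- have -> : \sum_(k <- l) k.1^`()`_a * k.2`_b = tcoef l a.+1 b *+ a.+1.
    rewrite /tcoef -sumrMnl; apply: eq_bigr => k _ /=.
    by rewrite coef_deriv mulrnAl.
  exact: Hmul.
- have -> : \sum_(k <- l) k.1`_a * k.2^`()`_b = tcoef l a b.+1 *+ b.+1.
    rewrite /tcoef -sumrMnl; apply: eq_bigr => k _ /=.
    by rewrite coef_deriv mulrnAr.
  exact: Hmul.
Qed.

Lemma tensfE p z r l x : deg_le p l -> tensf z r l x =
  \sum_(a < p.+1) \sum_(b < p.+1) tcoef l a b *
    (((x.1 - z.1) / r) ^+ a * ((x.2 - z.2) / r) ^+ b).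
Proof.
move=> /allP H; rewrite /tensf /tcoef big_seq.
transitivity (\sum_(k <- l | k \in l) \sum_(a < p.+1) \sum_(b < p.+1)
    k.1`_a * k.2`_b * (((x.1 - z.1) / r) ^+ a * ((x.2 - z.2) / r) ^+ b)).
  apply: eq_bigr => k /H /andP[h1 h2].
  rewrite (horner_coef_wide _ h1) (horner_coef_wide _ h2) mulr_suml.
  apply: eq_bigr => a _; rewrite mulr_sumr; apply: eq_bigr => b _; ring.
rewrite -big_seq exchange_big; apply: eq_bigr => a _.
rewrite exchange_big; apply: eq_bigr => b _.
by rewrite mulr_suml.
Qed.

Lemma pds_tensf s z r l :
  pds s (tensf z r l) = fun x => r^-1 ^+ size s * tensf z r (foldr tderiv l s) x.
Proof.
elim: s => [|i s IH] /=; first by apply/funext => x; rewrite mul1r.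
rewrite IH (pd_cstM i _ (smooth_pderivable (smooth_tensf _ _ _))) pd_tensf.
by apply/funext => x; rewrite exprSr mulrA.
Qed.

(** [Lam > 1] admits points outside the square of half side r. This is what lets information on a
    square inside a triangle control the polynomial on the whole triangle, at the price of
    [Lam ^+ p] in each variable. *)
Lemma tensf_le p z r l B Lam x : deg_le p l -> (forall a b, `|tcoef l a b| <= B) ->
  0 < r -> 1 <= Lam -> `|x.1 - z.1| <= Lam * r -> `|x.2 - z.2| <= Lam * r ->
  `|tensf z r l x| <= (p.+1%:R * Lam ^+ p) ^+ 2 * B.
Proof.
move=> dl H r0 L1 h1 h2; rewrite (tensfE _ _ _ dl).
have B0 : 0 <= B by apply: le_trans (H 0%N 0%N).
have hX (t : R) (a : 'I_p.+1) : `|t| <= Lam * r -> `|(t / r) ^+ a| <= Lam ^+ p.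
  move=> ht; rewrite normrX.
  apply: (@le_trans _ _ (Lam ^+ a)).
    rewrite lerXn2r ?nnegrE//; first exact: le_trans L1.
    by rewrite normrM normfV (gtr0_norm r0) ler_pdivrMr.
  by rewrite ler_weXn2l// -ltnS.
apply: (le_trans (ler_norm_sum _ _ _)).
have -> : (p.+1%:R * Lam ^+ p) ^+ 2 * B =
    \sum_(a < p.+1) \sum_(b < p.+1) (B * (Lam ^+ p * Lam ^+ p)).
  by rewrite !sumr_const !card_ord -mulrnA -[RHS]mulr_natl natrM; ring.
apply: ler_sum => a _; apply: (le_trans (ler_norm_sum _ _ _)).
apply: ler_sum => b _; rewrite !normrM.
apply: ler_pM; [exact: normr_ge0|by rewrite mulr_ge0|exact: H|].
by apply: ler_pM; [exact: normr_ge0|exact: normr_ge0|exact: hX|exact: hX].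
Qed.

End TensorPolynomials.

(** * The inverse estimate on a square *)

Section InverseEstimate.
Context {R : realType}.
Implicit Types (x z : plane R) (r : R) (l : seq ({poly R} * {poly R})) (P : {poly R}).

Local Notation sq z r := (cbox (z.1 - r, z.2 - r) (z.1 + r, z.2 + r)).

Definition dual_bump (P Q : {poly R}) z r x : R :=
  wpoly P ((x.1 - z.1) / r) * wpoly Q ((x.2 - z.2) / r).

Lemma smooth_wpoly P (f : plane R -> R) : smooth f -> smooth (fun x => wpoly P (f x)).
Proof.
move=> sf; apply: (smoothM (smooth_horner P sf)).
exact: (smoothM (smooth_expinv 1 (smoothD sf (smooth_cst 1))) (smooth_expinv 1 (smooth_rsub 1 sf))).
Qed.

Lemma smooth_dual_bump P Q z r : smooth (dual_bump P Q z r).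
Proof.
exact: (smoothM (smooth_wpoly P (smooth_scaled1 z r)) (smooth_wpoly Q (smooth_scaled2 z r))).
Qed.

Lemma scaled_itv (t c r : R) : 0 < r -> (-1 < (t - c) / r < 1) = (c - r < t < c + r).
Proof.
move=> r0; rewrite ltr_pdivlMr// ltr_pdivrMr// mul1r mulN1r.
by rewrite ltrBrDr ltrBlDr [- r + c]addrC [r + c]addrC.
Qed.

Lemma dual_bump_supp P Q z r x : 0 < r -> ~ sq z r x -> dual_bump P Q z r x = 0.
Proof.
move=> r0 nx; rewrite /dual_bump /wpoly.
have [h1|h1] := boolP (-1 < (x.1 - z.1) / r < 1); last by rewrite (weight_eq0 h1) mulr0 mul0r.
have [h2|h2] := boolP (-1 < (x.2 - z.2) / r < 1); last by rewrite (weight_eq0 h2) !mulr0.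
exfalso; apply: nx; apply: obox_cbox; apply/oboxP => /=.
by move: h1 h2; rewrite !scaled_itv.
Qed.

Lemma wpoly_le P t : `|wpoly P t| <= \sum_(i < size P) `|P`_i|.
Proof.
have [/andP[h1 h2]|h] := boolP (-1 < t < 1); last first.
  by rewrite /wpoly weight_eq0// mulr0 normr0 sumr_ge0.
rewrite /wpoly normrM; have /andP[w0 w1] := weight_itv t.
apply: (@le_trans _ _ `|P.[t]|); first by rewrite ler_piMr// ger0_norm.
rewrite horner_coef; apply: (le_trans (ler_norm_sum _ _ _)); apply: ler_sum => i _.
rewrite normrM ler_piMr// normrX exprn_ile1//.
by rewrite ler_norml; lra.
Qed.

Lemma continuous_scaled (F : R -> R) (c r : R) : continuous F ->
  continuous (fun t : R => F ((t - c) / r)).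
Proof.
move=> cF t; apply: (@continuous_comp _ _ _ (fun t => (t - c) / r) F); last exact: cF.
apply: cvgM; last exact: cvg_cst.
by apply: cvgB; [exact: cvg_id|exact: cvg_cst].
Qed.

Lemma integral_tensf_dual_bump P Q z r l : 0 < r ->
  \int[mu2]_(x in sq z r) (tensf z r l x * dual_bump P Q z r x) =
  r ^+ 2 * \sum_(k <- l) moment (k.1 * P) * moment (k.2 * Q).
Proof.
move=> r0; have mQ : measurable (sq z r : set (mplane R)) by exact: measurable_cbox.
have icont (f : plane R -> R) : smooth f -> (@mu2 R).-integrable (sq z r) (EFin \o f).
  move=> /smooth_cont cf.
  have [B _ HB] := compact_bounded_fun (@cbox_compact _ (z.1 - r, z.2 - r) (z.1 + r, z.2 + r)) cf.
  apply: (bounded_integrable_plane (B := B) mQ _ (continuous_measurable_plane mQ cf) HB).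
  exact: (mu2_fin_sub_cbox mQ (fun x h => h)).
have sd := smooth_dual_bump P Q z r.
elim: l => [|k l IH].
  rewrite big_nil mulr0; under eq_Rintegral do rewrite /tensf big_nil mul0r.
  by rewrite Rintegral_cst// mul0r.
rewrite big_cons mulrDr -IH.
have E x : tensf z r (k :: l) x * dual_bump P Q z r x =
   wpoly (k.1 * P) ((x.1 - z.1) / r) * wpoly (k.2 * Q) ((x.2 - z.2) / r) +
   tensf z r l x * dual_bump P Q z r x.
  rewrite /tensf big_cons mulrDl; congr (_ + _).
  by rewrite /dual_bump /wpoly !hornerM; ring.
under eq_Rintegral do rewrite E.
rewrite RintegralD//; first last.
- exact: (icont _ (smoothM (smooth_tensf z r l) sd)).
- exact: (icont _ (smooth_dual_bump (k.1 * P) (k.2 * Q) z r)).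
congr (_ + _).
rewrite (@Rintegral_cbox_prod R (fun t => wpoly (k.1 * P) ((t - z.1) / r))
  (fun t => wpoly (k.2 * Q) ((t - z.2) / r))).
- by rewrite /= !moment_scale//; ring.
- exact: (continuous_scaled (@continuous_wpoly R (k.1 * P))).
- exact: (continuous_scaled (@continuous_wpoly R (k.2 * Q))).
Qed.

(* Testing with the dual bump functions extracts the coefficients of the
   polynomial; h may be any function with the same action on test functions. *)
Lemma inverse_estimate (p n : nat) (Lam : R) : 1 <= Lam ->
  exists2 C : R, 0 < C & forall z r l (h : plane R -> R), 0 < r -> deg_le p l ->
    sqint mu2 (sq z r) h ->
    (forall theta, smooth theta -> (forall x, ~ sq z r x -> theta x = 0) ->
       \int[mu2]_(x in sq z r) (h x * theta x) =
       \int[mu2]_(x in sq z r) (tensf z r l x * theta x)) ->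
    forall s x, size s = n -> `|x.1 - z.1| <= Lam * r -> `|x.2 - z.2| <= Lam * r ->
    r ^+ (2 * n).+2 * pds s (tensf z r l) x ^+ 2 <= C * ip mu2 (sq z r) h h.
Proof.
move=> L1; have [psi Hpsi] := @dual_poly R p.
pose S a : R := \sum_(i < size (psi a)) `|(psi a)`_i|.
pose B := 1 + \sum_(a < p.+1) S a.
have S0 a : 0 <= S a by apply: sumr_ge0.
have B0 : 0 < B by rewrite ltr_wpDr// sumr_ge0.
have SB a : S a <= B.
  by rewrite /B (bigD1 a)//= addrCA lerDl addr_ge0// sumr_ge0.
(* Each of the n derivatives multiplies the coefficient bound by at most p + 1; the second factor is
   the passage from coefficients to values in [tensf_le]. *)
pose K : R := p.+1%:R ^+ n * (p.+1%:R * Lam ^+ p) ^+ 2.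
have K0 : 0 < K.
  have L0 : 0 < Lam by exact: lt_le_trans L1.
  by rewrite /K mulr_gt0 ?exprn_gt0 ?mulr_gt0 ?exprn_gt0 ?ltr0n.
exists (K ^+ 2 * (4 * (B ^+ 2) ^+ 2)) => [|z r l h r0 dl Lh Hh s x sn hx1 hx2].
  apply: mulr_gt0; first exact: exprn_gt0.
  by apply: mulr_gt0 => //; do 2 apply: exprn_gt0.
have mQ : measurable (sq z r : set (mplane R)) by exact: measurable_cbox.
have muQ : mu2 (sq z r) = (4 * r ^+ 2)%:E.
  by rewrite mu2_cbox /=; [congr EFin; ring|lra|lra].
have muQfin : (mu2 (sq z r) < +oo)%E by rewrite muQ ltry.
set N := ip mu2 (sq z r) h h.
have N0 : 0 <= N by exact: ip_ge0.
(* Cauchy-Schwarz against a dual bump bounded by B^2 on a square of area 4 r^2 gives (r^2 c)^2 <= N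
   (B^2)^2 4 r^2 for every coefficient c, that is, |c| <= T. *)
pose T := Num.sqrt (4 * (B ^+ 2) ^+ 2 * N) / r.
have T0 : 0 <= T by rewrite divr_ge0 ?sqrtr_ge0// ltW.
have T2 : r ^+ 2 * T ^+ 2 = 4 * (B ^+ 2) ^+ 2 * N.
  rewrite /T exprMn exprVn mulrCA mulfV ?mulr1; last by rewrite expf_neq0// gt_eqF.
  by rewrite sqr_sqrtr// mulr_ge0// mulr_ge0// sqr_ge0.
have cT a b : `|tcoef l a b| <= T.
  have [pa|ap] := ltnP p a; first by rewrite (tcoef_eq0 dl) ?pa// normr0.
  have [pb|bp] := ltnP p b; first by rewrite (tcoef_eq0 dl) ?pb ?orbT// normr0.
  pose a' : 'I_p.+1 := Ordinal (ap : (a < p.+1)%N).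
  pose b' : 'I_p.+1 := Ordinal (bp : (b < p.+1)%N).
  pose th := dual_bump (psi a') (psi b') z r.
  have sth : smooth th by exact: smooth_dual_bump.
  have th_le y : `|th y| <= B ^+ 2.
    rewrite /th /dual_bump normrM expr2; apply: ler_pM => //.
      exact: le_trans (wpoly_le _ _) (SB a').
    exact: le_trans (wpoly_le _ _) (SB b').
  have Lth : sqint mu2 (sq z r) th.
    apply: (bounded_sqint mQ muQfin (continuous_measurable_plane mQ (smooth_cont sth)) (B := B ^+ 2)).
    by move=> y _.
  (* The hypothesis on h replaces it by the polynomial, whose product moments with the dual
     polynomials are its coefficients; r^2 is the Jacobian of the scaling. *)
  have E : ip mu2 (sq z r) h th = r ^+ 2 * tcoef l a b.
    rewrite /ip Hh//; last by move=> y; exact: dual_bump_supp.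
    rewrite integral_tensf_dual_bump//; congr (_ * _).
    rewrite /tcoef big_seq [RHS]big_seq; apply: eq_bigr => k kl.
    have /andP[h1 h2] := allP dl _ kl.
    by rewrite !Hpsi.
  have CS := ip_CauchySchwarz mQ Lh Lth.
  have thth : ip mu2 (sq z r) th th <= (B ^+ 2) ^+ 2 * (4 * r ^+ 2).
    have -> : (B ^+ 2) ^+ 2 * (4 * r ^+ 2) = \int[mu2]_(x in sq z r) ((B ^+ 2) ^+ 2).
      by rewrite Rintegral_cst// muQ.
    apply: le_Rintegral => //.
    - exact: (sqint_ipP mQ Lth Lth).
    - by apply: (bounded_integrable_plane (B := (B ^+ 2) ^+ 2) mQ muQfin) => // y _; rewrite ger0_norm ?sqr_ge0.
    - by move=> y _; rewrite -expr2 -(real_normK (num_real (th y))) lerXn2r ?nnegrE ?sqr_ge0.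
  rewrite -[leRHS]ger0_norm// -(ler_pXn2r (n := 2)) ?nnegrE//.
  rewrite !real_normK ?num_real//.
  rewrite -(@ler_pM2l _ (r ^+ 2 * r ^+ 2)) ?mulr_gt0 ?exprn_gt0//.
  rewrite -[X in _ <= X]mulrA T2.
  have -> : r ^+ 2 * r ^+ 2 * tcoef l a b ^+ 2 = (r ^+ 2 * tcoef l a b) ^+ 2 by ring.
  rewrite -E; apply: (le_trans CS).
  have -> : r ^+ 2 * (4 * (B ^+ 2) ^+ 2 * N) = N * ((B ^+ 2) ^+ 2 * (4 * r ^+ 2)) by ring.
  by rewrite ler_wpM2l.
have cTs : deg_le p (foldr tderiv l s) /\
    forall a b, `|tcoef (foldr tderiv l s) a b| <= p.+1%:R ^+ n * T.
  rewrite -sn; elim: s {sn} => [|i s [IHd IHc]] /=; first by split => // a b; rewrite mul1r.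
  split; first exact: deg_le_tderiv.
  by move=> a b; rewrite exprS -mulrA; exact: (tcoef_tderiv i IHd IHc).
case: cTs => dls cTs.
have Hle := tensf_le dls cTs r0 L1 hx1 hx2.
rewrite pds_tensf sn exprMn exprVn.
have -> : forall y : R, r ^+ (2 * n).+2 * ((r ^+ n)^-1 ^+ 2 * y) = r ^+ 2 * y.
  move=> y; rewrite -addn2 exprD mulnC exprM.
  have : r ^+ n != 0 by rewrite expf_neq0// gt_eqF.
  by move: (r ^+ n) => w w0; field.
rewrite -(real_normK (num_real (tensf _ _ _ _))).
apply: (@le_trans _ _ (r ^+ 2 * (K * T) ^+ 2)).
  have KT0 : 0 <= K * T by exact: mulr_ge0 (ltW K0) T0.
  apply: ler_wpM2l; first exact: sqr_ge0.
  apply: lerXn2r; rewrite ?nnegrE//.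
  apply: (le_trans Hle); rewrite /K le_eqVlt; apply/orP; left; apply/eqP; ring.
have -> : r ^+ 2 * (K * T) ^+ 2 = K ^+ 2 * (r ^+ 2 * T ^+ 2) by rewrite exprMn mulrCA.
by rewrite T2 !mulrA lexx.
Qed.

End InverseEstimate.

(** * Directional derivatives of polynomials *)

Section DirectionalDerivatives.
Context {R : realType}.
Implicit Types (x v z : plane R) (f g : plane R -> R) (P : {poly R}).

(** Linearity in v is more than the existence of partial derivatives gives. It is the bridge from
    the edge normals of the estimator to the partial derivatives of the inverse estimate. *)
Definition dirlin f :=
  forall x v, is_derive x v f (v.1 * pd 0 f x + v.2 * pd 1 f x).

Lemma dirlinP f (a b : plane R -> R) :
  (forall x v, is_derive x v f (v.1 * a x + v.2 * b x)) -> dirlin f.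
Proof.
move=> H x v.
have -> : pd 0 f x = a x.
  by have [_] := H x (basis_vec 0); rewrite /= mul1r mul0r addr0.
have -> : pd 1 f x = b x.
  by have [_] := H x (basis_vec 1); rewrite /= mul1r mul0r add0r.
exact: H.
Qed.

Lemma dirlin_cst (c : R) : dirlin (fun=> c).
Proof.
apply: (@dirlinP _ (fun=> 0) (fun=> 0)) => x v.
by rewrite !mulr0 addr0; exact: is_derive_cst.
Qed.

Lemma dirlin_fst : dirlin (fun x => x.1).
Proof.
apply: (@dirlinP _ (fun=> 1) (fun=> 0)) => x v.
by rewrite mulr0 addr0 mulr1; exact: is_derive_fst.
Qed.

Lemma dirlin_snd : dirlin (fun x => x.2).
Proof.
apply: (@dirlinP _ (fun=> 0) (fun=> 1)) => x v.
by rewrite mulr0 add0r mulr1; exact: is_derive_snd.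
Qed.

Lemma dirlinD f g : dirlin f -> dirlin g -> dirlin (fun x => f x + g x).
Proof.
move=> Hf Hg.
apply: (@dirlinP _ (fun x => pd 0 f x + pd 0 g x) (fun x => pd 1 f x + pd 1 g x)) => x v.
have -> : v.1 * (pd 0 f x + pd 0 g x) + v.2 * (pd 1 f x + pd 1 g x) =
  (v.1 * pd 0 f x + v.2 * pd 1 f x) + (v.1 * pd 0 g x + v.2 * pd 1 g x).
  by move: (pd 0 f x) (pd 0 g x) (pd 1 f x) (pd 1 g x) => ? ? ? ?; ring.
exact: (is_deriveD (Hf x v) (Hg x v)).
Qed.

Lemma dirlinM f g : dirlin f -> dirlin g -> dirlin (fun x => f x * g x).
Proof.
move=> Hf Hg.
apply: (@dirlinP _ (fun x => f x * pd 0 g x + g x * pd 0 f x)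
  (fun x => f x * pd 1 g x + g x * pd 1 f x)) => x v.
have -> : v.1 * (f x * pd 0 g x + g x * pd 0 f x) +
    v.2 * (f x * pd 1 g x + g x * pd 1 f x) =
  f x * (v.1 * pd 0 g x + v.2 * pd 1 g x) + g x * (v.1 * pd 0 f x + v.2 * pd 1 f x).
  by move: (pd 0 f x) (pd 0 g x) (pd 1 f x) (pd 1 g x) (f x) (g x) => ? ? ? ? ? ?; ring.
exact: (is_deriveM (Hf x v) (Hg x v)).
Qed.

Lemma dirlin_horner P f : dirlin f -> dirlin (fun x => P.[f x]).
Proof.
move=> Hf.
apply: (@dirlinP _ (fun x => P^`().[f x] * pd 0 f x) (fun x => P^`().[f x] * pd 1 f x)) => x v.
have -> : v.1 * (P^`().[f x] * pd 0 f x) + v.2 * (P^`().[f x] * pd 1 f x) =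
  P^`().[f x] * (v.1 * pd 0 f x + v.2 * pd 1 f x).
  by move: (pd 0 f x) (pd 1 f x) (P^`().[f x]) => ? ? ?; ring.
exact: (is_derive_comp_plane (is_derive_poly P (f x)) (Hf x v)).
Qed.

Lemma dirlin_tensf z r l : dirlin (tensf z r l).
Proof.
have d1 : dirlin (fun x : plane R => (x.1 - z.1) / r).
  exact: (dirlinM (dirlinD dirlin_fst (dirlin_cst (- z.1))) (dirlin_cst r^-1)).
have d2 : dirlin (fun x : plane R => (x.2 - z.2) / r).
  exact: (dirlinM (dirlinD dirlin_snd (dirlin_cst (- z.2))) (dirlin_cst r^-1)).
elim: l => [|k l IH].
  have -> : tensf z r [::] = fun=> 0 by apply/funext => x; rewrite /tensf big_nil.
  exact: dirlin_cst.
have -> : tensf z r (k :: l) =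
    fun x => k.1.[(x.1 - z.1) / r] * k.2.[(x.2 - z.2) / r] + tensf z r l x.
  by apply/funext => x; rewrite /tensf big_cons.
exact: (dirlinD (dirlinM (dirlin_horner _ d1) (dirlin_horner _ d2)) IH).
Qed.

Lemma dirlin_derive f x v : dirlin f -> 'D_v f x = v.1 * pd 0 f x + v.2 * pd 1 f x.
Proof. by move=> /(_ x v)[]. Qed.

End DirectionalDerivatives.

(** * Polynomials independent of a local frame *)

Section PlanePolynomials.
Context {R : realType}.
Implicit Types (x v z : plane R) (f g : plane R -> R) (p : nat).
Implicit Types (l : seq ({poly R} * {poly R})).

(** The degree is at most p in each variable separately, a class that contains [poly_fun p] and is
    stable under affine rescaling of each coordinate, so [tpoly_recenter] can move to any square. *)
Definition tpoly p f := exists2 l, deg_le p l & f = tensf 0 1 l.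

Lemma poly_fun_tpoly p f : poly_fun p f -> tpoly p f.
Proof.
move=> [c Hc].
exists [seq ((if (ab.1 + ab.2 <= p)%N then c ab.1 ab.2 else 0) *: 'X^(ab.1), 'X^(ab.2))
   | ab : 'I_p.+1 * 'I_p.+1 <- [seq (a, b) | a <- enum 'I_p.+1, b <- enum 'I_p.+1]].
  apply/allP => _ /mapP[_ /allpairsP[[a b] /= [_ _ ->]] ->] /=.
  rewrite size_polyXn ltn_ord andbT.
  by apply: (leq_trans (size_scale_leq _ _)); rewrite size_polyXn.
apply/funext => x; rewrite Hc /tensf big_map big_allpairs big_enum.
apply: eq_bigr => a _; rewrite big_enum big_mkcond; apply: eq_bigr => b _ /=.
rewrite !subr0 !divr1 hornerZ !hornerXn.
by case: ifP => _; rewrite ?mul0r.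
Qed.

Lemma tpoly_smooth p f : tpoly p f -> smooth f.
Proof. by move=> [l _ ->]; exact: smooth_tensf. Qed.

Lemma tpoly_dirlin p f : tpoly p f -> dirlin f.
Proof. by move=> [l _ ->]; exact: dirlin_tensf. Qed.

Lemma tpoly_pds p f s : tpoly p f -> tpoly p (pds s f).
Proof.
move=> [l dl ->]; exists (foldr tderiv l s).
  by elim: s => [|i s IH] //=; exact: deg_le_tderiv.
by rewrite pds_tensf; apply/funext => x; rewrite invr1 expr1n mul1r.
Qed.

Lemma tpoly_lin p f g (a b : R) : tpoly p f -> tpoly p g ->
  tpoly p (fun x => a * f x + b * g x).
Proof.
move=> [l dl ->] [m dm ->].
pose sc (c : R) (k : {poly R} * {poly R}) := (c *: k.1, k.2).
have dsc c n : deg_le p n -> deg_le p (map (sc c) n).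
  move=> /allP H; apply/allP => _ /mapP[k /H /andP[h1 h2] ->] /=.
  by rewrite h2 andbT (leq_trans (size_scale_leq _ _)).
have Esc c n x : tensf 0 1 (map (sc c) n) x = c * tensf 0 1 n x.
  rewrite /tensf big_map mulr_sumr; apply: eq_bigr => k _ /=.
  by rewrite hornerZ mulrA.
exists (map (sc a) l ++ map (sc b) m).
  by rewrite /deg_le all_cat; apply/andP; split; exact: dsc.
apply/funext => x; rewrite -!Esc.
by rewrite [RHS]big_cat.
Qed.

Lemma tpolyB p f g : tpoly p f -> tpoly p g -> tpoly p (fun x => f x - g x).
Proof.
move=> Hf Hg; have := tpoly_lin 1 (-1) Hf Hg.
by under eq_fun do rewrite mul1r mulN1r.
Qed.

Lemma tpoly0 p : tpoly p (fun=> 0).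
Proof. by exists [::] => //; apply/funext => x; rewrite /tensf big_nil. Qed.

Lemma tpoly_recenter p f z (r : R) : r != 0 -> tpoly p f ->
  exists2 l, deg_le p l & f = tensf z r l.
Proof.
move=> r0 [l dl ->].
exists [seq (k.1 \Po (r *: 'X + z.1%:P), k.2 \Po (r *: 'X + z.2%:P)) | k <- l].
  have sc (c : R) (P : {poly R}) : (size P <= p.+1)%N -> (size (P \Po (r *: 'X + c%:P)) <= p.+1)%N.
    move=> sP; apply: (leq_trans (size_comp_poly_leq _ _)).
    have -> : size (r *: 'X + c%:P) = 2%N.
      by rewrite -mul_polyC size_MXaddC polyC_eq0 (negPf r0) /= size_polyC r0.
    by rewrite muln1; case: (size P) sP.
  move/allP: dl => H; apply/allP => _ /mapP[k /H /andP[h1 h2] ->] /=.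
  by rewrite !sc.
apply/funext => x; rewrite /tensf big_map; apply: eq_bigr => k _ /=.
rewrite !horner_comp !hornerD !hornerZ !hornerX !hornerC !subr0 !divr1.
by congr (k.1.[_] * k.2.[_]); field.
Qed.

Local Notation sq z r := (cbox (z.1 - r, z.2 - r) (z.1 + r, z.2 + r)).

Lemma inverse_estimate_tpoly p n (Lam : R) : 1 <= Lam ->
  exists2 C : R, 0 < C & forall z (r : R) (q h : plane R -> R), 0 < r -> tpoly p q ->
    sqint mu2 (sq z r) h ->
    (forall theta, smooth theta -> (forall x, ~ sq z r x -> theta x = 0) ->
       \int[mu2]_(x in sq z r) (h x * theta x) =
       \int[mu2]_(x in sq z r) (q x * theta x)) ->
    forall s x, size s = n -> `|x.1 - z.1| <= Lam * r -> `|x.2 - z.2| <= Lam * r ->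
    r ^+ (2 * n).+2 * pds s q x ^+ 2 <= C * ip mu2 (sq z r) h h.
Proof.
move=> L1; have [C C0 HC] := @inverse_estimate R p n Lam L1.
exists C => // z r q h r0 Hq; have rn0 : r != 0 by rewrite gt_eqF.
by have [l dl ->] := tpoly_recenter z rn0 Hq; exact: HC.
Qed.

(** The inverse estimate without derivatives and with h = 0; for a given x, [Lam] is taken so large
    that x is within reach of the square. *)
Lemma tpoly_eq0 p f z (r : R) : 0 < r -> tpoly p f -> (forall x, sq z r x -> f x = 0) ->
  f = fun=> 0.
Proof.
move=> r0 Hf f0; apply/funext => x.
pose Lam := 1 + (`|x.1 - z.1| + `|x.2 - z.2|) / r.
have L1 : 1 <= Lam by rewrite lerDl divr_ge0 ?addr_ge0// ltW.
have Lr : Lam * r = r + (`|x.1 - z.1| + `|x.2 - z.2|).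
  by rewrite /Lam mulrDl mul1r divfK// gt_eqF.
have [C C0 HC] := inverse_estimate_tpoly p 0 L1.
have mQ : measurable (sq z r : set (mplane R)) by exact: measurable_cbox.
have E theta : smooth theta -> (forall y, ~ sq z r y -> theta y = 0) ->
    \int[mu2]_(y in sq z r) (0 * theta y) = \int[mu2]_(y in sq z r) (f y * theta y).
  by move=> _ _; apply: eq_Rintegral => y; rewrite inE => /f0 ->.
have := HC z r f (fun=> 0) r0 Hf (sqint0 _ mQ) E [::] x erefl.
rewrite Lr /= muln0.
have n1 := normr_ge0 (x.1 - z.1); have n2 := normr_ge0 (x.2 - z.2).
move=> /(_ _ _); have -> : ip mu2 (sq z r) (fun=> 0) (fun=> 0) = 0 :> R.
  by rewrite /ip; under eq_Rintegral do rewrite mul0r; rewrite Rintegral_cst ?mul0r.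
rewrite mulr0 => /(_ _ _) H.
have {}H : r ^+ 2 * f x ^+ 2 <= 0 by apply: H; lra.
apply/eqP; rewrite -sqrf_eq0 eq_le sqr_ge0 andbT.
by move: H; rewrite pmulr_rle0// exprn_gt0.
Qed.

End PlanePolynomials.

(** * Geometry of newest-vertex bisection *)

Section Triangles.
Context {R : realType}.
Implicit Types (K : triangle R) (x y z u v o : plane R) (E F : plane R * plane R).
Implicit Types (T S : triangulation R).

Definition cross u v : R := u.1 * v.2 - u.2 * v.1.

Definition tdet K : R := cross (K.1.2 - K.1.1) (K.2 - K.1.1).

Lemma area_tdet K : area K = `|tdet K| / 2.
Proof. by rewrite /area /tdet /cross /= [X in _ - X]mulrC. Qed.

Lemma tdet_neq0 K : 0 < area K -> tdet K != 0.
Proof. by rewrite area_tdet => h; rewrite -normr_gt0; lra. Qed.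

Lemma plane_eq x y : x.1 = y.1 -> x.2 = y.2 -> x = y.
Proof. by case: x y => [? ?] [? ?] /= -> ->. Qed.

(** Cramer's rule: [bs] and [bt] are the barycentric coordinates belonging to the second and third
    vertex. *)
Definition bs K x : R := cross (x - K.1.1) (K.2 - K.1.1) / tdet K.
Definition bt K x : R := cross (K.1.2 - K.1.1) (x - K.1.1) / tdet K.

Lemma bary_sum K x : 0 < area K ->
  x = K.1.1 + bs K x *: (K.1.2 - K.1.1) + bt K x *: (K.2 - K.1.1).
Proof.
move=> /tdet_neq0; rewrite /bs /bt /tdet /cross.
case: K x => [[[a1 a2] [b1 b2]] [c1 c2]] [x1 x2] /= h.
by apply: plane_eq; rewrite /= /GRing.scale /=; field.
Qed.

Lemma bs_comb K (s t : R) : 0 < area K ->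
  bs K (K.1.1 + s *: (K.1.2 - K.1.1) + t *: (K.2 - K.1.1)) = s.
Proof.
move=> /tdet_neq0; rewrite /bs /bt /tdet /cross.
case: K => [[[a1 a2] [b1 b2]] [c1 c2]] /= h.
by rewrite /= /GRing.scale /=; field.
Qed.

Lemma bt_comb K (s t : R) : 0 < area K ->
  bt K (K.1.1 + s *: (K.1.2 - K.1.1) + t *: (K.2 - K.1.1)) = t.
Proof.
move=> /tdet_neq0; rewrite /bs /bt /tdet /cross.
case: K => [[[a1 a2] [b1 b2]] [c1 c2]] /= h.
by rewrite /= /GRing.scale /=; field.
Qed.

Lemma tri_setP K x : 0 < area K ->
  tri_set K x <-> [/\ 0 <= bs K x, 0 <= bt K x & bs K x + bt K x <= 1].
Proof.
move=> K0; split; first by move=> [s [t [s0 t0 st ->]]]; rewrite bs_comb// bt_comb.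
by move=> [s0 t0 st]; exists (bs K x), (bt K x); split => //; exact: bary_sum.
Qed.

Definition tri_int K : set (plane R) :=
  [set x | [/\ 0 < bs K x, 0 < bt K x & bs K x + bt K x < 1]].

Lemma tri_int_sub K : 0 < area K -> tri_int K `<=` tri_set K.
Proof. by move=> K0 x [s0 t0 st]; apply/(tri_setP _ K0); split; exact: ltW. Qed.

Lemma continuous_bs K : continuous (bs K).
Proof.
have -> : bs K = fun x => ((x.1 - K.1.1.1) * (K.2.2 - K.1.1.2) + (- 1) * ((x.2 - K.1.1.2) * (K.2.1 - K.1.1.1))) * (tdet K)^-1.
  by apply/funext => x; rewrite /bs /cross /= mulN1r.
apply: smooth_cont.
exact: (smoothM (smoothD (smoothM (smooth_subr _ (@smooth_fst R)) (smooth_cst _))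
  (smoothZ _ (smoothM (smooth_subr _ (@smooth_snd R)) (smooth_cst _)))) (smooth_cst _)).
Qed.

Lemma continuous_bt K : continuous (bt K).
Proof.
have -> : bt K = fun x => ((x.2 - K.1.1.2) * (K.1.2.1 - K.1.1.1) + (- 1) * ((x.1 - K.1.1.1) * (K.1.2.2 - K.1.1.2))) * (tdet K)^-1.
  by apply/funext => x; rewrite /bt /cross /= mulN1r; congr (_ / _); ring.
apply: smooth_cont.
exact: (smoothM (smoothD (smoothM (smooth_subr _ (@smooth_snd R)) (smooth_cst _))
  (smoothZ _ (smoothM (smooth_subr _ (@smooth_fst R)) (smooth_cst _)))) (smooth_cst _)).
Qed.

Lemma open_tri_int K : open (tri_int K).
Proof.
have -> : tri_int K = (bs K @^-1` `]0, +oo[ `&` bt K @^-1` `]0, +oo[) `&`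
    (fun x => bs K x + bt K x) @^-1` `]-oo, 1[.
  apply/seteqP; split => x; rewrite /tri_int /= !in_itv /= !andbT; first by case.
  by move=> [[]].
have cb := @continuous_bs K; have ct := @continuous_bt K.
apply: openI; [apply: openI|]; apply: open_comp; do ?exact: interval_open.
- by move=> x _; exact: cb.
- by move=> x _; exact: ct.
- by move=> x _; apply: cvgD; [exact: cb|exact: ct].
Qed.

Lemma closed_tri_set K : 0 < area K -> closed (tri_set K).
Proof.
move=> K0.
have -> : tri_set K = (bs K @^-1` `[0, +oo[ `&` bt K @^-1` `[0, +oo[) `&`
    (fun x => bs K x + bt K x) @^-1` `]-oo, 1].
  apply/seteqP; split => x.
    by move=> /(tri_setP _ K0)[h1 h2 h3]; rewrite /= !in_itv /= !andbT.
  by rewrite /= !in_itv /= !andbT => -[[h1 h2] h3]; apply/(tri_setP _ K0).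
have cb := @continuous_bs K; have ct := @continuous_bt K.
apply: closedI; [apply: closedI|]; apply: preimage_closed; do ?exact: interval_closed.
- by move=> x _; exact: cb.
- by move=> x _; exact: ct.
- by move=> x _; apply: cvgD; [exact: cb|exact: ct].
Qed.

Definition nsq u : R := u.1 ^+ 2 + u.2 ^+ 2.

(* Both this quantity and the area are halved by newest-vertex bisection, so
   that their quotient measures the shape regularity. *)
Definition legs K : R := nsq (K.2 - K.1.2) + nsq (K.2 - K.1.1).

(** Apollonius: |c - a|^2 + |c - b|^2 = 2 |c - m|^2 + 2 |a - m|^2 for the midpoint m of ab, and m is
    the vertex opposite to the refinement edge ca of the child. *)
Lemma legs_child1 K : legs (child1 K) = legs K / 2.
Proof.
case: K => [[[a1 a2] [b1 b2]] [c1 c2]].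
by rewrite /legs /nsq /child1 /refmid /= /GRing.scale /=; field.
Qed.

Lemma legs_child2 K : legs (child2 K) = legs K / 2.
Proof.
case: K => [[[a1 a2] [b1 b2]] [c1 c2]].
by rewrite /legs /nsq /child2 /refmid /= /GRing.scale /=; field.
Qed.

Lemma area_child1 K : area (child1 K) = area K / 2.
Proof.
rewrite !area_tdet; have -> : tdet (child1 K) = tdet K / 2.
  case: K => [[[a1 a2] [b1 b2]] [c1 c2]].
  by rewrite /tdet /cross /child1 /refmid /= /GRing.scale /=; field.
by rewrite normrM (@ger0_norm _ (2^-1)).
Qed.

Lemma area_child2 K : area (child2 K) = area K / 2.
Proof.
rewrite !area_tdet; have -> : tdet (child2 K) = tdet K / 2.
  case: K => [[[a1 a2] [b1 b2]] [c1 c2]].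
  by rewrite /tdet /cross /child2 /refmid /= /GRing.scale /=; field.
by rewrite normrM (@ger0_norm _ (2^-1)).
Qed.

Lemma child1_sub K : tri_set (child1 K) `<=` tri_set K.
Proof.
case: K => [[[a1 a2] [b1 b2]] [c1 c2]] x [s [t [s0 t0 st ->]]].
exists (t / 2), (1 - s - t); split; [lra|lra|lra|].
by apply: plane_eq; rewrite /refmid /= /GRing.scale /=; field.
Qed.

Lemma child2_sub K : tri_set (child2 K) `<=` tri_set K.
Proof.
case: K => [[[a1 a2] [b1 b2]] [c1 c2]] x [s [t [s0 t0 st ->]]].
exists (1 - s - t / 2), s; split; [lra|lra|lra|].
by apply: plane_eq; rewrite /refmid /= /GRing.scale /=; field.
Qed.

Lemma children_cover K x : tri_set K x -> tri_set (child1 K) x \/ tri_set (child2 K) x.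
Proof.
case: K => [[[a1 a2] [b1 b2]] [c1 c2]] [s [t [s0 t0 st ->]]].
(* The median that bisects K is the set where the barycentric coordinates of both ends of the
   refinement edge agree. *)
have [h|h] := leP s (1 - s - t).
  left; exists (1 - s - t - s), (2 * s); split; [lra|lra|lra|].
  by apply: plane_eq; rewrite /refmid /= /GRing.scale /=; field.
right; exists t, (2 * (1 - s - t)); split; [lra|lra|lra|].
by apply: plane_eq; rewrite /refmid /= /GRing.scale /=; field.
Qed.

Lemma nvb_parent T S : nvb T S -> forall K, K \in S ->
  exists2 K', K' \in T & tri_set K `<=` tri_set K'.
Proof.
elim => [K KT|S' K0 _ IH K0S K]; first by exists K.
rewrite !inE => /or3P[/eqP->|/eqP->|/andP[_ KS]]; last exact: IH.
  have [K' K'T sub] := IH _ K0S; exists K' => //.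
  exact: subset_trans (@child1_sub K0) sub.
have [K' K'T sub] := IH _ K0S; exists K' => //.
exact: subset_trans (@child2_sub K0) sub.
Qed.

Lemma nvb_cover T S : nvb T S -> forall K x, K \in T -> tri_set K x ->
  exists K', [/\ K' \in S, tri_set K' `<=` tri_set K & tri_set K' x].
Proof.
elim => [K x KT Kx|S' K0 _ IH K0S K x KT Kx]; first by exists K; split => // y.
have [K' [K'S sub K'x]] := IH _ _ KT Kx.
have [eqK|neK] := eqVneq K' K0; last first.
  by exists K'; split => //; rewrite !inE neK K'S !orbT.
rewrite eqK in sub K'x; have [h|h] := children_cover K'x.
  exists (child1 K0); split => //; first by rewrite !inE eqxx.
  exact: subset_trans (@child1_sub K0) sub.
exists (child2 K0); split => //; first by rewrite !inE eqxx orbT.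
exact: subset_trans (@child2_sub K0) sub.
Qed.

(** Bisection leaves the quotient of [legs] and [area] unchanged and decreases the area, so both
    bounds of the initial triangulation persist. *)
Definition shape_ok (sigma amax : R) K :=
  [/\ 0 < area K, legs K <= sigma * area K & area K <= amax].

Lemma nvb_shape sigma amax T S : nvb T S -> (forall K, K \in T -> shape_ok sigma amax K) ->
  forall K, K \in S -> shape_ok sigma amax K.
Proof.
move=> H HT; elim: H => [//|S' K0 _ IH K0S K].
have [h1 h2 h3] := IH _ K0S.
rewrite !inE => /or3P[/eqP->|/eqP->|/andP[_ KS]]; last exact: IH.
  by rewrite /shape_ok legs_child1 area_child1; split; lra.
by rewrite /shape_ok legs_child2 area_child2; split; lra.
Qed.

Lemma shape_exists T : (forall K, K \in T -> 0 < area K) ->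
  exists sigma amax, 1 <= sigma /\ forall K, K \in T -> shape_ok sigma amax K.
Proof.
move=> HT; have legs0 K : 0 <= legs K by rewrite /legs /nsq !addr_ge0 ?sqr_ge0.
have bnd (G : triangle R -> R) : (forall K, K \in T -> 0 <= G K) ->
    forall K, K \in T -> G K <= \sum_(K <- T) G K.
  move=> G0 K KT; rewrite (big_rem K)//= lerDl big_seq sumr_ge0// => K' K'T.
  by apply: G0; exact: (mem_rem K'T).
exists (1 + \sum_(K <- T) legs K / area K), (\sum_(K <- T) area K); split.
  rewrite lerDl big_seq sumr_ge0// => K KT; rewrite divr_ge0//.
  exact/ltW/HT.
move=> K KT; have K0 := HT _ KT; split => //; last first.
  by apply: (bnd area) => // K' K'T; exact/ltW/HT.
rewrite -ler_pdivrMr//.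
apply: (le_trans (bnd (fun K => legs K / area K) _ _ KT)); last by rewrite lerDr.
by move=> K' K'T; rewrite divr_ge0//; exact/ltW/HT.
Qed.

Definition centroid K : plane R := 3^-1 *: (K.1.1 + K.1.2 + K.2).

(* The square with centre [centroid K] and half side [inrad sigma K] lies in
   [tri_int K]; all scaling arguments use this length. *)
Definition inrad (sigma : R) K : R := Num.sqrt (area K / (12 * (24 * sigma))).

Section Shape.
Variables (sigma amax : R) (K : triangle R).
Hypotheses (sigma1 : 1 <= sigma) (HK : shape_ok sigma amax K).

Lemma inrad_gt0 : 0 < inrad sigma K.
Proof.
have s0 := lt_le_trans ltr01 sigma1; case: HK => K0 _ _.
by rewrite sqrtr_gt0; apply: divr_gt0 => //; apply: mulr_gt0; rewrite ?mulr_gt0 ?ltr0n.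
Qed.

Lemma inrad_sqr : area K = 12 * (24 * sigma) * inrad sigma K ^+ 2.
Proof.
have s0 := lt_le_trans ltr01 sigma1; case: HK => K0 _ _.
have d0 : 0 < 12 * (24 * sigma) by apply: mulr_gt0; rewrite ?mulr_gt0 ?ltr0n.
by rewrite sqr_sqrtr ?divr_ge0// ?ltW// mulrCA mulfV ?mulr1// gt_eqF.
Qed.

(** The constant in [inrad] makes (24 sigma r)^2 equal to 2 sigma |K|, which is at least twice
    [legs K]. The refinement edge ab satisfies |b - a|^2 <= 2 |c - a|^2 + 2 |c - b|^2, so it obeys
    the same bound. *)
Lemma edge_coord_le : let r := inrad sigma K in
  [/\ `|(K.1.2 - K.1.1).1| <= 24 * sigma * r, `|(K.1.2 - K.1.1).2| <= 24 * sigma * r,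
      `|(K.2 - K.1.1).1| <= 24 * sigma * r & `|(K.2 - K.1.1).2| <= 24 * sigma * r].
Proof.
move=> r; have s1 := sigma1; have r0 := inrad_gt0; have rE := inrad_sqr; rewrite -/r in r0 rE.
have [K0 Kl _] := HK.
have D2 : (24 * sigma * r) ^+ 2 = 2 * (sigma * area K) by rewrite rE; ring.
have D0 : 0 <= 24 * sigma * r by rewrite !mulr_ge0//; lra.
have le (y : R) : y ^+ 2 <= (24 * sigma * r) ^+ 2 -> `|y| <= 24 * sigma * r.
  by rewrite -(real_normK (num_real y)) ler_pXn2r.
rewrite {}D2 in le; move: Kl; rewrite /legs /nsq.
case: (K) => [[[a1 a2] [b1 b2]] [c1 c2]] /= in le * => Kl.
have q1 := sqr_ge0 (c1 - b1); have q2 := sqr_ge0 (c2 - b2).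
have q3 := sqr_ge0 (c1 - a1); have q4 := sqr_ge0 (c2 - a2).
have q5 := sqr_ge0 ((c1 - b1) + (c1 - a1)); have q6 := sqr_ge0 ((c2 - b2) + (c2 - a2)).
split; apply: le; nra.
Qed.

Lemma cross_le (u v : plane R) (A B : R) : `|u.1| <= A -> `|u.2| <= A ->
  `|v.1| <= B -> `|v.2| <= B -> `|cross u v| <= 2 * A * B.
Proof.
move=> u1 u2 v1 v2; rewrite /cross; apply: (le_trans (ler_normB _ _)); rewrite !normrM.
have := ler_pM (normr_ge0 _) (normr_ge0 _) u1 v2.
have := ler_pM (normr_ge0 _) (normr_ge0 _) u2 v1; lra.
Qed.

Lemma third_add_small (c d : R) : - 12^-1 <= c <= 12^-1 -> - 12^-1 <= d <= 12^-1 ->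
  [/\ 0 < 3^-1 + c, 0 < 3^-1 + d & 3^-1 + c + (3^-1 + d) < 1].
Proof. by move=> /andP[? ?] /andP[? ?]; split; lra. Qed.

Local Notation g := (centroid K).
Local Notation r := (inrad sigma K).

(** At the centroid all barycentric coordinates are 1/3. Moving each coordinate of the point by at
    most r changes [bs] and [bt] by at most 48 sigma r^2 / |[tdet K]| = 1/12, because |[tdet K]| =
    576 sigma r^2. *)
Lemma inner_square : cbox (g.1 - r, g.2 - r) (g.1 + r, g.2 + r) `<=` tri_int K.
Proof.
have s1 := sigma1; move=> x /cboxP[/= hx1 hx2]; have r0 := inrad_gt0; have rE := inrad_sqr.
have [K0 Kl _] := HK; have d0 := tdet_neq0 K0.
have [v1 v2 w1 w2] := edge_coord_le.
have x1 : `|(x - g).1| <= r by rewrite ler_norml /=; lra.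
have x2 : `|(x - g).2| <= r by rewrite ler_norml /=; lra.
have dE : `|tdet K| = 24 * (24 * sigma) * r ^+ 2.
  by move: rE; rewrite area_tdet; lra.
have cs := cross_le x1 x2 w1 w2; have ct := cross_le v1 v2 x1 x2.
have sE : bs K x = 3^-1 + cross (x - g) (K.2 - K.1.1) / tdet K.
  move: d0; rewrite /bs /tdet /cross /centroid.
  case: (K) x {cs ct x1 x2 hx1 hx2} => [[[a1 a2] [b1 b2]] [c1 c2]] [y1 y2] /= h.
  by rewrite /= /GRing.scale /=; field.
have tE : bt K x = 3^-1 + cross (K.1.2 - K.1.1) (x - g) / tdet K.
  move: d0; rewrite /bt /tdet /cross /centroid.
  case: (K) x {cs ct x1 x2 hx1 hx2 sE} => [[[a1 a2] [b1 b2]] [c1 c2]] [y1 y2] /= h.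
  by rewrite /= /GRing.scale /=; field.
have small (c : R) : `|c| <= 48 * sigma * r ^+ 2 -> `|c / tdet K| <= 12^-1.
  move=> hc; rewrite normrM normfV dE ler_pdivrMr; first by lra.
  have s0 := lt_le_trans ltr01 sigma1; apply: mulr_gt0; last exact: exprn_gt0.
  by apply: mulr_gt0; rewrite ?mulr_gt0 ?ltr0n.
have {}cs : `|cross (x - g) (K.2 - K.1.1) / tdet K| <= 12^-1.
  by apply: small; apply: (le_trans cs); lra.
have {}ct : `|cross (K.1.2 - K.1.1) (x - g) / tdet K| <= 12^-1.
  by apply: small; apply: (le_trans ct); lra.
rewrite /tri_int /= sE tE; move: cs ct; rewrite !ler_norml; exact: third_add_small.
Qed.

Lemma tri_set_near x : tri_set K x ->
  `|x.1 - g.1| <= 48 * sigma * r /\ `|x.2 - g.2| <= 48 * sigma * r.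
Proof.
have s1 := sigma1; move=> [s [t [s0 t0 st ->]]]; have r0 := inrad_gt0.
have [v1 v2 w1 w2] := edge_coord_le.
have comb (p q : R) : `|p| <= 24 * sigma * r -> `|q| <= 24 * sigma * r ->
    `|(s - 3^-1) * p + (t - 3^-1) * q| <= 48 * sigma * r.
  move=> hp hq; apply: (le_trans (ler_normD _ _)); rewrite !normrM.
  have hs : `|s - 3^-1| <= 1 by rewrite ler_norml; lra.
  have ht : `|t - 3^-1| <= 1 by rewrite ler_norml; lra.
  have := ler_pM (normr_ge0 _) (normr_ge0 _) hs hp.
  have := ler_pM (normr_ge0 _) (normr_ge0 _) ht hq; lra.
have := comb _ _ v1 w1; have := comb _ _ v2 w2.
have E1 : (K.1.1 + s *: (K.1.2 - K.1.1) + t *: (K.2 - K.1.1)).1 - g.1 =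
   (s - 3^-1) * (K.1.2 - K.1.1).1 + (t - 3^-1) * (K.2 - K.1.1).1.
  by rewrite /centroid /= /GRing.scale /=; field.
have E2 : (K.1.1 + s *: (K.1.2 - K.1.1) + t *: (K.2 - K.1.1)).2 - g.2 =
   (s - 3^-1) * (K.1.2 - K.1.1).2 + (t - 3^-1) * (K.2 - K.1.1).2.
  by rewrite /centroid /= /GRing.scale /=; field.
by rewrite E1 E2.
Qed.

End Shape.

End Triangles.

(** * Neighbours across an edge of a regular triangulation *)

Section RegularTriangulations.
Context {R : realType}.
Implicit Types (K : triangle R) (x y z u v o : plane R) (E F : plane R * plane R).
Implicit Types (T S : triangulation R) (Omega : set (plane R)).

(** The midpoint identifies an edge: it is no vertex and lies on no other edge of the triangle. A
    triangle of a regular triangulation that contains it therefore has the whole edge. *)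
Definition emid E : plane R := 2^-1 *: (E.1 + E.2).

Lemma segment_cross E x y z : segment E.1 E.2 x -> segment E.1 E.2 y ->
  segment E.1 E.2 z -> cross (y - x) (z - x) = 0.
Proof.
move=> [s _ <-] [t _ <-] [r _ <-]; case: E => [[a1 a2] [b1 b2]].
by rewrite /cross /= /GRing.scale /=; ring.
Qed.

Lemma edge_third K E : E \in edges K ->
  exists o, [/\ o \in vertices K,
    vertices K =i [:: E.1; E.2; o],
    (forall s t : R, 0 <= s -> 0 <= t -> s + t <= 1 ->
       tri_set K (E.1 + s *: (E.2 - E.1) + t *: (o - E.1))) &
    cross (E.2 - E.1) (o - E.1) = tdet K].
Proof.
case: K => [[a b] c]; rewrite !inE => /or3P[]/eqP->.
- exists c; split => //=; first by rewrite !inE eqxx !orbT.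
  by move=> s t s0 t0 st; exists s, t.
- exists a; split => //=; first by rewrite !inE eqxx.
  + by move=> x; rewrite !inE /=; do !case: eqP.
  + move=> s t s0 t0 st; exists (1 - s - t), s; split; [lra|lra|lra|].
    case: a b c => [a1 a2] [b1 b2] [c1 c2].
    by apply: plane_eq; rewrite /= /GRing.scale /=; ring.
  + case: a b c => [a1 a2] [b1 b2] [c1 c2].
    by rewrite /tdet /cross /=; ring.
- exists b; split => //=; first by rewrite !inE eqxx orbT.
  + by move=> x; rewrite !inE /=; do !case: eqP.
  + move=> s t s0 t0 st; exists t, (1 - s - t); split; [lra|lra|lra|].
    case: a b c => [a1 a2] [b1 b2] [c1 c2].
    by apply: plane_eq; rewrite /= /GRing.scale /=; ring.
  + case: a b c => [a1 a2] [b1 b2] [c1 c2].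
    by rewrite /tdet /cross /=; ring.
Qed.

Lemma has_edge_third K E : has_edge K E ->
  exists o, [/\ o \in vertices K,
    vertices K =i [:: E.1; E.2; o],
    (forall s t : R, 0 <= s -> 0 <= t -> s + t <= 1 ->
       tri_set K (E.1 + s *: (E.2 - E.1) + t *: (o - E.1))) &
    `|cross (E.2 - E.1) (o - E.1)| = `|tdet K|].
Proof.
move=> /orP[] /edge_third[ o [h1 h2 h3 hc]].
  by exists o; split; rewrite // hc.
rewrite /= in h2 h3 hc; exists o; split => //.
- by move=> x; rewrite h2 !inE orbCA.
- move=> s t s0 t0 st.
  have -> : E.1 + s *: (E.2 - E.1) + t *: (o - E.1) =
     E.2 + (1 - s - t) *: (E.1 - E.2) + t *: (o - E.2).
    case: E o {h1 h2 h3 hc} => [[a1 a2] [b1 b2]] [c1 c2].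
    by apply: plane_eq; rewrite /= /GRing.scale /=; ring.
  by apply: h3; lra.
- rewrite -hc -normrN; congr `|_|.
  case: E o {h1 h2 h3 hc} => [[a1 a2] [b1 b2]] [c1 c2].
  by rewrite /cross /=; ring.
Qed.

Lemma has_edge_swap K E : has_edge K (E.2, E.1) = has_edge K E.
Proof. by rewrite /has_edge /= orbC; case: E. Qed.

Lemma edge_neq K E : 0 < area K -> has_edge K E -> E.1 != E.2.
Proof.
move=> /tdet_neq0 d0 /has_edge_third[ o [_ _ _ hc]]; apply/eqP => e.
by move: hc; rewrite e /cross !subrr /= !mul0r subrr normr0 => /esym/eqP; rewrite normr_eq0 (negPf d0).
Qed.

Lemma tri_edge_segment K E x : has_edge K E -> segment E.1 E.2 x -> tri_set K x.
Proof.
move=> /has_edge_third[ o [_ _ h _]] [s /=]; rewrite in_itv /= => /andP[s0 s1] <-.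
have := h s 0 s0 (lexx _); rewrite addr0 => /(_ s1).
rewrite scale0r addr0; congr (tri_set K _).
by case: E {h} => a b /=; rewrite scalerBr scalerBl scale1r addrAC addrA.
Qed.

Lemma segment_l (a b : plane R) : segment a b a.
Proof. by exists 0; [rewrite /= in_itv /= lexx ler01|rewrite subr0 scale1r scale0r addr0]. Qed.

Lemma segment_r (a b : plane R) : segment a b b.
Proof. by exists 1; [rewrite /= in_itv /= lexx ler01|rewrite subrr scale1r scale0r add0r]. Qed.

Lemma segment_mid E : segment E.1 E.2 (emid E).
Proof.
exists 2^-1; first by rewrite /= in_itv /=; lra.
rewrite /emid scalerDr; congr (_ *: _ + _); lra.
Qed.

(** An edge other than F ends in the vertex o opposite to F. Its midpoint is then the mean of o and
    an end of F, hence half as far from the line of F as o is, and so not on it. *)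
Lemma edge_mid_eq K E F : 0 < area K -> has_edge K E -> has_edge K F ->
  segment F.1 F.2 (emid E) -> E = F \/ E = (F.2, F.1).
Proof.
move=> K0 hE hF hm; have /negP nE := edge_neq K0 hE.
have [ o [_ vF _ cF]] := has_edge_third hF.
have co : cross (F.2 - F.1) (o - F.1) != 0.
  by rewrite -normr_eq0 cF normr_eq0 tdet_neq0.
have oE x : x \in [:: F.1; F.2] -> emid E = 2^-1 *: (o + x) -> False.
  move=> xF e; have := segment_cross (segment_l F.1 F.2) (segment_r F.1 F.2) hm.
  rewrite e => /eqP; apply/negP.
  have -> : cross (F.2 - F.1) (2^-1 *: (o + x) - F.1) = 2^-1 * cross (F.2 - F.1) (o - F.1).
    case: F o {hF hm vF cF co e} xF => [[a1 a2] [b1 b2]] [c1 c2].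
    by rewrite !inE => /orP[]/eqP->; rewrite /cross /= /GRing.scale /=; field.
  by rewrite mulf_neq0// invr_neq0.
have [ oe [_ vE _ _]] := has_edge_third hE.
have v1 : E.1 \in [:: F.1; F.2; o] by rewrite -vF vE !inE eqxx.
have v2 : E.2 \in [:: F.1; F.2; o] by rewrite -vF vE !inE eqxx orbT.
have n1 : E.1 != o.
  apply/eqP => e; move: v2; rewrite !inE => /or3P[]/eqP e2.
  - by apply: (oE F.1); rewrite ?inE ?eqxx// /emid e e2.
  - by apply: (oE F.2); rewrite ?inE ?eqxx ?orbT// /emid e e2.
  - by apply: nE; rewrite e e2.
have n2 : E.2 != o.
  apply/eqP => e; move: v1; rewrite !inE => /or3P[]/eqP e1.
  - by apply: (oE F.1); rewrite ?inE ?eqxx// /emid e e1 addrC.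
  - by apply: (oE F.2); rewrite ?inE ?eqxx ?orbT// /emid e e1 addrC.
  - by apply: nE; rewrite e e1.
move: v1 v2; rewrite !inE (negPf n1) (negPf n2) !orbF => /orP[]/eqP e1 /orP[]/eqP e2.
- by case: nE; rewrite e1 e2.
- by left; case: E F e1 e2 {hE hF hm nE vF cF co oE vE n1 n2} => [? ?] [? ?] /= -> ->.
- by right; case: E F e1 e2 {hE hF hm nE vF cF co oE vE n1 n2} => [? ?] [? ?] /= -> ->.
- by case: nE; rewrite e1 e2.
Qed.

Lemma emid_not_vertex K E : 0 < area K -> has_edge K E -> emid E \notin vertices K.
Proof.
move=> K0 hE; have nE := edge_neq K0 hE.
have [ o [_ vE _ cE]] := has_edge_third hE.
have co : cross (E.2 - E.1) (o - E.1) != 0.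
  by rewrite -normr_eq0 cE normr_eq0 tdet_neq0.
rewrite vE !inE !negb_or; apply/and3P; split; apply/eqP => e.
- move/eqP: nE; apply; have -> : E.2 = 2 *: emid E - E.1.
    by rewrite /emid scalerA mulfV// scale1r addrAC subrr add0r.
  by rewrite e scaler_nat mulr2n addrK.
- move/eqP: nE; apply; have -> : E.1 = 2 *: emid E - E.2.
    by rewrite /emid scalerA mulfV// scale1r addrK.
  by rewrite e scaler_nat mulr2n addrK.
- move/eqP: co; apply; rewrite -e; apply: (@segment_cross E).
  + exact: segment_l.
  + exact: segment_r.
  + exact: segment_mid.
Qed.

Section Regular.
Variables (Omega : set (plane R)) (T : triangulation R).
Hypothesis HT : regular_triangulation Omega T.

Lemma regular_area K : K \in T -> 0 < area K.
Proof. by case: HT => h _ _; exact: h. Qed.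

(** Each admissible intersection, empty, a vertex or an edge, lies on a line. Overlaps of distinct
    triangles are excluded below by exhibiting three common points that are not collinear. *)
Lemma regular_cross K K' x y z : K \in T -> K' \in T -> K != K' ->
  (tri_set K `&` tri_set K') x -> (tri_set K `&` tri_set K') y ->
  (tri_set K `&` tri_set K') z -> cross (y - x) (z - x) = 0.
Proof.
move=> KT K'T KK'; case: HT => _ _ /(_ _ _ KT K'T KK')[->//|[v [_ _ ->]]|[E [_ _ ->]]].
  by move=> /= -> -> ->; rewrite subrr /cross /= !mul0r subrr.
exact: segment_cross.
Qed.

Lemma regular_not_sub K K' : K \in T -> K' \in T -> tri_set K `<=` tri_set K' -> K = K'.
Proof.
move=> KT K'T sub; apply/eqP; apply: contraT => ne.
have K0 := regular_area KT.
have v1 : tri_set K K.1.1.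
  by exists 0, 0; split; rewrite ?lexx ?addr0 ?ler01// !scale0r !addr0.
have v2 : tri_set K K.1.2.
  exists 1, 0; split; rewrite ?lexx ?addr0 ?ler01// scale0r scale1r addr0.
  by rewrite addrC subrK.
have v3 : tri_set K K.2.
  exists 0, 1; split; rewrite ?lexx ?add0r ?ler01// scale0r scale1r addr0.
  by rewrite addrC subrK.
have := regular_cross KT K'T ne (conj v1 (sub _ v1)) (conj v2 (sub _ v2)) (conj v3 (sub _ v3)).
by move/eqP; rewrite -/(tdet K) (negPf (tdet_neq0 K0)).
Qed.

Lemma regular_neighbor K K' E : K \in T -> K' \in T -> K != K' -> has_edge K E ->
  tri_set K' (emid E) -> has_edge K' E.
Proof.
move=> KT K'T KK' hE hm; have K0 := regular_area KT.
have mK : tri_set K (emid E) by apply: (tri_edge_segment hE); exact: segment_mid.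
case: HT => _ _ /(_ _ _ KT K'T KK')[h|[v [vK _ h]]|[F [hF hF' h]]].
- by have : set0 (emid E) by rewrite -h.
- have : [set v] (emid E) by rewrite -h.
  by move=> /= e; have := emid_not_vertex K0 hE; rewrite e vK.
- have hs : segment F.1 F.2 (emid E) by rewrite -h.
  by have [->|->] := edge_mid_eq K0 hE hF hs; rewrite ?has_edge_swap.
Qed.

(** Close to the midpoint of the common edge there is a point off the edge that belongs to both
    triangles; with the ends of the edge it contradicts collinearity. *)
Lemma regular_same_side K K' E o o' : K \in T -> K' \in T ->
  (forall s t : R, 0 <= s -> 0 <= t -> s + t <= 1 ->
       tri_set K (E.1 + s *: (E.2 - E.1) + t *: (o - E.1))) ->
  (forall s t : R, 0 <= s -> 0 <= t -> s + t <= 1 ->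
       tri_set K' (E.1 + s *: (E.2 - E.1) + t *: (o' - E.1))) ->
  0 < cross (E.2 - E.1) (o - E.1) * cross (E.2 - E.1) (o' - E.1) -> K = K'.
Proof.
move=> KT K'T hK hK' pos; apply/eqP; apply: contraT => ne.
set d := cross (E.2 - E.1) (o - E.1) in pos.
set d' := cross (E.2 - E.1) (o' - E.1) in pos.
have d0 : d != 0 by apply/eqP => e; rewrite e mul0r ltxx in pos.
pose beta := d' / d.
have b0 : 0 < beta.
  rewrite /beta -(pmulr_lgt0 _ (_ : 0 < d ^+ 2)); last by rewrite exprn_even_gt0.
  by have -> : d' / d * d ^+ 2 = d * d' by field.
pose alpha := cross (o' - E.1) (o - E.1) / d.
have oE : o' - E.1 = alpha *: (E.2 - E.1) + beta *: (o - E.1).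
  move: d0; rewrite /alpha /beta /d' /d /cross.
  case: E o o' {hK hK' pos d d' beta b0 alpha} => [[a1 a2] [b1 b2]] [c1 c2] [e1 e2] /= h.
  by apply: plane_eq; rewrite /= /GRing.scale /=; field.
pose e := (4 * (1 + `|alpha| + beta))^-1.
have den : 0 < 1 + `|alpha| + beta by have := normr_ge0 alpha; lra.
have e0 : 0 < e by rewrite invr_gt0 mulr_gt0.
have eE : e * (1 + `|alpha| + beta) = 4^-1.
  by rewrite /e; field; rewrite gt_eqF.
have ea : `|e * alpha| <= 4^-1 by rewrite normrM (gtr0_norm e0) -eE ler_pM2l//; lra.
have e1 : e <= 4^-1.
  by rewrite -eE -[leLHS]mulr1 ler_pM2l//; have := normr_ge0 alpha; lra.
have eb : e * beta <= 4^-1.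
  by rewrite -eE ler_pM2l//; have := normr_ge0 alpha; lra.
have eb0 : 0 < e * beta by exact: mulr_gt0.
move: ea; rewrite ler_norml => /andP[ea1 ea2].
(* Seen from o and from o', this point has tangential coordinates 1/2 + e alpha / 2 and 1/2 - e
   alpha / 2. By the choice of e all perturbations are at most 1/4, so it lies in both triangles. *)
pose x := E.1 + (2^-1 + e * alpha / 2) *: (E.2 - E.1) + (e * beta) *: (o - E.1).
have xK : tri_set K x by apply: hK; lra.
have xE : x = E.1 + (2^-1 - e * alpha / 2) *: (E.2 - E.1) + e *: (o' - E.1).
  rewrite oE /x; case: (E) (o) => [[a1 a2] [b1 b2]] [c1 c2].
  by apply: plane_eq; rewrite /= /GRing.scale /=; field.
have xK' : tri_set K' x by rewrite xE; apply: hK'; lra.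
have l1 : tri_set K E.1.
  have := hK 0 0 (lexx _) (lexx _); rewrite addr0 => /(_ ler01).
  by rewrite !scale0r !addr0.
have l2 : tri_set K E.2.
  have := hK 1 0 ler01 (lexx _); rewrite addr0 => /(_ (lexx _)).
  by rewrite scale1r scale0r addr0 addrC subrK.
have l1' : tri_set K' E.1.
  have := hK' 0 0 (lexx _) (lexx _); rewrite addr0 => /(_ ler01).
  by rewrite !scale0r !addr0.
have l2' : tri_set K' E.2.
  have := hK' 1 0 ler01 (lexx _); rewrite addr0 => /(_ (lexx _)).
  by rewrite scale1r scale0r addr0 addrC subrK.
have := regular_cross KT K'T ne (conj l1 l1') (conj l2 l2') (conj xK xK').
have -> : cross (E.2 - E.1) (x - E.1) = e * beta * d.
  rewrite /x /d /cross; move: (e * beta) (2^-1 + _) => y w.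
  by case: (E) (o) => [[a1 a2] [b1 b2]] [c1 c2]; rewrite /= /GRing.scale /=; ring.
by move/eqP; rewrite mulf_eq0 (negPf d0) orbF gt_eqF.
Qed.

(** The three pairwise products multiply to the positive number (abc)^2, so they cannot all be
    nonpositive. *)
Lemma three_signs (a b c : R) : a != 0 -> b != 0 -> c != 0 ->
  b * c <= 0 -> b * a <= 0 -> c * a <= 0 -> False.
Proof.
move=> a0 b0 c0 bc ba ca; have := mulr_le0 bc ba.
have -> : b * c * (b * a) = b ^+ 2 * (c * a) by ring.
rewrite pmulr_rge0 ?exprn_even_gt0// => ca'.
have /eqP : c * a = 0 by apply/eqP; rewrite eq_le ca.
by rewrite mulf_eq0 (negPf a0) (negPf c0).
Qed.

(* Pigeonhole: two of three triangles sharing an edge lie on the same side of it. *)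
Lemma regular_neighbor_uniq K K1 K2 E : K \in T -> K1 \in T -> K2 \in T ->
  K1 != K -> K2 != K -> has_edge K E -> has_edge K1 E -> has_edge K2 E -> K1 = K2.
Proof.
move=> KT K1T K2T n1 n2 /has_edge_third[ o [_ _ h c]] /has_edge_third[ o1 [_ _ h1 c1]]
  /has_edge_third[ o2 [_ _ h2 c2]].
have nz K' o' : K' \in T -> `|cross (E.2 - E.1) (o' - E.1)| = `|tdet K'| ->
    cross (E.2 - E.1) (o' - E.1) != 0.
  by move=> K'T e; rewrite -normr_eq0 e normr_eq0 tdet_neq0// regular_area.
have z := nz _ _ KT c; have z1 := nz _ _ K1T c1; have z2 := nz _ _ K2T c2.
have [p|p] := ltP 0 (cross (E.2 - E.1) (o1 - E.1) * cross (E.2 - E.1) (o2 - E.1)).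
  exact: (regular_same_side K1T K2T h1 h2 p).
have [q|q] := ltP 0 (cross (E.2 - E.1) (o1 - E.1) * cross (E.2 - E.1) (o - E.1)).
  by have /eqP := regular_same_side K1T KT h1 h q; rewrite (negPf n1).
have [r|r] := ltP 0 (cross (E.2 - E.1) (o2 - E.1) * cross (E.2 - E.1) (o - E.1)).
  by have /eqP := regular_same_side K2T KT h2 h r; rewrite (negPf n2).
case: (three_signs z z1 z2 p q r).
Qed.

Lemma regular_interior_disjoint K K' : K \in T -> K' \in T -> K != K' ->
  tri_int K `&` tri_int K' = set0.
Proof.
move=> KT K'T ne; apply/seteqP; split => // x [xK xK'].
have oU : open (tri_int K `&` tri_int K') by apply: openI; exact: open_tri_int.
have [e e0 eU] := open_boxP oU (conj xK xK').
have sub y : cbox (x.1 - e, x.2 - e) (x.1 + e, x.2 + e) y -> (tri_set K `&` tri_set K') y.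
  by move=> /eU[h h']; split; apply: tri_int_sub => //; exact: regular_area.
have h0 : cbox (x.1 - e, x.2 - e) (x.1 + e, x.2 + e) x.
  by apply/cboxP => /=; lra.
have h1 : cbox (x.1 - e, x.2 - e) (x.1 + e, x.2 + e) (x.1 + e, x.2).
  by apply/cboxP => /=; lra.
have h2 : cbox (x.1 - e, x.2 - e) (x.1 + e, x.2 + e) (x.1, x.2 + e).
  by apply/cboxP => /=; lra.
have := regular_cross KT K'T ne (sub _ h0) (sub _ h1) (sub _ h2).
rewrite /cross /=; have -> : (x.1 + e - x.1) * (x.2 + e - x.2) - (x.2 - x.2) * (x.1 - x.1) = e ^+ 2 by ring.
by move/eqP; rewrite sqrf_eq0 gt_eqF.
Qed.

Lemma regular_sub_closure K : K \in T -> tri_set K `<=` closure Omega.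
Proof. by case: HT => _ -> _ KT x Kx; exists K. Qed.

(* A point of tri_int K outside Omega would be a boundary point of Omega, but
   the points just below the local graph are not even in the closure of Omega. *)
Lemma regular_interior_sub K : open Omega -> lipschitz_boundary Omega -> K \in T ->
  tri_int K `<=` Omega.
Proof.
move=> oO lip KT x xK; apply: contrapT => nO.
have K0 := regular_area KT.
have clx : closure Omega x by apply: (regular_sub_closure KT); exact: tri_int_sub.
have bx : boundary Omega x by split => //; rewrite (interior_id _).1.
have [e [r [h [L [g [e1 r0 h0 gL gP]]]]]] := lip _ bx.
have en : e.1 ^+ 2 + e.2 ^+ 2 = 1.
  by rewrite -[LHS]sqr_sqrtr ?addr_ge0 ?sqr_ge0// -/(enorm e) e1 expr1n.
(* In the local frame x is the origin, and x is outside [Omega], so it does not lie above the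
   graph. *)
have g0 : 0 <= g 0.
  rewrite leNgt; apply/negP => gn; apply: nO.
  have := gP 0 0; rewrite !normr0 => /(_ r0 h0)[_ /(_ gn)].
  by rewrite !scale0r !addr0.
have [d d0 dK] := open_boxP (@open_tri_int _ K) xK.
pose t := - Num.min (h / 2) (d / 2).
have t0 : t < 0 by rewrite /t oppr_lt0 lt_min !divr_gt0.
have th : `|t| < h.
  rewrite normrN ger0_norm; last by rewrite le_min !divr_ge0// ltW.
  by rewrite gt_min; apply/orP; left; lra.
have td : `|t| <= d / 2.
  rewrite normrN ger0_norm; last by rewrite le_min !divr_ge0// ltW.
  by rewrite ge_min lexx orbT.
pose y := x + t *: rot90 e.
have ele : `|e.1| <= 1 /\ `|e.2| <= 1.
  have q1 := sqr_ge0 e.1; have q2 := sqr_ge0 e.2.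
  by split; rewrite -(@ler_pXn2r _ 2) ?nnegrE// real_normK ?num_real// expr1n; lra.
have yK : tri_int K y.
  apply: dK; apply/cboxP; rewrite /y /rot90 /= /GRing.scale /=.
  have h1 : `|t * e.1| <= d / 2.
    by rewrite normrM; apply: le_trans td; rewrite ler_piMr//; case: ele.
  have h2 : `|t * e.2| <= d / 2.
    by rewrite normrM; apply: le_trans td; rewrite ler_piMr//; case: ele.
  move: h1 h2; rewrite !ler_norml; lra.
have cly : closure Omega y by apply: (regular_sub_closure KT); exact: tri_int_sub.
(* y lies strictly below the graph, hence so does a neighbourhood of y *)
pose c := fun z : plane R => (z.1 - x.1) * e.1 + (z.2 - x.2) * e.2.
pose q := fun z : plane R => (z.2 - x.2) * e.1 + (-1) * ((z.1 - x.1) * e.2).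
have sm1 := @smooth_fst R; have sm2 := @smooth_snd R.
have cc : continuous c.
  apply: smooth_cont; exact: (smoothD (smoothM (smooth_subr _ sm1) (smooth_cst _))
    (smoothM (smooth_subr _ sm2) (smooth_cst _))).
have cq : continuous q.
  apply: smooth_cont; exact: (smoothD (smoothM (smooth_subr _ sm2) (smooth_cst _))
    (smoothZ _ (smoothM (smooth_subr _ sm1) (smooth_cst _)))).
have zE z : z = x + c z *: e + q z *: rot90 e.
  apply: plane_eq; rewrite /c /q /rot90 /= /GRing.scale /=.
    transitivity (x.1 + (z.1 - x.1) * (e.1 ^+ 2 + e.2 ^+ 2)); last by ring.
    by rewrite en; ring.
  transitivity (x.2 + (z.2 - x.2) * (e.1 ^+ 2 + e.2 ^+ 2)); last by ring.
  by rewrite en; ring.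
have cy : c y = 0 by rewrite /c /y /rot90 /= /GRing.scale /=; ring.
have qy : q y = t.
  rewrite /q /y /rot90 /= /GRing.scale /=.
  by transitivity (t * (e.1 ^+ 2 + e.2 ^+ 2)); [ring|rewrite en mulr1].
(* If |c z| < rho then g (c z) >= g 0 - |t| / 2 >= t / 2 by the Lipschitz bound, while q z < t / 2
   for z near y; so such z lie below the graph. *)
pose rho := - t / (2 * (1 + `|L|)).
have L1 : 0 < 1 + `|L| by have := normr_ge0 L; lra.
have rho0 : 0 < rho by rewrite divr_gt0 ?mulr_gt0//; lra.
have rL : L * rho <= - t / 2.
  apply: (@le_trans _ _ ((1 + `|L|) * rho)).
    by rewrite ler_pM2r//; have := ler_norm L; lra.
  by rewrite /rho le_eqVlt; apply/orP; left; apply/eqP; field; rewrite gt_eqF.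
have N1 : \forall z \near y, `|c z| < Num.min r rho.
  have := cc y; rewrite /continuous_at cy => /cvgr0Pnorm_lt; apply.
  by rewrite lt_min r0.
have N2 : \forall z \near y, `|t - q z| < Num.min (h - `|t|) (- t / 2).
  have := cq y; rewrite /continuous_at qy => /cvgrPdist_lt; apply.
  by rewrite lt_min subr_gt0 th; lra.
have [z [Oz]] := cly _ (filterI N1 N2).
rewrite /= !lt_min => -[/andP[c1 c2] /andP[q1 q2]].
have qh : `|q z| < h.
  have -> : q z = t - (t - q z) by ring.
  by apply: (le_lt_trans (ler_normB _ _)); lra.
have [+ _] := gP (c z) (q z) c1 qh.
rewrite -zE => /(_ Oz) gq.
have := gL (c z) 0; rewrite subr0 => gc.
have Lc : L * `|c z| <= - t / 2.
  have [L0|L0] := leP 0 L.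
    by apply: le_trans rL; rewrite ler_wpM2l// ltW.
  apply: (@le_trans _ _ 0); last by lra.
  by rewrite nmulr_rle0.
move: gc q2; rewrite ler_norml ltr_norml => /andP[? ?] /andP[? ?]; lra.
Qed.

End Regular.

Definition neighbors T K E := [seq K' <- enum_fset T | (K' != K) && has_edge K' E].

Lemma neighborsP Omega T K E : regular_triangulation Omega T -> K \in T -> has_edge K E ->
  neighbors T K E = [::] \/
  exists K', [/\ neighbors T K E = [:: K'], K' \in T, K' != K & has_edge K' E].
Proof.
move=> HT KT hE; have un : uniq (neighbors T K E) by rewrite filter_uniq// fset_uniq.
have mem K' : K' \in neighbors T K E -> [/\ K' \in T, K' != K & has_edge K' E].
  by rewrite mem_filter => /andP[/andP[? ?] ?].
case E1 : (neighbors T K E) un mem => [|K1 [|K2 s]] un mem; first by left.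
  by right; exists K1; have [? ? ?] := mem K1 (mem_head _ _); split.
exfalso; have [t1 n1 h1] := mem K1 (mem_head _ _).
have [|t2 n2 h2] := mem K2; first by rewrite !inE eqxx orbT.
have e := regular_neighbor_uniq HT KT t1 t2 n1 n2 hE h1 h2.
by move: un; rewrite /= e inE eqxx.
Qed.

(** The coarse ancestor of a fine neighbour contains the midpoint of E and differs from K, hence has
    the edge E; conversely, a coarse neighbour has a descendant containing that midpoint. This makes
    the jumps on the two meshes comparable. *)
Lemma refined_neighbors Omega T S K E : regular_triangulation Omega T ->
  regular_triangulation Omega S -> nvb T S -> K \in T -> K \in S -> has_edge K E ->
  (neighbors T K E = [::] /\ neighbors S K E = [::]) \/
  exists K' K'', [/\ neighbors T K E = [:: K'], neighbors S K E = [:: K''],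
    K' \in T, K'' \in S & tri_set K'' `<=` tri_set K'].
Proof.
move=> HT HS TS KT KS hE.
have mK : tri_set K (emid E) by apply: (tri_edge_segment hE); exact: segment_mid.
have memT K' : K' \in T -> K' != K -> has_edge K' E -> K' \in neighbors T K E.
  by move=> t n h; rewrite mem_filter n h.
have memS K' : K' \in S -> K' != K -> has_edge K' E -> K' \in neighbors S K E.
  by move=> t n h; rewrite mem_filter n h.
have up K'' : K'' \in S -> K'' != K -> has_edge K'' E ->
    exists K', [/\ K' \in T, K' != K, has_edge K' E & tri_set K'' `<=` tri_set K'].
  move=> t n h; have [K' K'T sub] := nvb_parent TS t.
  have K'K : K' != K.
    apply/eqP => e; rewrite e in sub; move/eqP: n; apply.
    exact: (regular_not_sub HS t KS sub).
  exists K'; split => //; apply: (regular_neighbor HT KT K'T _ hE); first by rewrite eq_sym.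
  by apply: sub; apply: (tri_edge_segment h); exact: segment_mid.
have [nS|[K'' [nS t n h]]] := neighborsP HS KS hE; last first.
  right; have [K' [t' n' h' sub]] := up _ t n h.
  exists K', K''; split => //.
  have [nT|[K1 [nT _ _ _]]] := neighborsP HT KT hE.
    by have := memT _ t' n' h'; rewrite nT.
  by have := memT _ t' n' h'; rewrite nT inE => /eqP->.
left; split => //; have [//|[K' [nT t n h]]] := neighborsP HT KT hE.
have mK' : tri_set K' (emid E) by apply: (tri_edge_segment h); exact: segment_mid.
have [K'' [t'' sub m'']] := nvb_cover TS t mK'.
have n'' : K'' != K.
  apply/eqP => e; rewrite e in sub; move/eqP: n; apply; symmetry.
  exact: (regular_not_sub HT KT t sub).
have h'' : has_edge K'' E.
  by apply: (regular_neighbor HS KS t'' _ hE m''); rewrite eq_sym.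
by have := memS _ t'' n'' h''; rewrite nS.
Qed.

Lemma mesh_le_nvb T S delta : nvb T S -> mesh_le T delta -> mesh_le S delta.
Proof.
move=> TS HT K KS x y Kx Ky; have [K' K'T sub] := nvb_parent TS KS.
exact: (HT _ K'T _ _ (sub _ Kx) (sub _ Ky)).
Qed.

End RegularTriangulations.

(** * Piecewise polynomial functions *)

Section Pieces.
Context {R : realType}.
Implicit Types (K : triangle R) (x : plane R) (T S : triangulation R).
Implicit Types (Omega : set (plane R)) (f g v w : plane R -> R) (p : nat).

Lemma poly_funD p f g : poly_fun p f -> poly_fun p g -> poly_fun p (fun x => f x + g x).
Proof.
move=> [c Hc] [d Hd]; exists (fun a b => c a b + d a b) => x.
rewrite Hc Hd -big_split; apply: eq_bigr => a _ /=.
by rewrite -big_split; apply: eq_bigr => b _ /=; ring.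
Qed.

Lemma poly_fun0 p : poly_fun p (fun=> 0 : R).
Proof.
exists (fun _ _ => 0) => x; rewrite big1// => a _; rewrite big1// => b _.
by rewrite !mul0r.
Qed.

Lemma poly_fun_sum p (n : nat) (F : nat -> plane R -> R) :
  (forall i, (i < n)%N -> poly_fun p (F i)) -> poly_fun p (fun x => \sum_(i < n) F i x).
Proof.
elim: n => [|n IH] H; first by under eq_fun do rewrite big_ord0; exact: poly_fun0.
have -> : (fun x => \sum_(i < n.+1) F i x) = (fun x => (\sum_(i < n) F i x) + F n x).
  by apply/funext => x; rewrite big_ord_recr.
by apply: poly_funD; [apply: IH => i ni; apply: H; exact: leqW|exact: H].
Qed.

Lemma is_piece_sub p v K K' f : tri_set K `<=` tri_set K' -> is_piece p v K' f -> is_piece p v K f.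
Proof. by move=> sub [pf H]; split => // x /sub; exact: H. Qed.

Lemma is_piece_uniq p v K f g : 0 < area K -> is_piece p v K f -> is_piece p v K g -> f = g.
Proof.
move=> K0 [pf Hf] [pg Hg].
(* The singleton family supplies some shape constant for K, and with it a square inside K on which
   the two polynomials agree. *)
have HT K' : K' \in [fset K]%fset -> 0 < area K' by rewrite inE => /eqP->.
have [sigma [amax [s1 Hs]]] := shape_exists HT.
have {}Hs : shape_ok sigma amax K by apply: Hs; rewrite inE.
have E : (fun x => f x - g x) = fun=> 0.
  apply: (tpoly_eq0 (inrad_gt0 s1 Hs) (tpolyB (poly_fun_tpoly pf) (poly_fun_tpoly pg))).
  move=> x hx; have Kx := tri_int_sub K0 (inner_square s1 Hs hx).
  by rewrite -(Hf _ Kx) -(Hg _ Kx) subrr.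
by apply/funext => x; apply/eqP; rewrite -subr_eq0; apply/eqP; exact: (congr1 (fun h => h x) E).
Qed.

Lemma pieceP p v K f : is_piece p v K f -> is_piece p v K (piece p v K).
Proof. by move=> H; exact: (xgetPex (fun=> 0) (ex_intro _ f H)). Qed.

Lemma piece_sub p v K K' f : 0 < area K -> tri_set K `<=` tri_set K' ->
  is_piece p v K' f -> piece p v K = piece p v K'.
Proof.
move=> K0 sub H; apply: (is_piece_uniq K0 _ (is_piece_sub sub (pieceP H))).
exact: (pieceP (is_piece_sub sub H)).
Qed.

Lemma one_level_sub K K' s : s \in one_level_patterns K -> K' \in s ->
  tri_set K' `<=` tri_set K.
Proof.
have h1 := @child1_sub R; have h2 := @child2_sub R.
have h11 := subset_trans (@child1_sub R (child1 K)) (h1 K).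
have h21 := subset_trans (@child2_sub R (child1 K)) (h1 K).
have h12 := subset_trans (@child1_sub R (child2 K)) (h2 K).
have h22 := subset_trans (@child2_sub R (child2 K)) (h2 K).
rewrite /one_level_patterns !inE => /or4P[/eqP->|/eqP->|/eqP->|/orP[/eqP->|/eqP->]];
  rewrite !inE.
- by move=> /eqP->.
- by move=> /orP[]/eqP->.
- by move=> /or3P[]/eqP->.
- by move=> /or3P[]/eqP->.
- by move=> /or4P[]/eqP->.
Qed.

(** Walking back through the chain of refinements, K is contained in some triangle of every level,
    so each summand of v is a single polynomial on K. *)
Lemma hier_piece Omega p Tinit T v K : hier_argyris Omega p Tinit T v -> K \in T ->
  exists f, is_piece p v K f.
Proof.
move=> [m [S [w [S0 Sm step Hw ->]]]] KT.
have anc d : (d <= m)%N -> exists2 K', K' \in S (m - d)%N & tri_set K `<=` tri_set K'.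
  elim: d => [_|d IH dm]; first by rewrite subn0 Sm; exists K.
  have [K' K'S sub] := IH (ltnW dm).
  have lm : (m - d.+1 < m)%N by rewrite ltn_subrL (leq_trans _ dm).
  have [_ [c [Hc /(_ K')]]] := step _ lm.
  rewrite -subSn// subSS => -[/(_ K'S)[K2 K2S K'c] _].
  by exists K2 => //; apply: (subset_trans sub); exact: (one_level_sub (Hc _ K2S) K'c).
(* The premise stands under the existential so that [choice] yields a sequence indexed by all
   natural numbers. *)
have Hl (l : nat) : exists f, (l <= m)%N -> is_piece p (w l) K f.
  have [lm|ml] := leqP l m; last by exists (fun=> 0).
  have [K' K'S sub] := anc (m - l)%N (leq_subr _ _).
  rewrite subKn// in K'S.
  have [_ /(_ _ K'S)[f Hf] _] := Hw _ lm.
  by exists f => _; exact: (is_piece_sub sub Hf).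
have [F HF] := choice Hl.
exists (fun x => \sum_(l < m.+1) F l x); split.
  by apply: poly_fun_sum => l lm; have [] := HF l lm.
move=> x Kx; apply: eq_bigr => l _.
by have [_] := HF l (ltn_ord l); exact.
Qed.

Lemma hier_H20 Omega p Tinit T v : open Omega -> bounded_set Omega ->
  hier_argyris Omega p Tinit T v -> H20 Omega v.
Proof.
move=> oO bO [m [S [w [_ _ _ Hw ->]]]].
by apply: (H20_sum oO bO) => l lm; have [] := Hw l lm.
Qed.

End Pieces.

(** * Inverse estimates on shape-regular triangles *)

Section LocalInverseEstimates.
Context {R : realType}.
Implicit Types (K : triangle R) (x : plane R).

(** The test functions live on the square around the centroid, and the reach 48 sigma of
    [tri_set_near] extends the bound to the closed triangle, edges included. *)
Lemma tri_inverse p n (sigma : R) : 1 <= sigma ->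
  exists2 C : R, 0 < C & forall amax K (q h : plane R -> R), shape_ok sigma amax K ->
    tpoly p q -> sqint mu2 (tri_int K) h ->
    (forall theta, test_function (tri_int K) theta ->
       \int[mu2]_(x in tri_int K) (h x * theta x) =
       \int[mu2]_(x in tri_int K) (q x * theta x)) ->
    forall s x, size s = n -> tri_set K x ->
    inrad sigma K ^+ (2 * n).+2 * pds s q x ^+ 2 <= C * ip mu2 (tri_int K) h h.
Proof.
move=> s1; have L1 : 1 <= 48 * sigma by lra.
have [C C0 HC] := @inverse_estimate_tpoly R p n _ L1.
exists C => // amax K q h HK Hq Lh Hth s x sn Kx.
have r0 := inrad_gt0 s1 HK; set r := inrad sigma K in r0 *.
set g := centroid K; have sub := inner_square s1 HK; rewrite -/r -/g in sub.
have [x1 x2] := tri_set_near s1 HK Kx; rewrite -/r -/g in x1 x2.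
have mQ := @measurable_cbox R (g.1 - r, g.2 - r) (g.1 + r, g.2 + r).
have mI := open_measurable_plane (@open_tri_int R K).
have LQ : sqint mu2 (cbox (g.1 - r, g.2 - r) (g.1 + r, g.2 + r)) h.
  by case: Lh => mh ih; split; [exact: measurable_funS mI sub mh|exact: integrableS mI mQ sub ih].
have HQ theta : smooth theta ->
    (forall y, ~ cbox (g.1 - r, g.2 - r) (g.1 + r, g.2 + r) y -> theta y = 0) ->
    \int[mu2]_(y in cbox (g.1 - r, g.2 - r) (g.1 + r, g.2 + r)) (h y * theta y) =
    \int[mu2]_(y in cbox (g.1 - r, g.2 - r) (g.1 + r, g.2 + r)) (q y * theta y).
  move=> st t0.
  have tt : test_function (tri_int K) theta.
    split => //; exists (cbox (g.1 - r, g.2 - r) (g.1 + r, g.2 + r)).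
    by split => //; exact: cbox_compact.
  have id (f : plane R -> R) :
      \int[mu2]_(y in cbox (g.1 - r, g.2 - r) (g.1 + r, g.2 + r)) (f y * theta y) =
      \int[mu2]_(y in tri_int K) (f y * theta y).
    apply: (Rintegral_supp (C := cbox (g.1 - r, g.2 - r) (g.1 + r, g.2 + r))) => //.
    by move=> y ny; rewrite t0// mulr0.
  by rewrite !id Hth.
apply: (le_trans (HC g r q h r0 Hq LQ HQ s x sn x1 x2)).
rewrite ler_wpM2l//; first exact: ltW.
rewrite /ip -(setIidr sub) Rintegral_mkcondr.
apply: le_Rintegral => //.
- rewrite -restrict_EFin; apply/integrable_restrict => //.
  by rewrite (setIidr sub); exact: (sqint_ipP mQ LQ LQ).
- exact: (sqint_ipP mI Lh Lh).
- by move=> y _; rewrite patchE; case: ifP => // _; rewrite -expr2 sqr_ge0.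
Qed.

Lemma tri_diam (sigma amax : R) K x y : 1 <= sigma -> shape_ok sigma amax K ->
  tri_set K x -> tri_set K y ->
  `|x.1 - y.1| <= 96 * sigma * inrad sigma K /\ `|x.2 - y.2| <= 96 * sigma * inrad sigma K.
Proof.
move=> s1 HK Kx Ky; have [x1 x2] := tri_set_near s1 HK Kx.
have [y1 y2] := tri_set_near s1 HK Ky.
move: x1 x2 y1 y2; move: (inrad _ _) => r; rewrite !ler_norml.
by move=> /andP[? ?] /andP[? ?] /andP[? ?] /andP[? ?]; split; lra.
Qed.

Lemma tri_set_cbox (sigma amax : R) K (d := 48 * sigma * inrad sigma K) : 1 <= sigma ->
  shape_ok sigma amax K -> tri_set K `<=`
  cbox ((centroid K).1 - d, (centroid K).2 - d) ((centroid K).1 + d, (centroid K).2 + d).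
Proof.
move=> s1 HK x Kx; have [x1 x2] := tri_set_near s1 HK Kx.
move: x1 x2; rewrite /d; move: (centroid K) (48 * sigma * inrad sigma K) => c t.
by rewrite !ler_norml => /andP[? ?] /andP[? ?]; apply/cboxP => /=; lra.
Qed.

Lemma measurable_tri_set K : 0 < area K -> measurable (tri_set K : set (mplane R)).
Proof. by move=> K0; apply: closed_measurable_plane; exact: closed_tri_set. Qed.

Lemma tri_mu2_le (sigma amax : R) K : 1 <= sigma -> shape_ok sigma amax K ->
  (mu2 (tri_set K) <= ((96 * sigma * inrad sigma K) ^+ 2)%:E)%E.
Proof.
move=> s1 HK; have r0 := inrad_gt0 s1 HK; have [K0 _ _] := HK.
have sub := tri_set_cbox s1 HK.
move: sub r0; move: (centroid K) (inrad sigma K) => g r sub r0.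
have D0 : 0 <= 48 * sigma * r.
  by rewrite mulr_ge0 ?(ltW r0)// mulr_ge0// (le_trans ler01 s1).
have <- : mu2 (cbox (g.1 - 48 * sigma * r, g.2 - 48 * sigma * r)
    (g.1 + 48 * sigma * r, g.2 + 48 * sigma * r)) = ((96 * sigma * r) ^+ 2)%:E.
  by rewrite mu2_cbox /=; [congr EFin; ring|lra|lra].
apply: le_measure; rewrite ?inE//; last exact: measurable_cbox.
exact: measurable_tri_set.
Qed.

Lemma compact_tri_set K : 0 < area K -> compact (tri_set K).
Proof.
move=> K0; have HT K' : K' \in [fset K]%fset -> 0 < area K' by rewrite inE => /eqP->.
have [sigma [amax [s1 Hs]]] := shape_exists HT.
have HK : shape_ok sigma amax K by apply: Hs; rewrite inE.
apply: subclosed_compact (tri_set_cbox s1 HK); first exact: closed_tri_set.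
exact: cbox_compact.
Qed.

Lemma edge_in_tri K E : E \in edges K -> tri_set K E.1 /\ tri_set K E.2.
Proof.
move=> EK; have hE : has_edge K E by rewrite /has_edge EK.
by split; apply: (tri_edge_segment hE); [exact: segment_l|exact: segment_r].
Qed.

Lemma enorm_le (u : plane R) (A : R) : 0 <= A -> `|u.1| <= A -> `|u.2| <= A -> enorm u <= 2 * A.
Proof.
move=> A0 h1 h2; rewrite /enorm -[leRHS]ger0_norm ?mulr_ge0// -sqrtr_sqr ler_sqrt ?sqr_ge0//.
have q1 : u.1 ^+ 2 <= A ^+ 2 by rewrite -(real_normK (num_real u.1)) lerXn2r ?nnegrE.
have q2 : u.2 ^+ 2 <= A ^+ 2 by rewrite -(real_normK (num_real u.2)) lerXn2r ?nnegrE.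
have := sqr_ge0 A; rewrite exprMn; lra.
Qed.

(** Twice the area of K is the cross product of the common edge, of order r', and another side of K,
    of order r. As the area is of order r^2, one factor r cancels. *)
Lemma neighbor_inrad (sigma amax : R) K K' E : 1 <= sigma ->
  shape_ok sigma amax K -> shape_ok sigma amax K' ->
  has_edge K E -> has_edge K' E ->
  inrad sigma K <= (96 * sigma) ^+ 2 * inrad sigma K'.
Proof.
move=> s1 HK HK' hE hE'; have [K0 _ _] := HK.
have r0 := inrad_gt0 s1 HK; have r0' := inrad_gt0 s1 HK'.
have [ o [ oK _ h cE]] := has_edge_third hE.
have s l := tri_edge_segment hE l; have s' l := tri_edge_segment hE' l.
have oT : tri_set K o.
  have := h 0 1 (lexx _) ler01; rewrite add0r => /(_ (lexx _)).
  by rewrite scale0r scale1r addr0 addrC subrK.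
have [e1 e2] := tri_diam s1 HK' (s' _ (segment_r E.1 E.2)) (s' _ (segment_l E.1 E.2)).
have [ o1 o2] := tri_diam s1 HK oT (s _ (segment_l E.1 E.2)).
have := cross_le (u := E.2 - E.1) (v := o - E.1) e1 e2 o1 o2.
rewrite cE; have aE := inrad_sqr s1 HK; have := area_tdet K; move: aE.
move: r0 r0'; move: (inrad sigma K) (inrad sigma K') (area K) `|tdet K| => r r' a d r0 r0' -> e le.
have {}le : 12 * (24 * sigma) * r ^+ 2 <= (96 * sigma * r') * (96 * sigma * r).
  have {}e : d = 2 * (12 * (24 * sigma) * r ^+ 2) by rewrite e; field.
  by move: le; rewrite e; move: (12 * _ * _) (96 * _ * r') (96 * _ * r) => y u w; lra.
rewrite -(@ler_pM2r _ r)//.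
apply: (@le_trans _ _ (12 * (24 * sigma) * r ^+ 2)).
  rewrite expr2 mulrA ler_pM2r// -[leLHS]mul1r ler_pM2r//; lra.
by apply: (le_trans le); rewrite le_eqVlt; apply/orP; left; apply/eqP; ring.
Qed.

End LocalInverseEstimates.

(** * The differential operators of the estimator on polynomials *)

Section PolynomialOperators.
Context {R : realType}.
Implicit Types (x : plane R) (E : plane R * plane R) (f g : plane R -> R) (p : nat).

Lemma sum2E (a : 'I_2 -> R) : \sum_(i < 2) a i = a 0 + a 1.
Proof.
rewrite !big_ord_recl big_ord0 addr0; congr (a _ + a _); exact/val_inj.
Qed.

Lemma sum22E (a b : R) (h : 'I_2 -> 'I_2 -> R) :
  \sum_(i < 2) \sum_(k < 2) (if i == 0 then a else b) * (if k == 0 then a else b) * h i k =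
  a * a * h 0 0 + a * b * h 0 1 + (b * a * h 1 0 + b * b * h 1 1).
Proof. by rewrite !sum2E. Qed.

Lemma sum4_sqr (a : 'I_2 -> 'I_2 -> R) :
  (\sum_(i < 2) \sum_(k < 2) a i k) ^+ 2 <= 4 * \sum_(i < 2) \sum_(k < 2) a i k ^+ 2.
Proof.
rewrite !sum2E; move: (a 0 0) (a 0 1) (a 1 0) (a 1 1) => b c d e.
have h1 := sqr_ge0 (b - c); have h2 := sqr_ge0 (d - e).
have h3 := sqr_ge0 ((b + c) - (d + e)); nra.
Qed.

(** On a product of univariate polynomials, derivatives in different variables act on different
    factors, so they commute term by term. *)
Lemma pd_pd_comm p f i k : tpoly p f -> pds [:: i; k] f = pds [:: k; i] f.
Proof.
have comm t : tderiv i (tderiv k t) = tderiv k (tderiv i t) :> seq ({poly R} * {poly R}).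
  by elim: t => //= -[a b] t ->; congr cons; do 2 case: ifP.
by move=> [l _ ->]; rewrite !pds_tensf /= comm.
Qed.

Lemma pds_laplace s f x : smooth f ->
  pds s (laplace f) x = \sum_(k < 2) pds (s ++ [:: k; k]) f x.
Proof.
move=> sf; rewrite /laplace (pds_sum s _ (fun i => smooth_pds [:: i; i] sf)).
by apply: eq_bigr => k _; rewrite /pds foldr_cat.
Qed.

Lemma laplace2E f x : smooth f ->
  laplace (laplace f) x = \sum_(i < 2) \sum_(k < 2) pds [:: i; i; k; k] f x.
Proof.
by move=> sf; rewrite {1}/laplace; apply: eq_bigr => i _; rewrite pds_laplace.
Qed.

Lemma laplace2B f g x : smooth f -> smooth g ->
  laplace (laplace (fun y => f y - g y)) x = laplace (laplace f) x - laplace (laplace g) x.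
Proof.
move=> sf sg; have sfg : smooth (fun y => f y - g y).
  have := smoothD sf (smoothZ (-1) sg).
  by under eq_fun do rewrite mulN1r.
transitivity (\sum_(i < 2) \sum_(k < 2) pds [:: i; i; k; k] f x -
  \sum_(i < 2) \sum_(k < 2) pds [:: i; i; k; k] g x); last first.
  by congr (_ - _); symmetry; exact: laplace2E.
apply: (etrans (laplace2E x sfg)).
rewrite -sumrB; apply: eq_bigr => i _; rewrite -sumrB; apply: eq_bigr => k _.
by rewrite (pdsB _ sf sg).
Qed.

Lemma tpoly_laplace p f : tpoly p f -> tpoly p (laplace f).
Proof.
move=> Hf; have -> : laplace f = fun x => 1 * pds [:: 0; 0] f x + 1 * pds [:: 1; 1] f x.
  apply/funext => x; rewrite [X in _ = X + _]mul1r [X in _ = _ + X]mul1r.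
  exact: (sum2E (fun i => pds [:: i; i] f x)).
exact: (tpoly_lin 1 1 (tpoly_pds [:: 0; 0] Hf) (tpoly_pds [:: 1; 1] Hf)).
Qed.

Lemma tpoly_derive p f (v : plane R) : tpoly p f ->
  (fun x => 'D_v f x) = fun x => v.1 * pd 0 f x + v.2 * pd 1 f x.
Proof. by move=> Hf; apply/funext => x; apply: dirlin_derive; exact: tpoly_dirlin Hf. Qed.

Lemma tpoly_dderive p f (v : plane R) : tpoly p f -> tpoly p (fun x => 'D_v f x).
Proof.
move=> Hf; rewrite (tpoly_derive v Hf).
exact: (tpoly_lin v.1 v.2 (tpoly_pds [:: 0] Hf) (tpoly_pds [:: 1] Hf)).
Qed.

Lemma tpoly_d_nunu p E f : tpoly p f -> tpoly p (d_nunu E f).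
Proof. by move=> Hf; do 2 apply: tpoly_dderive. Qed.

Lemma tpoly_d_nu_laplace p E f : tpoly p f -> tpoly p (d_nu_laplace E f).
Proof. by move=> Hf; apply: tpoly_dderive; exact: tpoly_laplace. Qed.

Lemma d_nunuE p E f x : tpoly p f -> d_nunu E f x =
  \sum_(i < 2) \sum_(k < 2) (if i == 0 then (unit_normal E).1 else (unit_normal E).2) *
    (if k == 0 then (unit_normal E).1 else (unit_normal E).2) * pds [:: i; k] f x.
Proof.
move=> Hf; rewrite /d_nunu; set nu := unit_normal E.
have Hd := tpoly_dderive nu Hf.
rewrite (dirlin_derive x nu (tpoly_dirlin Hd)) (tpoly_derive nu Hf).
have H0 := tpoly_smooth (tpoly_pds [:: 0] Hf); have H1 := tpoly_smooth (tpoly_pds [:: 1] Hf).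
have pdl i : pd i (fun y => nu.1 * pd 0 f y + nu.2 * pd 1 f y) x =
    nu.1 * pd i (pd 0 f) x + nu.2 * pd i (pd 1 f) x.
  rewrite (pdD i (smooth_pderivable (smoothZ nu.1 H0)) (smooth_pderivable (smoothZ nu.2 H1))).
  by rewrite (pd_cstM i nu.1 (smooth_pderivable H0)) (pd_cstM i nu.2 (smooth_pderivable H1)).
apply: (etrans (congr2 (fun a b => nu.1 * a + nu.2 * b) (pdl 0) (pdl 1))).
apply/esym; apply: (etrans (sum22E nu.1 nu.2 (fun i k => pds [:: i; k] f x))).
rewrite /pds /=.
move: (pd 0 (pd 0 f) x) (pd 0 (pd 1 f) x) (pd 1 (pd 0 f) x) (pd 1 (pd 1 f) x) => a b c d.
by rewrite -!mulrA !mulrDr.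
Qed.

Lemma d_nu_laplaceE p E f x : tpoly p f -> d_nu_laplace E f x =
  \sum_(i < 2) \sum_(k < 2) (if i == 0 then (unit_normal E).1 else (unit_normal E).2) *
    pds [:: i; k; k] f x.
Proof.
move=> Hf; rewrite /d_nu_laplace; set nu := unit_normal E.
have Hd := tpoly_laplace Hf.
rewrite (dirlin_derive x nu (tpoly_dirlin Hd)).
have sf := tpoly_smooth Hf.
rewrite (pds_laplace [:: 0] x sf : pd 0 (laplace f) x = _).
rewrite (pds_laplace [:: 1] x sf : pd 1 (laplace f) x = _).
by rewrite [RHS]sum2E !mulr_sumr.
Qed.

Lemma unit_normal_le E : `|(unit_normal E).1| <= 1 /\ `|(unit_normal E).2| <= 1.
Proof.
rewrite /unit_normal; move: (E.2 - E.1) => d.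
rewrite /rot90 /= /GRing.scale /= !normrM normrN normfV.
have e0 : 0 <= enorm d by rewrite sqrtr_ge0.
have le (i : R) : i ^+ 2 <= enorm d ^+ 2 -> `|enorm d|^-1 * `|i| <= 1.
  move=> hi; rewrite (ger0_norm e0).
  have [->|n0] := eqVneq (enorm d) 0; first by rewrite invr0 mul0r.
  have ep : 0 < enorm d by rewrite lt_def n0.
  rewrite mulrC ler_pdivrMr// mul1r -(@ler_pXn2r _ 2) ?nnegrE//.
  by rewrite real_normK ?num_real.
have q1 := sqr_ge0 d.1; have q2 := sqr_ge0 d.2.
by split; apply: le; rewrite sqr_sqrtr ?addr_ge0//; lra.
Qed.

Lemma d_nunuB p E f g x : tpoly p f -> tpoly p g ->
  d_nunu E (fun y => f y - g y) x = d_nunu E f x - d_nunu E g x.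
Proof.
move=> Hf Hg; rewrite (d_nunuE E x Hf) (d_nunuE E x Hg) (d_nunuE E x (tpolyB Hf Hg)).
rewrite -sumrB; apply: eq_bigr => i _; rewrite -sumrB; apply: eq_bigr => k _.
by rewrite (pdsB _ (tpoly_smooth Hf) (tpoly_smooth Hg)) mulrBr.
Qed.

Lemma d_nu_laplaceB p E f g x : tpoly p f -> tpoly p g ->
  d_nu_laplace E (fun y => f y - g y) x = d_nu_laplace E f x - d_nu_laplace E g x.
Proof.
move=> Hf Hg; rewrite (d_nu_laplaceE E x Hf) (d_nu_laplaceE E x Hg) (d_nu_laplaceE E x (tpolyB Hf Hg)).
rewrite -sumrB; apply: eq_bigr => i _; rewrite -sumrB; apply: eq_bigr => k _.
by rewrite (pdsB _ (tpoly_smooth Hf) (tpoly_smooth Hg)) mulrBr.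
Qed.

Lemma sqr_mul_le (a b : R) : `|a| <= 1 -> (a * b) ^+ 2 <= b ^+ 2.
Proof.
move=> ha; rewrite exprMn ler_piMl ?sqr_ge0//.
by rewrite -(real_normK (num_real a)) exprn_ile1.
Qed.

Lemma d_nunu_sqr_le p E f x : tpoly p f ->
  d_nunu E f x ^+ 2 <= 4 * \sum_(i < 2) \sum_(k < 2) pds [:: i; k] f x ^+ 2.
Proof.
move=> Hf; rewrite (d_nunuE E x Hf); have [n1 n2] := unit_normal_le E.
apply: (le_trans (sum4_sqr _)); rewrite ler_wpM2l//.
apply: ler_sum => i _; apply: ler_sum => k _; apply: sqr_mul_le.
by rewrite normrM mulr_ile1//; case: ifP.
Qed.

Lemma d_nu_laplace_sqr_le p E f x : tpoly p f ->
  d_nu_laplace E f x ^+ 2 <= 4 * \sum_(i < 2) \sum_(k < 2) pds [:: i; k; k] f x ^+ 2.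
Proof.
move=> Hf; rewrite (d_nu_laplaceE E x Hf); have [n1 n2] := unit_normal_le E.
apply: (le_trans (sum4_sqr _)); rewrite ler_wpM2l//.
by apply: ler_sum => i _; apply: ler_sum => k _; apply: sqr_mul_le; case: ifP.
Qed.

Lemma laplace2_sqr_le f x : smooth f ->
  laplace (laplace f) x ^+ 2 <= 4 * \sum_(i < 2) \sum_(k < 2) pds [:: i; i; k; k] f x ^+ 2.
Proof. by move=> sf; rewrite laplace2E//; exact: sum4_sqr. Qed.

End PolynomialOperators.

(** * Integrals over the part of an edge inside the domain *)

Section EdgeIntegrals.
Context {R : realType}.
Implicit Types (E : plane R * plane R) (J f g : plane R -> R).
Variable Omega : set (plane R).
Hypothesis oO : open Omega.

Local Notation mu1 := (@lebesgue_measure R).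

Definition edge_param E (t : R) : plane R := (1 - t) *: E.1 + t *: E.2.

Lemma continuous_edge_param E : continuous (edge_param E).
Proof.
move=> t; apply: cvgD; apply: cvgZr_tmp; last exact: cvg_id.
by apply: cvgB; [exact: cvg_cst|exact: cvg_id].
Qed.

Definition edge_dom E : set R := [set t : R | 0 <= t <= 1 /\ Omega (edge_param E t)].

Lemma edge_dom_measurable E : measurable (edge_dom E : set (measurableTypeR R)).
Proof.
have -> : edge_dom E = `[0, 1] `&` edge_param E @^-1` Omega.
  by apply/seteqP; split => t; rewrite /edge_dom /= in_itv.
apply: measurableI; first exact: measurable_itv.
apply: open_measurable; apply: open_comp => // t _.
exact: continuous_edge_param.
Qed.

Lemma edge_dom_mu E : (mu1 (edge_dom E) <= 1%:E)%E.
Proof.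
have <- : mu1 (`[0, 1] : set R) = 1%:E :> \bar R.
  by rewrite lebesgue_measure_itv /= lte01 sube0.
apply: le_measure; rewrite ?inE//.
- exact: edge_dom_measurable.
- by move=> t [? _] /=; rewrite in_itv.
Qed.

Lemma edge_sqint E J : continuous J -> sqint mu1 (edge_dom E) (fun t => J (edge_param E t)).
Proof.
move=> cJ; have cF : continuous (fun t => J (edge_param E t)).
  by move=> t; apply: (@continuous_comp _ _ _ (edge_param E) J); [exact: continuous_edge_param|exact: cJ].
have cF2 : continuous (fun t => J (edge_param E t) ^+ 2).
  move=> t; apply: (@continuous_comp _ _ _ (fun t => J (edge_param E t)) (fun y : R => y ^+ 2)).
    exact: cF.
  exact: exprn_continuous.
split; first exact: (measurable_funTS (continuous_measurable_fun cF)).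
apply: (@integrableS _ (measurableTypeR R) R mu1 (`[0, 1] : set R)).
- exact: measurable_itv.
- exact: edge_dom_measurable.
- by move=> t [? _] /=; rewrite in_itv.
- exact: (continuous_itv_integrable 0 1 cF2).
Qed.

Lemma nrm_close_edge E f g : continuous f -> continuous g ->
  nrm_close (edge_integral Omega E (fun x => f x ^+ 2)) (edge_integral Omega E (fun x => g x ^+ 2))
    (edge_integral Omega E (fun x => (f x - g x) ^+ 2)).
Proof.
move=> cf cg; apply: nrm_closeZ; first exact: sqrtr_ge0.
have H := nrm_close_ip (edge_dom_measurable E) (edge_sqint E cf) (edge_sqint E cg).
by rewrite -!ip_sqrE in H.
Qed.

Lemma edge_integral_le E f (B : R) : continuous f -> 0 <= B ->
  (forall x, segment E.1 E.2 x -> f x ^+ 2 <= B) ->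
  edge_integral Omega E (fun x => f x ^+ 2) <= enorm (E.2 - E.1) * B.
Proof.
move=> cf B0 fB; rewrite /edge_integral ler_wpM2l ?sqrtr_ge0//.
have mS := edge_dom_measurable E; have mu1S := edge_dom_mu E.
apply: (@le_trans _ _ (\int[mu1]_(t in edge_dom E) B)); last first.
  rewrite Rintegral_cst// ler_piMr// -lee_fin fineK//.
  by rewrite ge0_fin_numE// (le_lt_trans mu1S)// ltry.
apply: le_Rintegral => //.
- by have [_] := edge_sqint E cf.
- apply: (@integrableS _ (measurableTypeR R) R mu1 (`[0, 1] : set R)).
  + exact: measurable_itv.
  + exact: mS.
  + by move=> t [? _] /=; rewrite in_itv.
  + exact: (continuous_itv_integrable 0 1 (@cst_continuous _ _ B)).
- move=> t [/andP[t0 t1] _]; apply: fB; exists t => //=.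
  by rewrite in_itv /= t0 t1.
Qed.

End EdgeIntegrals.

(** * From the weak Hessian to pointwise derivatives on a triangle *)

Section HessianEstimates.
Context {R : realType}.
Variable Omega : set (plane R).
Hypothesis oO : open Omega.
Hypothesis bO : bounded_set Omega.
Implicit Types (K : triangle R) (e f : plane R -> R) (x : plane R).

(** The local energy. The triangle is taken open because, once it lies in [Omega], its test
    functions are test functions of [Omega]. *)
Definition hess K e : R := \sum_(i < 2) \sum_(k < 2)
  ip mu2 (tri_int K) (wderiv Omega [:: i; k] e) (wderiv Omega [:: i; k] e).

Lemma hess_ge0 K e : 0 <= hess K e.
Proof. by apply: sumr_ge0 => i _; apply: sumr_ge0 => k _; exact: ip_ge0. Qed.

Lemma test_functionS (U : set (plane R)) theta : U `<=` Omega ->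
  test_function U theta -> test_function Omega theta.
Proof.
move=> sub [st [C [cC CU tC]]]; split => //; exists C; split => //.
exact: subset_trans sub.
Qed.

(** Both sides equal the integral of e against the second derivative of theta: on the left by
    definition of the weak derivative on [Omega], on the right by classical integration by parts on
    K. No boundary terms arise, since theta has compact support inside K. *)
Lemma wderiv_piece p K e f i k theta : 0 < area K -> tri_int K `<=` Omega ->
  H20 Omega e -> is_piece p e K f -> test_function (tri_int K) theta ->
  \int[mu2]_(x in tri_int K) (wderiv Omega [:: i; k] e x * theta x) =
  \int[mu2]_(x in tri_int K) (pds [:: i; k] f x * theta x).
Proof.
move=> K0 sub He [pf ef] tth; have [sth [C [cC CK tC]]] := tth.
have sf := tpoly_smooth (poly_fun_tpoly pf).
have sg : (-1) ^+ size [:: i; k] = 1 :> R by rewrite /= expr2 mulN1r opprK.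
have [_ /(_ _ (test_functionS sub tth))] := H20_wderiv He (mem_multi2 i k).
rewrite sg mul1r => E.
have clC : closed C by apply: compact_closed => //; exact: norm_hausdorff.
have CO := subset_trans CK sub.
rewrite (Rintegral_supp CK CO); last by move=> x /tC->; rewrite mulr0.
rewrite -E (pd_pd_comm i k (poly_fun_tpoly pf) : _ = pds (rev [:: i; k]) f).
have mI := open_measurable_plane (@open_tri_int R K).
have := integration_by_parts_pds [:: i; k] cC CK mI tC sf sth.
rewrite sg mul1r => <-.
rewrite (Rintegral_supp CO CK); last first.
  by move=> x /(pds_supp [:: i; k] clC tC) /= ->; rewrite mulr0.
apply: eq_Rintegral => x; rewrite inE => /(tri_int_sub K0) Kx.
by rewrite ef.
Qed.

(** [tri_inverse] for the polynomial [pds [:: i; k] f] with the weak derivative as h. The word s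
    counts the derivatives beyond the Hessian; two suffice because the estimator stops at order
    four. *)
Lemma hess_le p (sigma : R) : 1 <= sigma ->
  exists2 C : R, 0 < C & forall amax K e f, shape_ok sigma amax K ->
    tri_int K `<=` Omega -> H20 Omega e -> is_piece p e K f ->
    forall s i k x, (size s <= 2)%N -> tri_set K x ->
    inrad sigma K ^+ (2 * size s).+2 * pds (s ++ [:: i; k]) f x ^+ 2 <= C * hess K e.
Proof.
move=> s1; have [C0 C00 H0] := @tri_inverse R p 0 sigma s1.
have [C1 C10 H1] := @tri_inverse R p 1 sigma s1.
have [C2 C20 H2] := @tri_inverse R p 2 sigma s1.
exists (C0 + C1 + C2) => [|amax K e f HK sub He pe s i k x ss Kx]; first by rewrite !addr_gt0.
have [K0 _ _] := HK; have [pf _] := pe.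
have Hq := tpoly_pds [:: i; k] (poly_fun_tpoly pf).
have mI := open_measurable_plane (@open_tri_int R K).
have mO := open_measurable_plane oO.
have Lh : sqint mu2 (tri_int K) (wderiv Omega [:: i; k] e).
  have [[mh ih] _] := H20_wderiv He (mem_multi2 i k).
  by split; [exact: measurable_funS mO sub mh|exact: integrableS mO mI sub ih].
have Hd theta := @wderiv_piece p K e f i k theta K0 sub He pe.
have ipD : ip mu2 (tri_int K) (wderiv Omega [:: i; k] e) (wderiv Omega [:: i; k] e) <= hess K e.
  exact: (sum2_ge_term (G := fun i k => ip mu2 (tri_int K) (wderiv Omega [:: i; k] e)
    (wderiv Omega [:: i; k] e)) (fun i k => ip_ge0 _ _ _) i k).
have ip0 := ip_ge0 (@mu2 R) (tri_int K) (wderiv Omega [:: i; k] e).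
have -> : pds (s ++ [:: i; k]) f = pds s (pds [:: i; k] f) by rewrite /pds foldr_cat.
have fin C : 0 < C -> C <= C0 + C1 + C2 ->
    C * ip mu2 (tri_int K) (wderiv Omega [:: i; k] e) (wderiv Omega [:: i; k] e) <=
    (C0 + C1 + C2) * hess K e.
  by move=> Cp Cle; apply: ler_pM => //; exact: ltW.
case es : (size s) ss => [|[|[|//]]] _.
- by apply: le_trans (fin C0 C00 _); [exact: (H0 _ _ _ _ HK Hq Lh Hd)|lra].
- by apply: le_trans (fin C1 C10 _); [exact: (H1 _ _ _ _ HK Hq Lh Hd)|lra].
- by apply: le_trans (fin C2 C20 _); [exact: (H2 _ _ _ _ HK Hq Lh Hd)|lra].
Qed.

Lemma piece_estimates p (sigma : R) : 1 <= sigma ->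
  exists2 C : R, 0 < C & forall amax K e f, shape_ok sigma amax K ->
    tri_int K `<=` Omega -> H20 Omega e -> is_piece p e K f ->
    forall x E, tri_set K x ->
    [/\ inrad sigma K ^+ 6 * laplace (laplace f) x ^+ 2 <= C * hess K e,
        inrad sigma K ^+ 2 * d_nunu E f x ^+ 2 <= C * hess K e &
        inrad sigma K ^+ 4 * d_nu_laplace E f x ^+ 2 <= C * hess K e].
Proof.
move=> s1; have [C C0 HC] := @hess_le p sigma s1.
(* A factor 4 from [sum4_sqr], times four summands. *)
exists (16 * C) => [|amax K e f HK sub He pe x E Kx]; first by rewrite mulr_gt0.
have r0 := inrad_gt0 s1 HK; have [pf _] := pe; have tf := poly_fun_tpoly pf.
have H s i k := HC amax K e f HK sub He pe s i k x.
have fin (y : R) (n : nat) (a : 'I_2 -> 'I_2 -> R) :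
    y <= 4 * \sum_(i < 2) \sum_(k < 2) a i k ->
    (forall i k, inrad sigma K ^+ n * a i k <= C * hess K e) ->
    inrad sigma K ^+ n * y <= 16 * C * hess K e.
  move=> hy ha; apply: (@le_trans _ _ (inrad sigma K ^+ n * (4 * \sum_(i < 2) \sum_(k < 2) a i k))).
    by rewrite ler_wpM2l// exprn_ge0// ltW.
  have := ha 0 0; have := ha 0 1; have := ha 1 0; have := ha 1 1; rewrite !sum2E.
  have -> : 16 * C * hess K e = 16 * (C * hess K e) by rewrite mulrA.
  move: (_ ^+ n) (C * _) (a 0 0) (a 0 1) (a 1 0) (a 1 1) => m X b c d f' h1 h2 h3 h4.
  have -> : m * (4 * (b + c + (d + f'))) = 4 * (m * b + m * c + m * d + m * f') by ring.
  lra.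
split.
- apply: (fin _ _ (fun i k => pds [:: i; i; k; k] f x ^+ 2)).
    exact: (laplace2_sqr_le x (tpoly_smooth tf)).
  by move=> i k; exact: (H [:: i; i] k k).
- apply: (fin _ _ (fun i k => pds [:: i; k] f x ^+ 2)).
    exact: (d_nunu_sqr_le E x tf).
  by move=> i k; exact: (H [::] i k).
- apply: (fin _ _ (fun i k => pds [:: i; k; k] f x ^+ 2)).
    exact: (d_nu_laplace_sqr_le E x tf).
  by move=> i k; exact: (H [:: i] k k).
Qed.

End HessianEstimates.

(** * Stability of the estimator *)

Section ElementEstimates.
Context {R : realType}.
Variable Omega : set (plane R).
Hypothesis oO : open Omega.
Implicit Types (K : triangle R) (T S : triangulation R) (w e f : plane R -> R).
Implicit Types (E : plane R * plane R) (D : (plane R -> R) -> plane R -> R).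

Lemma nrm_close_mono (a b c d : R) : nrm_close a b c -> c <= d -> nrm_close a b d.
Proof. by move=> [a0 b0 c0 h] cd; split => //; lra. Qed.

Lemma poly_funB p f g : poly_fun p f -> poly_fun p g -> poly_fun p (fun x : plane R => f x - g x).
Proof.
move=> [c Hc] [d Hd]; exists (fun a b => c a b - d a b) => x.
rewrite Hc Hd -sumrB; apply: eq_bigr => a _ /=.
by rewrite -sumrB; apply: eq_bigr => b _ /=; ring.
Qed.

Lemma is_pieceB p w w' K f f' : is_piece p w K f -> is_piece p w' K f' ->
  is_piece p (w' \- w) K (fun x => f' x - f x).
Proof.
by move=> [pf Hf] [pf' Hf']; split => [|x Kx]; [exact: poly_funB|rewrite /= Hf ?Hf'].
Qed.

Lemma tri_sqint K f : 0 < area K -> continuous f -> sqint mu2 (tri_set K) f.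
Proof.
move=> K0 cf; have [B _ HB] := compact_bounded_fun (compact_tri_set K0) cf.
have mK := measurable_tri_set K0.
have HT K' : K' \in [fset K]%fset -> 0 < area K' by rewrite inE => /eqP->.
have [sigma [amax [s1 Hs]]] := shape_exists HT.
have HK : shape_ok sigma amax K by apply: Hs; rewrite inE.
apply: bounded_sqint HB => //; last exact: continuous_measurable_plane.
exact: mu2_fin_sub_cbox (tri_set_cbox s1 HK).
Qed.

Lemma tri_ip_le (sigma amax : R) K f (B : R) : 1 <= sigma -> shape_ok sigma amax K ->
  continuous f -> 0 <= B -> (forall x, tri_set K x -> f x ^+ 2 <= B) ->
  ip mu2 (tri_set K) f f <= (96 * sigma * inrad sigma K) ^+ 2 * B.
Proof.
move=> s1 HK cf B0 fB; have [K0 _ _] := HK; have mK := measurable_tri_set K0.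
have muK := tri_mu2_le s1 HK; rewrite -ip_sqrE.
have fin := mu2_fin_sub_cbox mK (tri_set_cbox s1 HK).
apply: (@le_trans _ _ (\int[mu2]_(x in tri_set K) B)); last first.
  rewrite (Rintegral_cst _ mK) mulrC ler_wpM2r// -lee_fin fineK//.
  by rewrite ge0_fin_numE.
apply: le_Rintegral => //; first by have [_] := tri_sqint K0 cf.
apply: (@bounded_integrable_plane _ _ _ `|B|) => //.
Qed.

Definition residual (l : R) f x : R := l * f x - laplace (laplace f) x.

Lemma tpoly_residual p l f : tpoly p f -> tpoly p (residual l f).
Proof.
move=> Hf; have := tpoly_lin l (-1) Hf (tpoly_laplace (tpoly_laplace Hf)).
by under eq_fun do rewrite mulN1r.
Qed.

Lemma sqrD_le (a b : R) : (a + b) ^+ 2 <= 2 * a ^+ 2 + 2 * b ^+ 2.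
Proof. by have := sqr_ge0 (a - b); nra. Qed.

(** The residuals differ by the polynomial of l' w' - l w minus the bilaplacian of the difference of
    the pieces. Both are bounded pointwise by inverse estimates, with r^(-2) and r^(-6). The factor
    |K|^2 times the measure of K cancels r^(-6) and leaves |K|^2 <= amax^2 with the first part. *)
Lemma volume_close p (sigma : R) : 1 <= sigma ->
  exists2 C : R, 0 < C & forall amax K w w' (l l' : R),
    shape_ok sigma amax K -> tri_int K `<=` Omega ->
    is_piece p w K (piece p w K) -> is_piece p w' K (piece p w' K) ->
    H20 Omega (w' \- w) -> L2 Omega (fun x => l' * w' x - l * w x) ->
    nrm_close
      (area K ^+ 2 * \int[mu2]_(x in tri_set K)
        (l' * w' x - laplace (laplace (piece p w' K)) x) ^+ 2)
      (area K ^+ 2 * \int[mu2]_(x in tri_set K)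
        (l * w x - laplace (laplace (piece p w K)) x) ^+ 2)
      (C * (1 + amax ^+ 2) *
        (ip mu2 (tri_int K) (fun x => l' * w' x - l * w x) (fun x => l' * w' x - l * w x) +
         hess Omega K (w' \- w))).
Proof.
move=> s1; have [C0 C00 H0] := @tri_inverse R p 0 sigma s1.
have [C1 C10 H1] := @piece_estimates R Omega oO p sigma s1.
have sg0 : 0 < sigma by apply: lt_le_trans s1.
exists (2 * (96 * sigma) ^+ 2 * (C0 + C1 * (12 * (24 * sigma)) ^+ 2)) => [|amax K w w' l l' HK sub].
  have k1 : 0 < 2 * (96 * sigma) ^+ 2 by rewrite mulr_gt0// exprn_gt0// mulr_gt0.
  apply: (mulr_gt0 k1); apply: (addr_gt0 C00); apply: (mulr_gt0 C10).
  by rewrite exprn_gt0// !mulr_gt0.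
have [K0 _ Kamax] := HK; have r0 := inrad_gt0 s1 HK; have ar := inrad_sqr s1 HK.
set q := piece p w K; set q' := piece p w' K => Hq Hq' He Lg.
have tq := poly_fun_tpoly (proj1 Hq); have tq' := poly_fun_tpoly (proj1 Hq').
have cont f : tpoly p f -> continuous f by move=> h; exact: (smooth_cont (tpoly_smooth h)).
have intE m v f : is_piece p v K f -> \int[mu2]_(x in tri_set K)
    (m * v x - laplace (laplace f) x) ^+ 2 = ip mu2 (tri_set K) (residual m f) (residual m f).
  move=> [_ Hv]; rewrite -ip_sqrE; apply: eq_Rintegral => x; rewrite inE => Kx.
  by rewrite /residual Hv.
rewrite [X in nrm_close (_ * X) _ _](intE l' w' q' Hq').
rewrite [X in nrm_close _ (_ * X) _](intE l w q Hq).
have cr := cont _ (tpoly_residual l tq); have cr' := cont _ (tpoly_residual l' tq').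
have H := nrm_closeZ (sqr_ge0 (area K)) (nrm_close_ip (measurable_tri_set K0)
  (tri_sqint K0 cr') (tri_sqint K0 cr)).
apply: (nrm_close_mono H) => {H}.
set g := fun x => l' * w' x - l * w x; set e := w' \- w.
have tG := tpoly_lin l' (- l) tq' tq; set G := fun x => l' * q' x + - l * q x in tG.
have gG x : tri_int K x -> g x = G x.
  by move=> /(tri_int_sub K0) Kx; rewrite /g /G mulNr (proj2 Hq _ Kx) (proj2 Hq' _ Kx).
have mI := open_measurable_plane (@open_tri_int R K).
have Sg : sqint mu2 (tri_int K) g.
  have mO := open_measurable_plane oO; have [mg ig] := Lg.
  by split; [exact: measurable_funS mO sub mg|exact: integrableS mO mI sub ig].
have G2 x : tri_set K x -> inrad sigma K ^+ 2 * G x ^+ 2 <= C0 * ip mu2 (tri_int K) g g.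
  move=> Kx; apply: (H0 amax K G g HK tG Sg _ [::] x erefl Kx) => theta _.
  by apply: eq_Rintegral => y; rewrite inE => /gG ->.
have L2x x : tri_set K x -> inrad sigma K ^+ 6 *
    laplace (laplace (fun y => q' y - q y)) x ^+ 2 <= C1 * hess Omega K e.
  by move=> Kx; have [] := H1 amax K e _ HK sub He (is_pieceB Hq Hq') x (0, 0) Kx.
have I0 := ip_ge0 (@mu2 R) (tri_int K) g; have h0 := hess_ge0 Omega K e.
set I := ip mu2 (tri_int K) g g in G2 I0 *; set h := hess Omega K e in L2x h0 *.
set r := inrad sigma K in r0 ar G2 L2x.
have diffE x : residual l' q' x - residual l q x =
    G x + - laplace (laplace (fun y => q' y - q y)) x.
  have aux (a b c d : R) : l' * c - a - (l * d - b) = l' * c + - l * d + - (a - b) by ring.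
  rewrite (laplace2B x (tpoly_smooth tq') (tpoly_smooth tq)); exact: aux.
have B0 : 0 <= 2 * (C0 * I / r ^+ 2) + 2 * (C1 * h / r ^+ 6).
  have rn n : 0 <= r ^+ n by exact: (exprn_ge0 n (ltW r0)).
  have B1 := divr_ge0 (mulr_ge0 (ltW C00) I0) (rn 2%N).
  have B2 := divr_ge0 (mulr_ge0 (ltW C10) h0) (rn 6%N).
  by lra.
have /= := @tri_ip_le sigma amax K (fun x => residual l' q' x - residual l q x) _ s1 HK
  (cont _ (tpolyB (tpoly_residual l' tq') (tpoly_residual l tq))) B0.
have bound x : tri_set K x -> (residual l' q' x - residual l q x) ^+ 2 <=
    2 * (C0 * I / r ^+ 2) + 2 * (C1 * h / r ^+ 6).
  move=> Kx; rewrite diffE; apply: (le_trans (sqrD_le _ _)); rewrite sqrrN.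
  by apply: lerD; rewrite ler_wpM2l// ler_pdivlMr ?exprn_gt0// mulrC; [exact: G2|exact: L2x].
move=> /(_ bound) {bound} Hip.
apply: (le_trans (ler_wpM2l (sqr_ge0 (area K)) Hip)); rewrite -/r.
have -> : area K ^+ 2 * ((96 * sigma * r) ^+ 2 *
    (2 * (C0 * I / r ^+ 2) + 2 * (C1 * h / r ^+ 6))) =
    2 * (96 * sigma) ^+ 2 * (C0 * (area K ^+ 2 * I) + C1 * (12 * (24 * sigma)) ^+ 2 * h).
  rewrite ar; have rn : r != 0 by rewrite gt_eqF.
  by move: (12 * _) (96 * _) => a b; field.
rewrite -[leRHS]mulrA -[leRHS]mulrA; apply: ler_wpM2l; first by rewrite mulr_ge0 ?sqr_ge0.
have a2 : area K ^+ 2 <= amax ^+ 2 by rewrite lerXn2r// nnegrE ltW// (lt_le_trans K0).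
have h1 : area K ^+ 2 * I <= (1 + amax ^+ 2) * (I + h).
  by apply: ler_pM; rewrite ?sqr_ge0//; lra.
have h2 : h <= (1 + amax ^+ 2) * (I + h).
  by rewrite -[leLHS]mul1r; apply: ler_pM => //; have := sqr_ge0 amax; lra.
rewrite [leRHS]mulrDl; apply: lerD; first by rewrite ler_wpM2l// ltW.
by rewrite ler_wpM2l// mulr_ge0 ?sqr_ge0// ltW.
Qed.

End ElementEstimates.

(** * Jump terms on an edge of a common triangle *)

Section EdgeEstimates.
Context {R : realType}.
Variable Omega : set (plane R).
Hypothesis oO : open Omega.
Implicit Types (K : triangle R) (T S : triangulation R) (w e f : plane R -> R).
Implicit Types (E : plane R * plane R) (D : (plane R -> R) -> plane R -> R).

Lemma jumpE p T w D K E x : jump p T w D K E x =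
  \sum_(K' <- neighbors T K E) (D (piece p w K) x - D (piece p w K') x).
Proof. by rewrite /neighbors big_filter. Qed.

Lemma neighbors_in T K K' E : K' \in neighbors T K E ->
  [/\ K' \in T, K' != K & has_edge K' E].
Proof. by rewrite mem_filter => /andP[/andP[? ?] ?]. Qed.

Lemma edge_enorm_le (sigma amax : R) K E : 1 <= sigma -> shape_ok sigma amax K ->
  E \in edges K -> enorm (E.2 - E.1) <= 2 * (96 * sigma * inrad sigma K).
Proof.
move=> s1 HK EK; have [E1 E2] := edge_in_tri EK.
have r0 := inrad_gt0 s1 HK; have [d1 d2] := tri_diam s1 HK E2 E1.
apply: enorm_le => //.
by rewrite mulr_ge0 ?(ltW r0)// mulr_ge0// (le_trans ler01 s1).
Qed.

(* [D] is [d_nunu E] with [m = 1], or [d_nu_laplace E] with [m = 3]; the weight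
   [W] is |K|^(m/2). *)
Lemma edge_close p (sigma amax : R) T S K E w w' D m (C kap W : R) :
  1 <= sigma -> 0 <= C -> 0 <= kap ->
  regular_triangulation Omega T -> regular_triangulation Omega S -> nvb T S ->
  (forall K, K \in S -> shape_ok sigma amax K) ->
  (forall K, K \in T -> exists f, is_piece p w K f) ->
  (forall K, K \in S -> exists f, is_piece p w' K f) ->
  (forall f, tpoly p f -> tpoly p (D f)) ->
  (forall f g x, tpoly p f -> tpoly p g -> D (fun y => f y - g y) x = D f x - D g x) ->
  (forall K f x, K \in S -> is_piece p (w' \- w) K f -> tri_set K x ->
     inrad sigma K ^+ m.+1 * D f x ^+ 2 <= C * hess Omega K (w' \- w)) ->
  K \in T -> K \in S -> E \in edges K -> 0 <= W <= kap * inrad sigma K ^+ m ->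
  nrm_close
    (W * edge_integral Omega E (fun x => jump p S w' D K E x ^+ 2))
    (W * edge_integral Omega E (fun x => jump p T w D K E x ^+ 2))
    (kap * (2 * (96 * sigma)) * (2 * C) * ((96 * sigma) ^+ 2) ^+ m.+1 *
      \sum_(K' <- neighbors S K E) (hess Omega K (w' \- w) + hess Omega K' (w' \- w))).
Proof.
move=> s1 C0 kap0 HT HS TS shp pT pS tD DB De KT KS EK /andP[W0 Wle].
have hE : has_edge K E by rewrite /has_edge EK.
have HK := shp K KS; have r0 := inrad_gt0 s1 HK.
have cont (U : triangulation R) v : (forall K, K \in U -> exists f, is_piece p v K f) ->
    K \in U -> continuous (fun x => jump p U v D K E x).
  move=> pU KU; have pc L : L \in U -> tpoly p (D (piece p v L)).
    by move=> /pU[f /pieceP[pf _]]; exact: (tD _ (poly_fun_tpoly pf)).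
  have tj : tpoly p (fun x => jump p U v D K E x).
    have -> : (fun x => jump p U v D K E x) = fun x =>
        \sum_(L <- neighbors U K E) (D (piece p v K) x - D (piece p v L) x).
      by apply/funext => x; exact: jumpE.
    have : forall L, L \in neighbors U K E -> L \in U by move=> L /neighbors_in[].
    elim: (neighbors U K E) => [_|L s IH sub].
      by under eq_fun do rewrite big_nil; exact: tpoly0.
    under eq_fun do rewrite big_cons.
    have := tpoly_lin 1 1 (tpolyB (pc _ KU) (pc _ (sub L (mem_head _ _))))
      (IH (fun M Ms => sub M (mem_behead (s := L :: s) Ms))).
    by under eq_fun do rewrite !mul1r.
  exact: (smooth_cont (tpoly_smooth tj)).
have cT := cont T w pT KT; have cS := cont S w' pS KS.
apply: (nrm_close_mono (nrm_closeZ W0 (nrm_close_edge oO E cS cT))).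
have cD : continuous (fun x => jump p S w' D K E x - jump p T w D K E x).
  by move=> x; apply: cvgB; [exact: cS|exact: cT].
have [[nT nS]|[K' [K'' [nT nS K'T K''S sub]]]] := refined_neighbors HT HS TS KT KS hE.
  rewrite nS big_nil mulr0.
  apply: (@le_trans _ _ (W * (enorm (E.2 - E.1) * 0))); last by rewrite !mulr0.
  rewrite ler_wpM2l//; apply: (edge_integral_le oO cD) => // x _.
  by rewrite !jumpE nT nS !big_nil subrr expr0n.
have [_ _ hE''] : [/\ K'' \in S, K'' != K & has_edge K'' E].
  by apply: neighbors_in; rewrite nS mem_head.
rewrite nS big_seq1.
have HK'' := shp K'' K''S; have r0'' := inrad_gt0 s1 HK''.
have [[f Hf] [f' Hf']] := (pT K KT, pS K KS).
have [[g Hg] [g' Hg']] := (pT K' K'T, pS K'' K''S).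
have pc := pieceP Hf; have pc' := pieceP Hf'.
(* The coarse polynomial on K' also represents w on the smaller triangle K'', so both functions are
   compared on K'' from here on. *)
have pd := is_piece_sub sub (pieceP Hg); have pd' := pieceP Hg'.
have [K''0 _ _] := HK''.
have K'E := piece_sub K''0 sub Hg.
set q := piece p w K in pc; set q' := piece p w' K in pc'.
have tq := poly_fun_tpoly (proj1 pc); have tq' := poly_fun_tpoly (proj1 pc').
set v := piece p w K' in pd; set v' := piece p w' K'' in pd'.
have tv := poly_fun_tpoly (proj1 pd); have tv' := poly_fun_tpoly (proj1 pd').
have tau := neighbor_inrad s1 HK HK'' hE hE''.
set h := hess Omega K (w' \- w); set h'' := hess Omega K'' (w' \- w).
have h0 : 0 <= h by exact: hess_ge0.
have h''0 : 0 <= h'' by exact: hess_ge0.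
set r := inrad sigma K in r0 tau Wle *; set r'' := inrad sigma K'' in r0'' tau *.
have rn n : 0 < r ^+ n by exact: exprn_gt0.
have rn'' n : 0 < r'' ^+ n by exact: exprn_gt0.
(* A pointwise bound for the squared difference of the two jumps, with one contribution from each
   side of the edge. *)
pose B := 2 * (C * h / r ^+ m.+1) + 2 * (C * h'' / r'' ^+ m.+1).
have B1 := divr_ge0 (mulr_ge0 C0 h0) (ltW (rn m.+1)).
have B2 := divr_ge0 (mulr_ge0 C0 h''0) (ltW (rn'' m.+1)).
have B0 : 0 <= B by rewrite /B; lra.
have bound x : segment E.1 E.2 x ->
    (jump p S w' D K E x - jump p T w D K E x) ^+ 2 <= B.
  move=> Ex; rewrite !jumpE nT nS !big_seq1 -/q -/q' -/v -/v'.
  have -> : D q' x - D v' x - (D q x - D v x) =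
      D (fun y => q' y - q y) x + - D (fun y => v' y - v y) x.
    have aux (a b c d : R) : a - b - (c - d) = a - c + - (b - d) by ring.
    by rewrite (DB _ _ x tq' tq) (DB _ _ x tv' tv); exact: aux.
  apply: (le_trans (sqrD_le _ _)); rewrite sqrrN; apply: lerD.
    rewrite ler_wpM2l// ler_pdivlMr// mulrC.
    by apply: (De _ _ _ KS (is_pieceB pc pc')); exact: (tri_edge_segment hE Ex).
  rewrite ler_wpM2l// ler_pdivlMr// mulrC.
  by apply: (De _ _ _ K''S (is_pieceB pd pd')); exact: (tri_edge_segment hE'' Ex).
have le1 := edge_integral_le oO cD B0 bound.
have le2 := ler_wpM2r B0 (edge_enorm_le s1 HK EK).
apply: (le_trans (ler_wpM2l W0 (le_trans le1 le2))); rewrite -/r.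
have s0 : 0 <= 96 * sigma by rewrite mulr_ge0// (le_trans ler01 s1).
have le3 : 0 <= 2 * (96 * sigma * r) * B.
  exact: (mulr_ge0 (mulr_ge0 (ler0n R 2) (mulr_ge0 s0 (ltW r0))) B0).
apply: (le_trans (ler_wpM2r le3 Wle)).
(* The weight supplies r^m and the edge length r. Together they cancel r^(m+1) on K and leave the
   ratio r / r'' for the neighbour, bounded by [neighbor_inrad]. *)
have -> : kap * r ^+ m * (2 * (96 * sigma * r) * B) =
    kap * (2 * (96 * sigma)) * (2 * C) * (h + h'' * (r / r'') ^+ m.+1).
  rewrite /B expr_div_n; have n1 := lt0r_neq0 (rn m.+1); have n2 := lt0r_neq0 (rn'' m.+1).
  have -> : forall b, kap * r ^+ m * (2 * (96 * sigma * r) * b) =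
      kap * (2 * (96 * sigma)) * (r ^+ m.+1 * b) by move=> b; rewrite exprS; ring.
  by move: (r ^+ m.+1) (r'' ^+ m.+1) (96 * sigma) n1 n2 => a b c na nb; field; rewrite nb na.
have k0 : 0 <= kap * (2 * (96 * sigma)) * (2 * C).
  exact: (mulr_ge0 (mulr_ge0 kap0 (mulr_ge0 (ler0n R 2) s0)) (mulr_ge0 (ler0n R 2) C0)).
rewrite -[leRHS]mulrA; apply: (ler_wpM2l k0).
have t1 : 1 <= (96 * sigma) ^+ 2.
  by apply: exprn_ege1; apply: (le_trans s1); rewrite ler_peMl ?ler1n// (le_trans ler01 s1).
rewrite mulrDr; apply: lerD.
  by rewrite ler_peMl// exprn_ege1.
rewrite mulrC ler_wpM2r// lerXn2r ?nnegrE ?divr_ge0 ?(ltW r0) ?(ltW r0'')//.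
  exact: sqr_ge0.
by rewrite ler_pdivrMr.
Qed.

End EdgeEstimates.

(** * Summation over the common triangles *)

Section Summation.
Context {R : realType}.
Variable Omega : set (plane R).
Hypothesis oO : open Omega.
Hypothesis bO : bounded_set Omega.
Hypothesis lO : lipschitz_boundary Omega.
Implicit Types (K : triangle R) (T S : triangulation R) (w e f : plane R -> R).
Implicit Types (E : plane R * plane R).

Definition edge_patch S K e : R :=
  \sum_(E <- edges K) \sum_(K' <- neighbors S K E) (hess Omega K e + hess Omega K' e).

Lemma powR_half (a : R) : 0 <= a -> a `^ (1 / 2) = Num.sqrt a.
Proof. by move=> a0; rewrite div1r powR12_sqrt. Qed.

Lemma powR_three_halves (a : R) : 0 <= a -> a `^ (3 / 2) = a * Num.sqrt a.
Proof.
move=> a0; have -> : 3 / 2 = 1 + 1 / 2 :> R by field.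
rewrite powRD; last by apply/implyP => /eqP; lra.
by rewrite powRr1// powR_half.
Qed.

Lemma eta2_close p (sigma : R) : 1 <= sigma ->
  exists2 C : R, 0 < C & forall amax T S K w w' (l l' : R),
    regular_triangulation Omega T -> regular_triangulation Omega S -> nvb T S ->
    (forall K, K \in S -> shape_ok sigma amax K) ->
    (forall K, K \in T -> exists f, is_piece p w K f) ->
    (forall K, K \in S -> exists f, is_piece p w' K f) ->
    H20 Omega (w' \- w) -> L2 Omega (fun x => l' * w' x - l * w x) ->
    K \in T -> K \in S ->
    nrm_close (eta2 Omega p S l' w' K) (eta2 Omega p T l w K)
      (C * (1 + amax ^+ 2) *
        (ip mu2 (tri_int K) (fun x => l' * w' x - l * w x) (fun x => l' * w' x - l * w x) +
         hess Omega K (w' \- w) + edge_patch S K (w' \- w))).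
Proof.
move=> s1; have [CV CV0 HV] := volume_close oO p s1.
have [C C0 HC] := @piece_estimates R Omega oO p sigma s1.
pose kap : R := 12 * (24 * sigma).
have kap0 : 0 <= kap by rewrite !mulr_ge0// (le_trans ler01 s1).
(* C1 and C2 are the constants of [edge_close] for m = 1 and m = 3: since |K| = kap r^2, the weights
   are sqrt(kap) r and kap sqrt(kap) r^3. *)
pose C1 := Num.sqrt kap * (2 * (96 * sigma)) * (2 * C) * ((96 * sigma) ^+ 2) ^+ 2.
pose C2 := kap * Num.sqrt kap * (2 * (96 * sigma)) * (2 * C) * ((96 * sigma) ^+ 2) ^+ 4.
have s0 : 0 <= 96 * sigma by rewrite mulr_ge0// (le_trans ler01 s1).
have sk0 : 0 <= Num.sqrt kap by rewrite sqrtr_ge0.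
have C10 : 0 <= C1.
  exact: (mulr_ge0 (mulr_ge0 (mulr_ge0 sk0 (mulr_ge0 (ler0n R 2) s0))
    (mulr_ge0 (ler0n R 2) (ltW C0))) (exprn_ge0 2 (sqr_ge0 _))).
have C20 : 0 <= C2.
  exact: (mulr_ge0 (mulr_ge0 (mulr_ge0 (mulr_ge0 kap0 sk0) (mulr_ge0 (ler0n R 2) s0))
    (mulr_ge0 (ler0n R 2) (ltW C0))) (exprn_ge0 4 (sqr_ge0 _))).
exists (CV + C1 + C2) => [|amax T S K w w' l l' HT HS TS shp pT pS He Lg KT KS].
  by rewrite -addrA ltr_wpDr// addr_ge0.
have HK := shp K KS; have [K0 _ _] := HK; have r0 := inrad_gt0 s1 HK.
have ar := inrad_sqr s1 HK; rewrite -/kap in ar.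
have [[f Hf] [f' Hf']] := (pT K KT, pS K KS).
have sub L : L \in S -> tri_int L `<=` Omega by exact: (regular_interior_sub HS oO lO).
have H1 := HV amax K w w' l l' HK (sub K KS) (pieceP Hf) (pieceP Hf') He Lg.
have sa : Num.sqrt (area K) = Num.sqrt kap * inrad sigma K.
  by rewrite ar sqrtrM// sqrtr_sqr ger0_norm// ltW.
set I := ip _ _ _ _ in H1 *; set h := hess Omega K _ in H1 *.
set P := edge_patch S K _.
have H2 : nrm_close
    (area K `^ (1 / 2) * \sum_(E <- edges K)
      edge_integral Omega E (fun x => jump p S w' (d_nunu E) K E x ^+ 2))
    (area K `^ (1 / 2) * \sum_(E <- edges K)
      edge_integral Omega E (fun x => jump p T w (d_nunu E) K E x ^+ 2)) (C1 * P).
  rewrite [X in nrm_close X]mulr_sumr [X in nrm_close _ X]mulr_sumr.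
  rewrite /P /edge_patch [X in nrm_close _ _ X]mulr_sumr; apply: nrm_close_sum_seq => E EK.
  apply: (edge_close oO (m := 1) s1 (ltW C0) sk0 HT HS TS shp pT pS
    (fun g => @tpoly_d_nunu R p E g) (fun g g' x => @d_nunuB R p E g g' x) _ KT KS EK).
    move=> L g x LS Hg Lx.
    by have [] := HC amax L (w' \- w) g (shp L LS) (sub L LS) He Hg x E Lx.
  by rewrite powR_ge0 (powR_half (ltW K0)) sa expr1 lexx.
have H3 : nrm_close
    (area K `^ (3 / 2) * \sum_(E <- edges K)
      edge_integral Omega E (fun x => jump p S w' (d_nu_laplace E) K E x ^+ 2))
    (area K `^ (3 / 2) * \sum_(E <- edges K)
      edge_integral Omega E (fun x => jump p T w (d_nu_laplace E) K E x ^+ 2)) (C2 * P).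
  rewrite [X in nrm_close X]mulr_sumr [X in nrm_close _ X]mulr_sumr.
  rewrite /P /edge_patch [X in nrm_close _ _ X]mulr_sumr; apply: nrm_close_sum_seq => E EK.
  apply: (edge_close oO (m := 3) s1 (ltW C0) (mulr_ge0 kap0 sk0) HT HS TS shp pT pS
    (fun g => @tpoly_d_nu_laplace R p E g) (fun g g' x => @d_nu_laplaceB R p E g g' x) _ KT KS EK).
    move=> L g x LS Hg Lx.
    by have [] := HC amax L (w' \- w) g (shp L LS) (sub L LS) He Hg x E Lx.
  rewrite powR_ge0 (powR_three_halves (ltW K0)) sa {1}ar.
  have -> : forall r s : R, kap * r ^+ 2 * (s * r) = kap * s * r ^+ 3 by move=> r s; ring.
  exact: lexx.
apply: (nrm_close_mono (nrm_closeD (nrm_closeD H1 H2) H3)).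
have I0 : 0 <= I by exact: ip_ge0.
have h0 : 0 <= h by exact: hess_ge0.
have P0 : 0 <= P.
  by apply: sumr_ge0 => E _; apply: sumr_ge0 => L _; rewrite addr_ge0// hess_ge0.
have a1 : 1 <= 1 + amax ^+ 2 by have := sqr_ge0 amax; lra.
move: (1 + amax ^+ 2) a1 => a a1.
have -> : (CV + C1 + C2) * a * (I + h + P) = CV * a * (I + h) + CV * a * P +
    (C1 * (a * P) + C2 * (a * P)) + (C1 + C2) * a * (I + h) by ring.
have a0 : 0 <= a by lra.
have aP : P <= a * P by rewrite ler_peMl.
have h1 := ler_wpM2l C10 aP; have h2 := ler_wpM2l C20 aP.
have h3 : 0 <= CV * a * P by rewrite !mulr_ge0// ltW.
have h4 : 0 <= (C1 + C2) * a * (I + h) by rewrite !mulr_ge0// addr_ge0.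
lra.
Qed.

(** The two triangles may list a common edge with opposite orientations, so the sums are not matched
    term by term: a nonempty left sum has at most three terms, and then the right sum has at least
    one. *)
Lemma swap_edge_count T K K' (h : R) : 0 <= h ->
  \sum_(E <- edges K | (K' != K) && has_edge K' E) h <=
  3 * \sum_(E <- edges K' | (K != K') && has_edge K E) h.
Proof.
move=> h0; have [/hasP[E EK /andP[ne hE]]|nE] :=
  boolP (has (fun E => (K' != K) && has_edge K' E) (edges K)); last first.
  rewrite big1_seq ?mulr_ge0 ?sumr_ge0// => E /andP[cE EK].
  by case/hasP: nE; exists E.
apply: (@le_trans _ _ (3 * h)).
  rewrite big_mkcond /= !big_cons big_nil addr0.
  by do 3 case: ifP => _; lra.
rewrite ler_wpM2l//.
have [F FK' hF] : exists2 F, F \in edges K' & has_edge K F.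
  move: hE; rewrite /has_edge => /orP[EK'|EK'].
    by exists E => //; rewrite /has_edge EK.
  exists (E.2, E.1) => //; rewrite /has_edge; apply/orP; right.
  by rewrite -surjective_pairing.
rewrite (big_rem F FK') /= hF eq_sym ne /= lerDl.
by apply: sumr_ge0.
Qed.

(** Double counting: a triangle has three edges with at most one neighbour across each, and
    [swap_edge_count] contributes another factor 3. *)
Lemma neighbors_exchange S (h : triangle R -> R) : (forall K, 0 <= h K) ->
  regular_triangulation Omega S ->
  \sum_(K <- S) \sum_(E <- edges K) \sum_(K' <- neighbors S K E) h K' <=
  9 * \sum_(K <- S) h K.
Proof.
move=> h0 HS; apply: (@le_trans _ _ (\sum_(K <- S) \sum_(K' <- S)
    3 * \sum_(F <- edges K' | (K != K') && has_edge K F) h K')).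
  apply: ler_sum => K _.
  have -> : \sum_(E <- edges K) \sum_(K' <- neighbors S K E) h K' =
      \sum_(K' <- S) \sum_(E <- edges K | (K' != K) && has_edge K' E) h K'.
    rewrite (exchange_big_dep xpredT)//=; apply: eq_bigr => E _.
    by rewrite /neighbors big_filter.
  by apply: ler_sum => K' _; exact: swap_edge_count.
rewrite exchange_big /= mulr_sumr big_seq [leRHS]big_seq; apply: ler_sum => K' K'S.
rewrite -mulr_sumr.
have -> : \sum_(K <- S) \sum_(F <- edges K' | (K != K') && has_edge K F) h K' =
    \sum_(F <- edges K') \sum_(K <- neighbors S K' F) h K'.
  rewrite (exchange_big_dep xpredT)//=; apply: eq_bigr => E _.
  by rewrite /neighbors big_filter.
have -> : 9 * h K' = 3 * (3 * h K') by ring.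
rewrite ler_wpM2l//; apply: (@le_trans _ _ (\sum_(F <- edges K') h K')).
  rewrite big_seq [leRHS]big_seq; apply: ler_sum => F FK'.
  have hF : has_edge K' F by rewrite /has_edge FK'.
  by have [->|[L [-> _ _ _]]] := neighborsP HS K'S hF; rewrite ?big_nil ?big_seq1.
by rewrite /= !big_cons big_nil; lra.
Qed.

(** 12 = 3 + 9: each K is counted at most once per edge for its own energy, and the energies of
    neighbours are handled by [neighbors_exchange]. *)
Lemma edge_patch_sum_le S e : regular_triangulation Omega S ->
  \sum_(K <- S) edge_patch S K e <= 12 * \sum_(K <- S) hess Omega K e.
Proof.
move=> HS; have h0 K := hess_ge0 Omega K e.
have -> : \sum_(K <- S) edge_patch S K e =
    \sum_(K <- S) \sum_(E <- edges K) \sum_(K' <- neighbors S K E) hess Omega K e +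
    \sum_(K <- S) \sum_(E <- edges K) \sum_(K' <- neighbors S K E) hess Omega K' e.
  rewrite -big_split; apply: eq_bigr => K _ /=; rewrite -big_split.
  by apply: eq_bigr => E _ /=; rewrite -big_split.
have H1 := neighbors_exchange h0 HS.
have H2 : \sum_(K <- S) \sum_(E <- edges K) \sum_(K' <- neighbors S K E) hess Omega K e <=
    3 * \sum_(K <- S) hess Omega K e.
  rewrite mulr_sumr big_seq [leRHS]big_seq; apply: ler_sum => K KS.
  apply: (@le_trans _ _ (\sum_(E <- edges K) hess Omega K e)).
    rewrite big_seq [leRHS]big_seq; apply: ler_sum => E EK.
    have hE : has_edge K E by rewrite /has_edge EK.
    by have [->|[L [-> _ _ _]]] := neighborsP HS KS hE; rewrite ?big_nil ?big_seq1.
  by rewrite /= !big_cons big_nil; lra.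
lra.
Qed.

(** The induction removes one open triangle at a time from D, which therefore has to vary. *)
Lemma disjoint_ip_le (s : seq (triangle R)) (D : set (plane R)) f :
  uniq s -> measurable (D : set (mplane R)) -> sqint mu2 D f ->
  (forall K, K \in s -> tri_int K `<=` D) ->
  (forall K K', K \in s -> K' \in s -> K != K' -> tri_int K `&` tri_int K' = set0) ->
  \sum_(K <- s) ip mu2 (tri_int K) f f <= ip mu2 D f f.
Proof.
elim: s D => [D _ _ _ _ _|K s IH D]; first by rewrite big_nil ip_ge0.
rewrite /= => /andP[Ks us] mD Hf sub dis; rewrite big_cons.
have mI := open_measurable_plane (@open_tri_int R K).
have KD := sub K (mem_head _ _).
have mD' := measurableD mD mI.
have [mf if2] := Hf.
have Df : sqint mu2 (D `\` tri_int K) f.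
  by split; [exact: measurable_funS mD _ mf|exact: integrableS mD mD' _ if2].
have -> : ip mu2 D f f = ip mu2 (tri_int K) f f + ip mu2 (D `\` tri_int K) f f.
  rewrite -!ip_sqrE -[in LHS](setDUK KD); apply: (Rintegral_setU mI mD').
    by rewrite setDUK.
  by apply/disj_setPS => x [Kx [_]].
rewrite lerD2l; apply: IH => //.
- move=> L Ls x Lx; split; first by apply: (sub L _ x Lx); rewrite inE Ls orbT.
  move=> Kx; have KL : K != L by apply: contraNneq Ks => ->.
  have := dis K L (mem_head _ _) _ KL; rewrite inE Ls orbT => /(_ isT).
  by move=> /seteqP[/(_ x) h _]; exact: h.
- by move=> L L' Ls L's; apply: dis; rewrite inE ?Ls ?L's orbT.
Qed.

Lemma interiors_ip_le S f : regular_triangulation Omega S -> L2 Omega f ->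
  \sum_(K <- S) ip mu2 (tri_int K) f f <= ip mu2 Omega f f.
Proof.
move=> HS Lf; apply: (disjoint_ip_le (fset_uniq S) (open_measurable_plane oO) Lf).
- by move=> K KS; exact: (regular_interior_sub HS oO lO KS).
- by move=> K K' KS K'S; exact: (regular_interior_disjoint HS KS K'S).
Qed.

Lemma hess_sum_le S e : regular_triangulation Omega S -> H20 Omega e ->
  \sum_(K <- S) hess Omega K e <= form_a Omega e e.
Proof.
move=> HS He; rewrite /hess exchange_big; apply: ler_sum => i _.
rewrite exchange_big; apply: ler_sum => k _; apply: interiors_ip_le => //.
by have [] := H20_wderiv He (mem_multi2 i k).
Qed.

Lemma sum_common_le T S (h : triangle R -> R) : (forall K, 0 <= h K) ->
  \sum_(K <- (T `&` S)%fset) h K <= \sum_(K <- S) h K.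
Proof.
move=> h0; have : perm_eq (enum_fset (T `&` S)%fset) [seq K <- enum_fset S | K \in T].
  apply: uniq_perm; rewrite ?filter_uniq ?fset_uniq// => K.
  by rewrite mem_filter -in_fsetI.
move=> /(perm_big _) -> ; rewrite big_filter big_mkcond /=.
by apply: ler_sum => K _; case: ifP.
Qed.

End Summation.

(** * Eigenvalues as energies and the difference of the right-hand sides *)

Section EigenpairEstimates.
Context {R : realType}.
Variable Omega : set (plane R).
Hypothesis oO : open Omega.
Hypothesis bO : bounded_set Omega.
Implicit Types (w : plane R -> R).

(** The eigenvalue equation is tested with the eigenfunction itself. *)
Lemma eigenpair_form W (l : R) w : eigenpair Omega W l w ->
  form_b Omega w w = 1 /\ form_a Omega w w = l.
Proof.
move=> [[Ww aw] nw]; have b1 : form_b Omega w w = 1.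
  by rewrite -(sqr_sqrtr (ip_ge0 (@mu2 R) Omega w : 0 <= form_b Omega w w))
    -[Num.sqrt _]/(norm_b Omega w) nw expr1n.
by rewrite (aw w Ww) b1 mulr1.
Qed.

(* The right-hand sides [l w] and [l' w'] differ by [l' (w' - w) + (l' - l) w],
   and [l' - l] is a difference of squared energy norms. *)
Lemma rhs_diff_le : exists2 C : R, 0 < C &
  forall (L l l' : R) (W W' : set (plane R -> R)) w w',
    0 <= L -> l <= L -> l' <= L -> H20 Omega w -> H20 Omega w' ->
    eigenpair Omega W l w -> eigenpair Omega W' l' w' ->
    ip mu2 Omega (fun x => l' * w' x - l * w x) (fun x => l' * w' x - l * w x) <=
    (C * L ^+ 2 + 8 * L) * form_a Omega (w' \- w) (w' \- w).
Proof.
have [CP CP0 HP] := poincare_H20 oO bO.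
exists (2 * CP) => [|L l l' W W' w w' L0 lL l'L Hw Hw' Ew Ew']; first by rewrite mulr_gt0.
have [b1 a1] := eigenpair_form Ew; have [b1' a1'] := eigenpair_form Ew'.
have He := H20_sub oO bO Hw' Hw.
have l0 : 0 <= l by rewrite -a1 form_a_ge0.
have l'0 : 0 <= l' by rewrite -a1' form_a_ge0.
have mO := open_measurable_plane oO.
set e := w' \- w in He *.
have -> : (fun x => l' * w' x - l * w x) = (fun x => l' * e x + (l' - l) * w x).
  by apply/funext => x; rewrite /e /=; ring.
have Le := sqintZ mO l' (H20_L2 He); have Lw := sqintZ mO (l' - l) (H20_L2 Hw).
apply: (le_trans (ip_norm2_le mO Le Lw)).
have -> : ip mu2 Omega (fun x => l' * e x) (fun x => l' * e x) = l' ^+ 2 * ip mu2 Omega e e.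
  rewrite (ipZl mO l' (H20_L2 He) Le) (ipZr mO l' (H20_L2 He) (H20_L2 He)).
  by rewrite mulrA expr2.
have -> : ip mu2 Omega (fun x => (l' - l) * w x) (fun x => (l' - l) * w x) = (l' - l) ^+ 2.
  rewrite (ipZl mO (l' - l) (H20_L2 Hw) Lw) (ipZr mO (l' - l) (H20_L2 Hw) (H20_L2 Hw)).
  by rewrite -[ip _ _ _ _]/(form_b Omega w w) b1 mulr1 expr2.
have A0 := form_a_ge0 Omega e; have I0 := ip_ge0 (@mu2 R) Omega e.
have h1 : l' ^+ 2 * ip mu2 Omega e e <= L ^+ 2 * (CP * form_a Omega e e).
  by apply: ler_pM; rewrite ?sqr_ge0//; [rewrite lerXn2r// nnegrE|exact: HP].
(* Eigenvalues are squared energy norms, so l' - l factors into the difference and the sum of these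
   norms: the difference is at most the energy norm of e, the sum at most 2 sqrt(L). *)
have h2 : (l' - l) ^+ 2 <= 4 * L * form_a Omega e e.
  have n1 := norm_a_sub_le oO bO Hw' Hw.
  rewrite /norm_a a1 a1' -/e in n1.
  have -> : (l' - l) ^+ 2 =
      (Num.sqrt l' - Num.sqrt l) ^+ 2 * (Num.sqrt l' + Num.sqrt l) ^+ 2.
    by rewrite -exprMn -subr_sqr !sqr_sqrtr.
  rewrite mulrC; apply: ler_pM; rewrite ?sqr_ge0//.
    apply: (@le_trans _ _ ((2 * Num.sqrt L) ^+ 2)); last first.
      by rewrite exprMn (sqr_sqrtr L0) -natrX.
    have s1 : Num.sqrt l <= Num.sqrt L by rewrite ler_sqrt.
    have s2 : Num.sqrt l' <= Num.sqrt L by rewrite ler_sqrt.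
    have q1 := sqrtr_ge0 l; have q2 := sqrtr_ge0 l'; have q3 := sqrtr_ge0 L.
    have q4 : 0 <= 2 * Num.sqrt L by exact: mulr_ge0 (ler0n R 2) q3.
    rewrite lerXn2r ?nnegrE ?(addr_ge0 q2 q1)// mulr_natl mulr2n; exact: lerD.
  rewrite -(sqr_sqrtr A0) -(real_normK (num_real (_ - _))).
  by rewrite lerXn2r ?nnegrE ?sqrtr_ge0.
move: (form_a Omega e e) (ip mu2 Omega e e) h1 h2 => a i h1 h2.
have -> : (2 * CP * L ^+ 2 + 8 * L) * a =
    2 * (L ^+ 2 * (CP * a)) + 2 * (4 * L * a) by ring.
by apply: lerD; rewrite ler_wpM2l.
Qed.

End EigenpairEstimates.

(** Formulated for arbitrary piecewise polynomials w, w' and numbers l, l', so that the eigenvalue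
    problem enters only afterwards. The factor 13 is 1 for the energy of the triangles themselves
    plus 12 from [edge_patch_sum_le]. *)
Lemma eta_stability (R : realType) (Omega : set (plane R)) p (sigma : R) :
  open Omega -> bounded_set Omega -> lipschitz_boundary Omega -> 1 <= sigma ->
  exists2 C : R, 0 < C & forall (amax : R) (T S : triangulation R) w w' (l l' : R),
    regular_triangulation Omega T -> regular_triangulation Omega S -> nvb T S ->
    (forall K, K \in S -> shape_ok sigma amax K) ->
    (forall K, K \in T -> exists f, is_piece p w K f) ->
    (forall K, K \in S -> exists f, is_piece p w' K f) ->
    H20 Omega (w' \- w) -> L2 Omega (fun x => l' * w' x - l * w x) ->
    `|eta Omega p S l' w' (T `&` S)%fset - eta Omega p T l w (T `&` S)%fset| <=
    Num.sqrt (C * (1 + amax ^+ 2) *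
      (ip mu2 Omega (fun x => l' * w' x - l * w x) (fun x => l' * w' x - l * w x) +
       13 * form_a Omega (w' \- w) (w' \- w))).
Proof.
move=> oO bO lO s1; have [C C0 HC] := eta2_close oO lO p s1.
exists C => // amax T S w w' l l' HT HS TS shp pT pS He Lg.
apply: nrm_close_le.
set g := fun x => l' * w' x - l * w x; set e := w' \- w.
pose D K := ip mu2 (tri_int K) g g + hess Omega K e + edge_patch Omega S K e.
have H : nrm_close (\sum_(K <- (T `&` S)%fset) eta2 Omega p S l' w' K)
    (\sum_(K <- (T `&` S)%fset) eta2 Omega p T l w K)
    (\sum_(K <- (T `&` S)%fset) C * (1 + amax ^+ 2) * D K).
  apply: nrm_close_sum_seq => K; rewrite in_fsetI => /andP[KT KS].
  exact: (HC amax T S K w w' l l').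
apply: (nrm_close_mono H); rewrite -mulr_sumr; apply: ler_wpM2l.
  by rewrite mulr_ge0 ?(ltW C0)// addr_ge0// sqr_ge0.
have D0 K : 0 <= D K.
  rewrite !addr_ge0 ?ip_ge0 ?hess_ge0//.
  by apply: sumr_ge0 => E _; apply: sumr_ge0 => L _; rewrite addr_ge0// hess_ge0.
apply: (le_trans (sum_common_le T S D0)); rewrite /D !big_split /=.
have h1 := interiors_ip_le oO lO HS Lg; have h2 := hess_sum_le oO lO HS He.
have h3 := edge_patch_sum_le e HS (Omega := Omega).
rewrite -/g -/e in h1 h2 *; move: h1 h2 h3.
move: (\sum_(K <- S) ip _ _ _ _) (\sum_(K <- S) hess _ _ _) (\sum_(K <- S) edge_patch _ _ _ _).
by move: (ip _ _ _ _) (form_a _ _ _) => a b i h q h1 h2 h3; lra.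
Qed.

Theorem mainTheorem4
  (R : realType) (Omega : set (plane R))
  (hOmega : polygonal_lipschitz_domain Omega)
  (Tinit : triangulation R) (hTinit : regular_triangulation Omega Tinit)
  (p : nat) (hp : (5 <= p)%N)
  (lam : nat -> R) (hlam : continuous_eigenvalues Omega lam)
  (j : nat) (hj : (1 <= j)%N)
  (hsimple : has_dim (eigenfunctions Omega (H20 Omega) (lam j)) 1)
  (u : plane R -> R) (hu : eigenpair Omega (H20 Omega) (lam j) u)
  (delta2 Lqo Lsep : R) (hdelta2 : 0 < delta2) (hLqo : 0 < Lqo) (hLsep : 0 < Lsep)
  (hprop : forall T : triangulation R,
     nvb_triangulation Omega Tinit T -> mesh_le T delta2 ->
     [/\ property_i Omega p Tinit j lam u T Lqo,
         property_ii Omega p Tinit j lam u T,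
         property_iii Omega p Tinit j lam T &
         property_iv Omega p Tinit j lam T Lsep]) :
  exists2 Lambda1 : R, 0 < Lambda1 &
    forall T That : triangulation R,
      nvb_triangulation Omega Tinit T -> mesh_le T delta2 ->
      nvb_triangulation Omega Tinit That -> nvb T That ->
    forall (lamh lamhat : nat -> \bar R) (lh lhat : R) (uh uhat : plane R -> R),
      discrete_eigenpair Omega p Tinit j u T lamh lh uh ->
      discrete_eigenpair Omega p Tinit j u That lamhat lhat uhat ->
      `|eta Omega p That lhat uhat (T `&` That)%fset
        - eta Omega p T lh uh (T `&` That)%fset|
      <= Lambda1 * norm_a Omega (uhat \- uh)%R.
Proof.
have [[_ oO _ bO] [lO _]] := hOmega.
have [sigma [amax [s1 shp]]] := shape_exists (regular_area hTinit).
have [C C0 HC] := eta_stability p oO bO lO s1.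
have [C' C'0 HC'] := rhs_diff_le oO bO.
(* By property (iii) this bounds the discrete eigenvalue number j on every admissible mesh,
   independently of the mesh. *)
pose L := lam j.+1.
have L0 : 0 < L by have [_ h _ _] := hlam; exact: h.
(* The last factor adds the constant of [rhs_diff_le] and the 13 of [eta_stability]; Q depends on
   the initial mesh only through sigma and [amax]. *)
pose Q := C * (1 + amax ^+ 2) * (C' * L ^+ 2 + 8 * L + 13).
have a0 : 0 < 1 + amax ^+ 2 by rewrite ltr_wpDr ?sqr_ge0.
have c0 : 0 < C' * L ^+ 2 + 8 * L + 13.
  by rewrite !addr_gt0// mulr_gt0// exprn_gt0.
have Q0 : 0 < Q by rewrite /Q !mulr_gt0.
exists (Num.sqrt Q) => [|T S [IT HT] dT [IS HS] TS lamh lamhat lh lhat uh uhat Ph Phat].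
  by rewrite sqrtr_gt0.
have bound (U : triangulation R) mu l w : nvb_triangulation Omega Tinit U ->
    mesh_le U delta2 -> discrete_eigenpair Omega p Tinit j u U mu l w -> l <= L.
  move=> IU dU [Hmu mul _ _]; have [_ _ h _] := hprop U IU dU.
  have [_ _ _ + _] := h mu Hmu; rewrite mul lte_fin; exact: ltW.
have lL := bound T lamh lh uh (conj IT HT) dT Ph.
(* The refinement inherits the mesh size bound, so property (iii) is available for it as well. *)
have lL' := bound S lamhat lhat uhat (conj IS HS) (mesh_le_nvb TS dT) Phat.
have [_ _ Eh _] := Ph; have [_ _ Ehat _] := Phat.
have [[Vh _] _] := Eh; have [[Vhat _] _] := Ehat.
have Hh := hier_H20 oO bO Vh; have Hhat := hier_H20 oO bO Vhat.
have He := H20_sub oO bO Hhat Hh; have mO := open_measurable_plane oO.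
have Lg : L2 Omega (fun x => lhat * uhat x - lh * uh x).
  exact: (sqintB mO (sqintZ mO lhat (H20_L2 Hhat)) (sqintZ mO lh (H20_L2 Hh))).
have H := HC amax T S uh uhat lh lhat HT HS TS (nvb_shape IS shp)
  (fun K => hier_piece Vh) (fun K => hier_piece Vhat) He Lg.
apply: (le_trans H); rewrite /norm_a -sqrtrM ?(ltW Q0)//.
have A0 := form_a_ge0 Omega (uhat \- uh).
rewrite ler_sqrt; last by rewrite mulr_ge0// ltW.
rewrite /Q -[leRHS]mulrA; apply: ler_wpM2l; first by rewrite ltW// mulr_gt0.
rewrite [leRHS]mulrDl; apply: lerD; last exact: lexx.
exact: (HC' L lh lhat _ _ uh uhat (ltW L0) lL lL' Hh Hhat Eh Ehat).
Qed.
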